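(* Let $d=1$ and suppose there exists a strong Markovian coupling of the environment with expectation $\widehat{\mathbb{E}}^E$ satisfying $$\int_0^\infty t\, \sup_{\eta,\xi\in\Omega}\widehat{\mathbb{E}}^E_{\eta,\xi}\,\rho(\eta^1_t(0),\eta^2_t(0))\,dt<\infty .$$ Let $\alpha_\epsilon:\Omega\times\mathbb{Z}\to[0,\infty)$, $\epsilon\ge0$, be admissible jump rates such that $\epsilon\mapsto\alpha_\epsilon(\eta,z)$ is differentiable at $0$ (derivative denoted $\alpha_0'(\eta,z)$), $\alpha_0(\eta,z)=\alpha_0(z)$ does not depend on $\eta$, and $|||\alpha_\epsilon-\alpha_0|||_1\le C\epsilon$ for some constant $C>0$. Let $v_\epsilon$ be the asymptotic speed of the walker with rates $\alpha_\epsilon$ and $\mu^E$ the ergodic measure of the environment. Then the Einstein relation $$\lim_{\epsilon\to0}\frac{v_\epsilon-v_0}{\epsilon}=\sigma_0^2,\qquad \sigma_0^2:=\sum_{z\in\mathbb{Z}}z^2\alpha_0(z),$$ holds if and only if $$\sum_{z\in\mathbb{Z}}z\int\alpha_0'(\eta,z)\,\mu^E(d\eta)=\sum_{z\in\mathbb{Z}}z^2\alpha_0(z).$$ In particular, the Einstein relation holds if $\int\alpha_0'(\eta,z)\,\mu^E(d\eta)=z\,\alpha_0(z)$ for all $z\in\mathbb{Z}$.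
   Context: Setting (with $d=1$). $(E,\rho)$ is a compact Polish space with metric $\rho\le 1$, $\Omega=E^{\mathbb{Z}}$ (product topology). Shifts: $\theta_x\eta(y)=\eta(y-x)$. The environment $(\eta_t)_{t\ge0}$ is a Feller process on $\Omega$ with path measures $\mathbb{P}^E_\eta$, generator $L^E$ and semigroup $S^E_t$ on $\mathcal{C}(\Omega;\mathbb{R})$; it is translation invariant: $\mathbb{P}^E_\eta(\theta_x\eta_t\in\cdot)=\mathbb{P}^E_{\theta_x\eta}(\eta_t\in\cdot)$. For $x\in\mathbb{Z}$, $(\Omega\times\Omega)_x=\{(\eta,\xi)\in\Omega^2:\eta(x)\ne\xi(x),\ \eta(y)=\xi(y)\ \forall y\ne x\}$. For $f:\Omega\to\mathbb{R}$, $\delta_f(x)=\sup_{(\eta,\xi)\in(\Omega\times\Omega)_x}\frac{f(\eta)-f(\xi)}{\rho(\eta(x),\xi(x))}$ and $|||f|||=\sum_{x}\delta_f(x)$. Walker: jump rates $\alpha:\Omega\times\mathbb{Z}\to[0,\infty)$, continuous in the first argument; the walker $X_t$ on $\mathbb{Z}$ jumps from $x$ to $x+z$ at rate $\alpha(\theta_{-x}\eta_t,z)$. Rates are admissible if $\|\alpha\|_1:=\sum_z|z|\sup_\eta|\alpha(\eta,z)|<\infty$ and $|||\alpha|||:=\sum_z|||\alpha(\cdot,z)|||<\infty$. For $\beta:\Omega\times\mathbb{Z}\to\mathbb{R}$, $|||\beta|||_1:=\sum_z|z|\,|||\beta(\cdot,z)|||$. The environment process $\theta_{-X_t}\eta_t$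 is the Markov process on $\Omega$ with generator $L^{EP}f(\eta)=L^Ef(\eta)+\sum_z\alpha(\eta,z)[f(\theta_{-z}\eta)-f(\eta)]$; under the coupling hypothesis of the claim it has a unique ergodic probability measure $\mu^{EP}$, the environment has a unique ergodic measure $\mu^E$, and the walker has asymptotic speed $\lim_{T\to\infty}X_T/T=\int\sum_z z\,\alpha(\eta,z)\,\mu^{EP}(d\eta)$ (a.s.). A strong Markovian coupling of the environment is a family of laws $\widehat{\mathbb{P}}^E_{\eta,\xi}$ (expectation $\widehat{\mathbb{E}}^E_{\eta,\xi}$) making $(\eta^1_t,\eta^2_t)_{t\ge0}$ a strong Markov process on $\Omega\times\Omega$ started from $(\eta,\xi)$ whose marginals have laws $\mathbb{P}^E_\eta$ and $\mathbb{P}^E_\xi$.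
   Formalization: The formal theorem adds the hypothesis that, for every η, Σ_z |z| |(α_ε(η,z)−α_0(z))/ε − α_0'(η,z)| → 0 as ε→0; without it the claim fails, e.g. for α_ε(z)=α_0(z)+ε²[z=⌈1/ε⌉] with α_0(±1)=1/2. *)

(* Defs.v *)
From HB Require Import structures.
From mathcomp Require Import all_boot all_order all_algebra.
From mathcomp Require Import all_classical all_reals all_analysis.

Set Implicit Arguments.
Unset Strict Implicit.
Unset Printing Implicit Defensive.

Import Order.TTheory GRing.Theory Num.Theory.
Import numFieldNormedType.Exports.

Local Open Scope classical_set_scope.
Local Open Scope ring_scope.

(* Measurable spaces are pointed in the library, so the (nonempty) space E of
   single-site values is a pointed metric space. *)
#[short(type="pmetricType")]
HB.structure Definition PointedMetric (K : numDomainType) :=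
  {M of Metric K M & Pointed M}.

(* The library makes products topological and pointed, but not both at once. *)
HB.instance Definition _ (S T : ptopologicalType) := Pointed.on (S * T)%type.

Notation borel S := (g_sigma_algebraType (@open S)).

(* The library has no nonnegative time axis: a path is a function on R of which
   only the restriction to [0, +oo[ is ever observed. *)
Definition cadlag {R : realType} {S : topologicalType} (w : R -> S) :=
  forall t, 0 <= t ->
    w @ t^'+ --> w t /\ (0 < t -> exists l : S, w @ t^'- --> l).

Record path (R : realType) (S : ptopologicalType) := Path {
  path_fun :> R -> S;
  path_cadlag : cadlag path_fun }.

Lemma cadlag_cst (R : realType) (S : ptopologicalType) (x : S) :
  cadlag (fun _ : R => x).
Proof. by move=> t _; split=> [|_]; [|exists x]; exact: cvg_cst. Qed.

HB.instance Definition _ (R : realType) (S : ptopologicalType) :=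
  gen_eqMixin (path R S).
HB.instance Definition _ (R : realType) (S : ptopologicalType) :=
  gen_choiceMixin (path R S).
HB.instance Definition _ (R : realType) (S : ptopologicalType) :=
  isPointed.Build (path R S) (Path (@cadlag_cst R S point)).

Lemma cadlag_comp (R : realType) (S T : ptopologicalType) (f : S -> T)
  (w : path R S) : continuous f -> cadlag (f \o w).
Proof.
move=> cf t t0; have [wr wl] := path_cadlag w t0; split.
  exact: (cvg_comp _ _ wr (cf _)).
by move=> /wl[l wtl]; exists (f l); exact: (cvg_comp _ _ wtl (cf _)).
Qed.

Definition path_map (R : realType) (S T : ptopologicalType) (f : S -> T)
  (cf : continuous f) (w : path R S) : path R T := Path (cadlag_comp w cf).

Definition path1 {R : realType} {S T : ptopologicalType} :=
  @path_map R (S * T)%type S fst (fun _ => cvg_fst).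

Definition path2 {R : realType} {S T : ptopologicalType} :=
  @path_map R (S * T)%type T snd (fun _ => cvg_snd).

(* The sigma-algebra on paths is the one generated by the coordinate maps. *)
Definition cylinders (R : realType) (S : ptopologicalType) :
    set (set (path R S)) :=
  [set A | exists (t : R) (U : set S),
    [/\ 0 <= t, open U & A = [set w : path R S | U (w t)]]].

Notation pathM R S := (g_sigma_algebraType (@cylinders R S)).

Definition past {R : realType} (S : ptopologicalType) (t : R) :
    set (set (path R S)) :=
  <<s [set A | exists (s : R) (U : set S),
         [/\ 0 <= s <= t, open U & A = [set w : path R S | U (w s)]]] >>.

Notation process R S := (R.-pker (borel S) ~> (pathM R S)).

Section processes.
Context {R : realType} {S : ptopologicalType}.
Implicit Types (P : process R S) (f g : S -> R) (x : S).

Definition started P :=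
  forall x, P x [set w : path R S | w 0 = x] = 1%E.

Definition markov P := started P /\
  forall x (s t : R), 0 <= s -> 0 <= t ->
  forall (A : set (path R S)), past s A ->
  forall B : set (borel S), measurable B ->
    P x (A `&` [set w : path R S | B (w (s + t))]) =
    (\int[P x]_(w in A) P (w s) [set u : path R S | B (u t)])%E.

Definition stopping_time (tau : path R S -> \bar R) :=
  (forall w, 0 <= tau w)%E /\
  forall t : R, 0 <= t -> past t [set w | (tau w <= t%:E)%E].

Definition past_stopping (tau : path R S -> \bar R) : set (set (path R S)) :=
  [set A | measurable (A : set (pathM R S)) /\
    forall t : R, 0 <= t -> past t (A `&` [set w | (tau w <= t%:E)%E])].

Definition strong_markov P := started P /\
  forall x (tau : path R S -> \bar R), stopping_time tau ->
  forall t : R, 0 <= t ->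
  forall A, past_stopping tau A -> forall B : set (borel S), measurable B ->
    let F := A `&` [set w | (tau w < +oo)%E] in
    P x (F `&` [set w : path R S | B (w (fine (tau w) + t))]) =
    (\int[P x]_(w in F) P (w (fine (tau w))) [set u : path R S | B (u t)])%E.

Definition semigroup P (t : R) f x : R := \int[P x]_w f (w t).

Definition unif_at0 (F : R -> S -> R) (g : S -> R) :=
  forall e : R, 0 < e ->
    \forall t \near 0^'+, forall x, `|F t x - g x| < e.

Definition feller P := [/\ markov P,
  forall t f, 0 <= t -> continuous f -> continuous (semigroup P t f) &
  forall f, continuous f -> unif_at0 (fun t => semigroup P t f) f].

(* The graph of the generator: f is in the domain and is mapped to g. *)
Definition generator P f g := [/\ continuous f, continuous g &
  unif_at0 (fun t x => (semigroup P t f x - f x) / t) g].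

Definition invariant P (mu : probability (borel S) R) :=
  forall t : R, 0 <= t -> forall B : set (borel S), measurable B ->
    (\int[mu]_x P x [set w : path R S | B (w t)])%E = mu B.

Definition ergodic P (mu : probability (borel S) R) := invariant P mu /\
  forall B : set (borel S), measurable B ->
    (forall t : R, 0 <= t ->
      {ae mu, forall x, P x [set w : path R S | B (w t)] = (\1_B x)%:E}) ->
    mu B = 0%E \/ mu B = 1%E.

(* Unique ergodicity in the usual sense: there is no other invariant
   probability measure. *)
Definition unique_ergodic P (mu : probability (borel S) R) :=
  ergodic P mu /\
  forall nu : probability (borel S) R, invariant P nu ->
    forall B : set (borel S), measurable B -> nu B = mu B.

End processes.

Definition config {R : realType} (E : pmetricType R) :=
  prod_topology (fun _ : int => E).

HB.instance Definition _ (R : realType) (E : pmetricType R) :=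
  Topological.on (config E).
HB.instance Definition _ (R : realType) (E : pmetricType R) :=
  isPointed.Build (config E) (fun _ => point).

(* The walker lives on the integers with the discrete topology. *)
Definition site : Type := discrete_topology int.
HB.instance Definition _ := DiscreteTopology.copy site (discrete_topology int).
HB.instance Definition _ := isPointed.Build site 0.

(* An unconditional sum of signed terms, defined like the integral with respect
   to the counting measure. *)
Definition sumZ {R : realType} (u : int -> \bar R) : \bar R :=
  (\esum_(z in [set: int]) u^\+ z - \esum_(z in [set: int]) u^\- z)%E.

Section environment.
Context {R : realType} {E : pmetricType R}.
Local Notation Omega := (config E).
Implicit Types (eta xi : Omega) (f : Omega -> R) (alpha beta : Omega -> int -> R).

Definition shift (x : int) eta : Omega := fun y => eta (y - x).

Definition translation_invariant (P : process R Omega) :=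
  forall (x : int) eta (t : R), 0 <= t ->
  forall B : set (borel Omega), measurable B ->
    P eta [set w : path R Omega | B (shift x (w t))] =
    P (shift x eta) [set w : path R Omega | B (w t)].

Definition differ_only_at (x : int) : set (Omega * Omega) :=
  [set p | p.1 x <> p.2 x /\ forall y, y != x -> p.1 y = p.2 y].

(* The 0 only matters when E is a single point: then no two configurations
   differ, and the supremum of the empty set is to be read as 0. *)
Definition delta f (x : int) : \bar R :=
  ereal_sup ([set 0%E] `|`
    [set ((f p.1 - f p.2) / mdist (p.1 x) (p.2 x))%:E | p in differ_only_at x]).

Definition tnorm f : \bar R := (\esum_(x in [set: int]) delta f x)%E.

Definition rates_norm1 alpha : \bar R :=
  (\esum_(z in [set: int]) (`|z|%:~R)%:E *
     ereal_sup [set `|alpha eta z|%:E | eta in [set: Omega]])%E.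

Definition rates_tnorm alpha : \bar R :=
  (\esum_(z in [set: int]) tnorm (alpha ^~ z))%E.

Definition rates_tnorm1 beta : \bar R :=
  (\esum_(z in [set: int]) (`|z|%:~R)%:E * tnorm (beta ^~ z))%E.

Definition jump_rates alpha :=
  (forall eta z, 0 <= alpha eta z) /\ (forall z, continuous (alpha ^~ z)).

Definition admissible alpha :=
  (rates_norm1 alpha < +oo)%E /\ (rates_tnorm alpha < +oo)%E.

Definition strong_markov_coupling (P : process R Omega)
    (Q : process R (Omega * Omega)%type) := [/\ strong_markov Q,
  forall eta xi (A : set (pathM R Omega)), measurable A ->
    Q (eta, xi) (path1 @^-1` A) = P eta A &
  forall eta xi (A : set (pathM R Omega)), measurable A ->
    Q (eta, xi) (path2 @^-1` A) = P xi A].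

Definition discrepancy (Q : process R (Omega * Omega)%type) (t : R) : \bar R :=
  ereal_sup [set (\int[Q p]_w (mdist ((w t).1 0) ((w t).2 0))%:E)%E
            | p in [set: Omega * Omega]].

(* The part of the joint generator of environment and walker that comes from
   the jumps of the walker. *)
Definition jump_part alpha (f : Omega * site -> R) (p : Omega * site) : R :=
  fine (sumZ (fun z =>
    (alpha (shift (- (p.2 : int)) p.1) z *
      (f (p.1, ((p.2 : int) + z : site)) - f p))%:E)).

(* W is the law of (eta_t, X_t)_t, where eta is the environment and X jumps from
   x to x + z at rate alpha (shift (- x) eta_t) z: a Markov process whose first
   component has law P, and whose generator is
     f |-> L^E f(., x)(eta) + sum_z alpha (shift (- x) eta) z
                                     (f (eta, x + z) - f (eta, x)),
   stated through Kolmogorov's forward equation for the bounded f for which the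
   right-hand side makes sense and is bounded. *)
Definition walker (P : process R Omega) alpha
    (W : process R (Omega * site)%type) := [/\ markov W,
  forall eta x (A : set (pathM R Omega)), measurable A ->
    W (eta, x) (path1 @^-1` A) = P eta A &
  forall f g : Omega * site -> R,
    (exists M : R, forall p, `|f p| <= M /\ `|g p| <= M) ->
    (forall x : site,
      generator P (fun eta => f (eta, x)) (fun eta => g (eta, x))) ->
    forall p (t : R), 0 <= t ->
      semigroup W t f p = f p + \int[@lebesgue_measure R]_(s in `[0, t])
        semigroup W s (g \+ jump_part alpha f) p].

Definition asymptotic_speed (W : process R (Omega * site)%type) (v : R) :=
  forall eta, {ae W (eta, 0 : site), forall w : path R (Omega * site)%type,
    ((w T).2 : int)%:~R / T @[T --> +oo] --> v}.

End environment.

(* Main.v *)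
(* The time averages of f over the environment seen from the walker with rates
   alpha_e have limit points Lam_e, which are means (positive normalized linear
   functionals) on the continuous functions. By Kolmogorov's forward equation
   Lam_e maps the drift sum_z z alpha_e(., z) to the speed v_e, hence
   (v_e - v_0) / e = Lam_e(g_e) for g_e = sum_z z (alpha_e - alpha_0)(., z) / e,
   because v_0 = sum_z z alpha_0(z) is the integral of a constant; and Lam_e almost
   annihilates L^E F + J F, where J is the generator of the walk with the rates
   alpha_0, when e is small. A limit point Lam of Lam_e as e -> 0 is therefore
   stationary for the environment seen from an independent walk. Two independent
   jump clocks started k jumps apart can be made to agree up to small errors, so Lam
   is invariant under the jumps, hence under the environment; by the Riesz
   representation and unique ergodicity Lam is the integral with respect to mu^E.

   It remains to pass to the limit in Lam_e(g_e). The functions g_e converge as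
   e -> 0 uniformly in the environment: pointwise convergence in the weighted l^1
   norm is the hypothesis on the derivative, and a gliding hump argument makes it
   uniform, since the bound on |||alpha_e - alpha_0|||_1 makes these functions
   Lipschitz with weights of total mass at most C. *)
Require Import Defs.
From HB Require Import structures.
From mathcomp Require Import all_boot all_order all_algebra.
From mathcomp Require Import all_classical all_reals all_analysis.
From mathcomp Require Import measurable_realfun ring lra.

Set Implicit Arguments.
Unset Strict Implicit.
Unset Printing Implicit Defensive.

Import Order.TTheory GRing.Theory Num.Theory.
Import numFieldNormedType.Exports.

Local Open Scope classical_set_scope.
Local Open Scope ring_scope.

(** Only the forward equation of the joint law of environment and walker is given, for bounded
    functions that lie in the domain of the environment generator at each site. So the environment
    seen from the walker is handled through means tested on pairs [(F, G)] of that generator, and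
    time integrals of the semigroup supply enough such pairs. The walk with constant rates is
    [lam * (kernel - 1)] for a contraction [kernel] that commutes with the environment semigroup S
    by translation invariance. Stationarity then becomes an approximate mean value property of the
    array [c k s = L (kernel^k (S_s h))]. The largest gap between entries d jumps apart is bounded,
    is 0 at d = 0 and is convex in d up to small errors, hence vanishes. The drift is the generator
    applied to the position, which is unbounded. The position is therefore truncated at
    [(|v| + 2) T], a level far from where the walker typically is up to time T. The gliding hump is
    run on differences of two slopes of the rates, because Lipschitz weights are given for
    [alpha e - alpha 0] and not for [alpha']. *)

(** * Comparison of integrals of functions not known to be measurable *)

Section monotone_integral.
Context d (T : measurableType d) (R : realType).
Variable mu : {measure set T -> \bar R}.

Lemma ge0_le_integral_nm (D : set T) (f g : T -> \bar R) :
  (forall x, D x -> (0 <= f x)%E) -> (forall x, D x -> (f x <= g x)%E) ->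
  (\int[mu]_(x in D) f x <= \int[mu]_(x in D) g x)%E.
Proof.
move=> f0 fg; rewrite !ge0_integralE//; last first.
  by move=> x Dx; exact: le_trans (f0 x Dx) (fg x Dx).
apply: le_ereal_sup => _ [h /= hf <-]; exists h => //= x.
apply: (le_trans (hf x)); rewrite /patch; case: ifPn => // /set_mem; exact: fg.
Qed.

(* The integral of the library is a supremum over simple functions, so that no
   measurability is needed here. *)
Lemma le_integral_nm (D : set T) (f g : T -> \bar R) :
  (forall x, D x -> (f x <= g x)%E) ->
  (\int[mu]_(x in D) f x <= \int[mu]_(x in D) g x)%E.
Proof.
move=> fg; rewrite [leLHS]integralE [leRHS]integralE; apply: leeB.
- by apply: ge0_le_integral_nm => // x Dx; rewrite !funeposE le_max2//; exact: fg.
- apply: ge0_le_integral_nm => // x Dx; rewrite !funenegE ge_max !le_max lexx orbT.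
  by rewrite leeN2 fg.
Qed.

Lemma integral_bound_nm (D : set T) (f : T -> R) (a b : R) : measurable D ->
  (mu D < +oo)%E ->
  (forall x, D x -> a <= f x <= b) ->
  (a%:E * mu D <= \int[mu]_(x in D) (f x)%:E <= b%:E * mu D)%E.
Proof.
move=> mD mDoo fab; rewrite -!integral_cst//; apply/andP; split;
  by apply: le_integral_nm => x /fab /andP[]; rewrite lee_fin.
Qed.

(** The common bound keeps both integrals finite: [fine] sends the infinities to 0 and preserves the
    order on finite values only. *)
Lemma le_Rintegral_nm (D : set T) (f g : T -> R) (M : R) : measurable D ->
  (mu D < +oo)%E -> (forall x, D x -> `|f x| <= M) ->
  (forall x, D x -> `|g x| <= M) -> (forall x, D x -> f x <= g x) ->
  \int[mu]_(x in D) f x <= \int[mu]_(x in D) g x.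
Proof.
move=> mD mDoo fM gM fg.
have fnu : mu D \is a fin_num by rewrite ge0_fin_numE.
have fin h : (forall x, D x -> `|h x| <= M) ->
    (\int[mu]_(x in D) (h x)%:E)%E \is a fin_num.
  move=> hM; have /(integral_bound_nm mD mDoo) /andP[l u] :
      forall x, D x -> - M <= h x <= M.
    by move=> x Dx; rewrite -ler_norml hM.
  rewrite fin_numElt (lt_le_trans _ l) ?(le_lt_trans u)//.
    by rewrite ltey_eq fin_numM.
  by rewrite ltNye_eq fin_numM.
by apply: fine_le; [exact: fin|exact: fin|apply: le_integral_nm => x Dx;
  rewrite lee_fin; exact: fg].
Qed.

End monotone_integral.

(** * Expectations of bounded functions *)

Section bounded_expectation.
Context d (T : measurableType d) (R : realType).
Variable mu : {measure set T -> \bar R}.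
Hypothesis mu1 : mu setT = 1%E.

Lemma bounded_integrable (f : T -> R) (M : R) : measurable_fun setT f ->
  (forall x, `|f x| <= M) -> mu.-integrable setT (EFin \o f).
Proof.
move=> mf fM; apply: measurable_bounded_integrable => //.
  by rewrite [ltLHS]mu1 ltry.
exists M; split; first exact: num_real.
move=> N MN x _ /=; exact: le_trans (fM x) (ltW MN).
Qed.

Lemma expectation_cst (c : R) : \int[mu]_x c = c.
Proof. by rewrite Rintegral_cst// mu1 /= mulr1. Qed.

Lemma expectation_le (f g : T -> R) (M : R) : (forall x, `|f x| <= M) ->
  (forall x, `|g x| <= M) -> (forall x, f x <= g x) ->
  \int[mu]_x f x <= \int[mu]_x g x.
Proof.
move=> fM gM fg; apply: (@le_Rintegral_nm _ _ _ _ _ _ _ M) => //.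
by rewrite [ltLHS]mu1 ltry.
Qed.

Lemma expectation_bound (f : T -> R) (M : R) : (forall x, `|f x| <= M) ->
  `|\int[mu]_x f x| <= M.
Proof.
move=> fM; have fM' x : `| `|f x| | <= M by rewrite normr_id.
have cM : `|M| <= M by rewrite ger0_norm// (le_trans (normr_ge0 _) (fM point)).
have cN : `|- M| <= M by rewrite normrN cM.
rewrite ler_norml -[X in X <= _ <= _]expectation_cst -[X in _ <= _ <= X]expectation_cst.
apply/andP; split; apply: (@expectation_le _ _ M) => // x.
- by have := fM x; rewrite ler_norml => /andP[].
- exact: le_trans (ler_norm _) (fM x).
Qed.

(** As [f] need not be measurable, the integral of [f - g] cannot be split. Instead [f] is squeezed
    between [g - c] and [g + c], so that additivity is applied to [g] alone. *)
Lemma expectation_near (f g : T -> R) (M c : R) : (forall x, `|f x| <= M) ->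
  measurable_fun setT g -> (forall x, `|f x - g x| <= c) ->
  `|\int[mu]_x f x - \int[mu]_x g x| <= c.
Proof.
move=> fM mg fg.
have c0 : 0 <= c by exact: le_trans (normr_ge0 _) (fg point).
have gM x : `|g x| <= M + c.
  rewrite -[g x](subrK (f x)) (le_trans (ler_normD _ _))// addrC lerD//.
  by rewrite distrC.
have ig : mu.-integrable setT (EFin \o g) by exact: (bounded_integrable mg gM).
have ic : mu.-integrable setT (EFin \o (fun=> c)).
  by apply: (@bounded_integrable _ c) => // x; rewrite ger0_norm.
have fM' x : `|f x| <= M + c + c by rewrite -addrA ler_wpDr// addr_ge0.
have g1 x : `|g x + c| <= M + c + c.
  by rewrite (le_trans (ler_normD _ _))// lerD// ger0_norm.
have g2 x : `|g x - c| <= M + c + c.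
  by rewrite (le_trans (ler_normB _ _))// lerD// ger0_norm.
have h1 : \int[mu]_x f x <= \int[mu]_x (g x + c).
  apply: expectation_le fM' g1 _ => x.
  by have := fg x; rewrite ler_norml => /andP[_]; rewrite lerBlDl.
have h2 : \int[mu]_x (g x - c) <= \int[mu]_x f x.
  apply: expectation_le g2 fM' _ => x.
  by have := fg x; rewrite ler_norml => /andP[+ _]; rewrite lerBrDl.
rewrite RintegralD// expectation_cst in h1.
rewrite RintegralB// expectation_cst in h2.
by rewrite ler_norml lerBrDl h2 lerBlDl h1.
Qed.

Lemma expectationD (f g : T -> R) (M N : R) :
  measurable_fun setT f -> measurable_fun setT g ->
  (forall x, `|f x| <= M) -> (forall x, `|g x| <= N) ->
  \int[mu]_x (f x + g x) = \int[mu]_x f x + \int[mu]_x g x.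
Proof.
by move=> mf mg fM gN; apply: RintegralD => //;
  [exact: (bounded_integrable mf fM)|exact: (bounded_integrable mg gN)].
Qed.

Lemma expectationZ (f : T -> R) (M c : R) : measurable_fun setT f ->
  (forall x, `|f x| <= M) -> \int[mu]_x (c * f x) = c * \int[mu]_x f x.
Proof.
by move=> mf fM; apply: RintegralZl => //; exact: (bounded_integrable mf fM).
Qed.

End bounded_expectation.

(** * Borel functions and the coordinate maps on paths *)

Section borel_functions.
Context (R : realType) (S : ptopologicalType).

Lemma open_borel (U : set S) : open U -> measurable (U : set (borel S)).
Proof. exact: sub_sigma_algebra. Qed.

Lemma continuous_borel (f : S -> R) : continuous f ->
  measurable_fun [set: borel S] (f : borel S -> R).
Proof.
move=> cf; apply: (measurability _ (RGenOInfty.measurableE R)) => //.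
move=> _ [_ [x ->] <-]; rewrite setTI; apply: open_borel.
by apply: open_comp => //; exact: rray_open.
Qed.

Lemma measurable_eval (t : R) : 0 <= t ->
  measurable_fun [set: pathM R S] (fun w : Defs.path R S => w t : borel S).
Proof.
move=> t0; apply: (@measurability _ _ _ (borel S) _ _ (@open S)) => //.
move=> _ [U oU <-]; rewrite setTI; apply: sub_sigma_algebra.
by exists t, U.
Qed.

End borel_functions.

Section transition.
Context (R : realType) (S : ptopologicalType) (P : process R S).

Lemma process_total x : P x setT = 1%E.
Proof. exact: prob_kernel. Qed.

Lemma measurable_path_eval (f : S -> R) (t : R) : continuous f -> 0 <= t ->
  measurable_fun [set: pathM R S] (fun w : Defs.path R S => f (w t)).
Proof.
move=> cf t0.
exact: (measurableT_comp (continuous_borel cf) (measurable_eval t0)).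
Qed.

Lemma measurable_transition (t : R) (B : set (borel S)) : 0 <= t ->
  measurable B ->
  measurable_fun [set: borel S] (fun x => P x [set w : Defs.path R S | B (w t)]).
Proof.
move=> t0 mB; apply: measurable_kernel.
by rewrite -[X in measurable X]setTI; exact: measurable_eval.
Qed.

End transition.

(** * Step functions and integration against a mixture of measures *)

Section staircase.
Context (R : realType).

(** The sum counts the integers in [[1, y]], so it is the integer part of [y]. *)
Lemma staircase_sum (n : nat) (y : R) : 0 <= y <= n%:R ->
  \sum_(i < n) ((i.+1%:R <= y)%R)%:R <= y <= \sum_(i < n) ((i.+1%:R <= y)%R)%:R + 1.
Proof.
elim: n => [|n IHn] /andP[y0 yn]; first by rewrite big_ord0 add0r y0 (le_trans yn)//.
rewrite big_ord_recr/=; have [ny|yn'] := leP n%:R y; last first.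
  have /negbTE -> : ~~ (n.+1%:R <= y) by rewrite -ltNge (lt_le_trans yn')// ler_nat.
  by rewrite addr0 IHn// y0 ltW.
rewrite (eq_bigr (fun=> 1)) => [|i _]; last first.
  by rewrite (le_trans _ ny)// ler_nat ltn_ord.
rewrite sumr_const card_ord; case: (leP n.+1%:R y) => [ny'|yn'].
  have -> : y = n.+1%:R by apply/eqP; rewrite eq_le yn ny'.
  by rewrite natr1 lexx lerDl ler01.
by rewrite addr0 ny natr1 ltW.
Qed.

(** For values in [[0, 1]]: [f] rounded down to a multiple of [1/(n+1)], written with indicators of
    superlevel sets so that linearity reduces it to sets. *)
Definition staircase (T : Type) (n : nat) (f : T -> R) (x : T) : R :=
  n.+1%:R^-1 * \sum_(i < n.+1) \1_[set x | i.+1%:R <= n.+1%:R * f x] x.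

Lemma staircaseP (T : Type) (n : nat) (f : T -> R) (x : T) : 0 <= f x <= 1 ->
  staircase n f x <= f x <= staircase n f x + n.+1%:R^-1.
Proof.
move=> /andP[f0 f1]; rewrite /staircase.
have /(@staircase_sum n.+1) : 0 <= n.+1%:R * f x <= n.+1%:R.
  by rewrite mulr_ge0//= ler_piMr.
rewrite (eq_bigr (fun i : 'I_n.+1 => \1_[set x | i.+1%:R <= n.+1%:R * f x] x)); last first.
  by move=> i _; rewrite indicE mem_setE.
set s := \sum_(_ < _) _ => /andP[su us].
have n0 : 0 < n.+1%:R :> R by [].
rewrite -[_ + n.+1%:R^-1]/(_) -[X in _ + X]mulr1 -mulrDr.
by rewrite !ler_pdivrMl// ler_pdivlMl// su us.
Qed.

End staircase.

Section mixture.
Context d1 d2 d3 d4 (X : measurableType d1) (Y1 : measurableType d2)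
  (Y2 : measurableType d3) (Z : measurableType d4) (R : realType).
Variables (m : {measure set X -> \bar R}) (nu : {measure set Y1 -> \bar R})
  (k : X -> {measure set Y2 -> \bar R}) (e1 : Y1 -> Z) (e2 : Y2 -> Z).
Hypotheses (m1 : m setT = 1%E) (nu1 : nu setT = 1%E)
  (k1 : forall x, k x setT = 1%E).
Hypotheses (me1 : measurable_fun setT e1) (me2 : measurable_fun setT e2).
Hypothesis mk : forall B : set Z, measurable B ->
  measurable_fun setT (fun x => k x (e2 @^-1` B)).
Hypothesis nuE : forall B : set Z, measurable B ->
  nu (e1 @^-1` B) = (\int[m]_x k x (e2 @^-1` B))%E.

Let mixes (f : Z -> R) := [/\ measurable_fun setT f, exists M : R, forall z, `|f z| <= M,
  measurable_fun setT (fun x => \int[k x]_y f (e2 y)) &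
  \int[nu]_y f (e1 y) = \int[m]_x \int[k x]_y f (e2 y)].

Let mixes_indic (B : set Z) : measurable B -> mixes \1_B.
Proof.
move=> mB.
have m2 : measurable (e2 @^-1` B) by rewrite -[X in measurable X]setTI; exact: me2.
have m1' : measurable (e1 @^-1` B) by rewrite -[X in measurable X]setTI; exact: me1.
have kE x : \int[k x]_y (\1_B (e2 y) : R) = fine (k x (e2 @^-1` B)).
  by rewrite /Rintegral integral_indic ?setIT.
have kf x : k x (e2 @^-1` B) \is a fin_num.
  rewrite ge0_fin_numE// (@le_lt_trans _ _ (k x setT))//.
    by apply: le_measure; rewrite ?inE.
  by rewrite [ltLHS]k1 ltry.
split.
- exact: measurable_indic.
- by exists 1 => z; rewrite indicE normr_nat; case: (_ \in _).
- under eq_fun do rewrite kE.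
  by apply: measurableT_comp => //; exact: mk.
- under [RHS]eq_Rintegral do rewrite kE.
  rewrite /Rintegral [in LHS]integral_indic ?setIT// nuE//.
  by congr fine; apply: eq_integral => x _; rewrite fineK.
Qed.

Let mixesD (f g : Z -> R) : mixes f -> mixes g -> mixes (fun z => f z + g z).
Proof.
move=> [mf [M fM] mkf Ef] [mg [N gN] mkg Eg].
have kD x : \int[k x]_y (f (e2 y) + g (e2 y)) =
    \int[k x]_y f (e2 y) + \int[k x]_y g (e2 y).
  by apply: (@expectationD _ _ _ _ (k1 x) _ _ M N) => //;
    exact: measurableT_comp.
split.
- exact: measurable_funD.
- by exists (M + N) => z; rewrite (le_trans (ler_normD _ _))// lerD.
- by under eq_fun do rewrite kD; exact: measurable_funD.
- rewrite (@expectationD _ _ _ _ nu1 _ _ M N)//; last 2 first.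
  + exact: measurableT_comp.
  + exact: measurableT_comp.
  under [RHS]eq_Rintegral do rewrite kD.
  rewrite (@expectationD _ _ _ _ m1 _ _ M N) ?Ef ?Eg// => x.
  + by apply: (@expectation_bound _ _ _ _ (k1 x) (f \o e2) M) => y; exact: fM.
  + by apply: (@expectation_bound _ _ _ _ (k1 x) (g \o e2) N) => y; exact: gN.
Qed.

Let mixesZ (c : R) (f : Z -> R) : mixes f -> mixes (fun z => c * f z).
Proof.
move=> [mf [M fM] mkf Ef].
have kZ x : \int[k x]_y (c * f (e2 y)) = c * \int[k x]_y f (e2 y).
  by apply: (@expectationZ _ _ _ _ (k1 x) _ M) => //; exact: measurableT_comp.
split.
- exact: measurable_funM.
- by exists (`|c| * M) => z; rewrite normrM ler_wpM2l.
- by under eq_fun do rewrite kZ; exact: measurable_funM.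
- rewrite (@expectationZ _ _ _ _ nu1 _ M)//; last exact: measurableT_comp.
  under [RHS]eq_Rintegral do rewrite kZ.
  rewrite (@expectationZ _ _ _ _ m1 _ M) ?Ef// => x.
  by apply: (@expectation_bound _ _ _ _ (k1 x) (f \o e2) M) => y; exact: fM.
Qed.

(** The hypothesis [nuE] is the case of indicators; linearity gives staircases, which approximate a
    function with values in [[0, 1]] uniformly. This is the passage from identities between sets to
    identities between functions: the Markov property, translation invariance and invariance of
    measures are all stated for sets. *)
Lemma expectation_mixture (f : Z -> R) (M : R) : measurable_fun setT f ->
  (forall z, `|f z| <= M) ->
  measurable_fun setT (fun x => \int[k x]_y f (e2 y)) ->
  \int[nu]_y f (e1 y) = \int[m]_x \int[k x]_y f (e2 y).
Proof.
move=> mf fM mkf.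
(* The affine change to [g] brings the values into [[0, 1]], and [E1], [E2] undo it; the [+ 1] keeps
   [N] positive. *)
pose N := `|M| + 1; have N0 : 0 < N by rewrite ltr_pwDr.
pose g z := (2 * N)^-1 * (f z + N).
have g01 z : 0 <= g z <= 1.
  have : `|f z| <= N by rewrite (le_trans (fM z))// (le_trans (ler_norm _))// lerDl.
  rewrite ler_norml => /andP[f1 f2]; rewrite mulr_ge0//=.
  - by rewrite ler_pdivrMl ?mulr_gt0// mulr1 mulrDl mul1r lerD2r.
  - by rewrite invr_ge0 mulr_ge0// ltW.
  - by rewrite -lerBlDr sub0r.
have mg : measurable_fun setT g.
  by apply: measurable_funM => //; exact: measurable_funD.
have stair n : mixes (staircase n g).
  have h j : mixes (fun z => \sum_(i < j) \1_[set x | i.+1%:R <= n.+1%:R * g x] z).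
    elim: j => [|j IHj].
      rewrite (_ : (fun=> _) = \1_set0); first exact: mixes_indic.
      by apply/funext => z; rewrite indic0 big_ord0.
    under eq_fun do rewrite big_ord_recr/=.
    apply: mixesD IHj _; apply: mixes_indic; rewrite -[X in measurable X]setTI.
    rewrite [X in _ `&` X](_ : _ = (fun z => n.+1%:R * g z) @^-1` `[j.+1%:R, +oo[).
      by apply: measurable_funM.
    by apply/seteqP; split => z; rewrite /= in_itv/= andbT.
  exact: (mixesZ n.+1%:R^-1 (h n.+1)).
have gle z : `|g z| <= 1 by rewrite ger0_norm; case/andP: (g01 z).
have near n z : `|g z - staircase n g z| <= n.+1%:R^-1.
  have /andP[h1 h2] := staircaseP n (g01 z).
  by rewrite ger0_norm ?subr_ge0// lerBlDl.
have kg x : \int[k x]_y g (e2 y) = (2 * N)^-1 * (\int[k x]_y f (e2 y) + N).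
  rewrite (@expectationZ _ _ _ _ (k1 x) _ (M + N)); last 2 first.
  - by apply: measurable_funD => //; exact: measurableT_comp.
  - by move=> y; rewrite (le_trans (ler_normD _ _))// lerD// ger0_norm// ltW.
  rewrite (@expectationD _ _ _ _ (k1 x) _ _ M N) ?expectation_cst//.
  - exact: measurableT_comp.
  - by move=> y; rewrite ger0_norm// ltW.
have mkg : measurable_fun setT (fun x => \int[k x]_y g (e2 y)).
  under eq_fun do rewrite kg.
  by apply: measurable_funM => //; exact: measurable_funD.
have gE : \int[nu]_y g (e1 y) = \int[m]_x \int[k x]_y g (e2 y).
  apply/eqP; rewrite -subr_eq0 -normr_le0; apply/ler_addgt0Pl => e e0.
  rewrite addr0.
  have [n ne] : exists n, n.+1%:R^-1 <= e / 2.
    have e20 : 0 < e / 2 by rewrite divr_gt0.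
    have [n _ hn] := near_infty_natSinv_lt (PosNum e20).
    by exists n; apply/ltW/hn => /=.
  have [ms [B sB] mks Es] := stair n.
  have d1' : `|\int[nu]_y g (e1 y) - \int[nu]_y staircase n g (e1 y)| <= e / 2.
    apply: (@expectation_near _ _ _ _ nu1 _ _ 1) => // [|y].
      exact: measurableT_comp.
    exact: le_trans (near _ _) ne.
  have d2' : `|\int[m]_x \int[k x]_y g (e2 y) -
             \int[m]_x \int[k x]_y staircase n g (e2 y)| <= e / 2.
    apply: (@expectation_near _ _ _ _ m1 _ _ 1) => // x.
      exact: expectation_bound.
    apply: (@expectation_near _ _ _ _ (k1 x) _ _ 1) => // [|y].
      exact: measurableT_comp.
    exact: le_trans (near _ _) ne.
  rewrite Es in d1'; rewrite distrC in d2'.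
  rewrite [e]splitr; apply: le_trans (lerD d1' d2').
  by apply: le_trans (ler_normD _ _); rewrite subrKA.
have Nn : `|N| <= N by rewrite ger0_norm// ltW.
have E1 : \int[nu]_y g (e1 y) = (2 * N)^-1 * (\int[nu]_y f (e1 y) + N).
  rewrite (@expectationZ _ _ _ _ nu1 _ (M + N)); last 2 first.
  - by apply: measurable_funD => //; exact: measurableT_comp.
  - by move=> y; rewrite (le_trans (ler_normD _ _))// lerD.
  rewrite (@expectationD _ _ _ _ nu1 _ _ M N) ?expectation_cst//.
  exact: measurableT_comp.
have E2 : \int[m]_x \int[k x]_y g (e2 y) =
    (2 * N)^-1 * (\int[m]_x \int[k x]_y f (e2 y) + N).
  have kfM x : `|\int[k x]_y f (e2 y)| <= M by exact: expectation_bound.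
  under eq_Rintegral do rewrite kg.
  rewrite (@expectationZ _ _ _ _ m1 _ (M + N)); last 2 first.
  - exact: measurable_funD.
  - by move=> y; rewrite (le_trans (ler_normD _ _))// lerD.
  by rewrite (@expectationD _ _ _ _ m1 _ _ M N) ?expectation_cst.
move: gE; rewrite E1 E2 => /mulfI; rewrite invr_eq0 mulf_neq0 ?gt_eqF//.
by move=> /(_ isT) /addIr.
Qed.

End mixture.

(** * Integrals over time of continuous functions *)

Section time_integral.
Context (R : realType).
Implicit Types (phi : R -> R) (a b c e : R).

(* The lower bound -1 makes every time t >= 0 interior, so that the
   derivative at 0 is two-sided. *)
Definition primitive phi (t : R) : R :=
  \int[@lebesgue_measure R]_(s in `[- 1, t]) phi s.

Definition tint phi (a b : R) : R := primitive phi b - primitive phi a.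

Lemma is_derive_primitive phi (t : R) : continuous phi -> -1 < t ->
  is_derive t 1 (primitive phi) (phi t).
Proof.
move=> cphi t1.
have ci : (@lebesgue_measure R).-integrable `[- 1, t + 1] (EFin \o phi).
  apply: continuous_compact_integrable; first exact: segment_compact.
  exact: continuous_subspaceT.
have t11 : t < t + 1 by rewrite ltrDl.
have [dF FE] := @continuous_FTC1_closed R phi (-1) t (t + 1)
  t11 ci t1 (cphi t).
apply: DeriveDef; first exact: dF.
by rewrite -derive1E; exact: FE.
Qed.

(** By the mean value theorem the integral is [b - a] times a value of [phi] on the segment. *)
Lemma primitive_mvt phi a b c e : continuous phi -> 0 <= a <= b ->
  (forall s, a <= s <= b -> `|phi s - c| <= e) ->
  `|tint phi a b - (b - a) * c| <= (b - a) * e.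
Proof.
move=> cphi /andP[a0 ab] phie; rewrite /tint.
have [||s sab ->] := @MVT_segment R (primitive phi) phi a b ab.
- move=> x; rewrite in_itv/= => /andP[ax _].
  by apply: is_derive_primitive => //; rewrite (lt_trans _ ax)// (lt_le_trans _ a0)// ltrN10.
- apply: derivable_within_continuous => x; rewrite in_itv/= => /andP[ax _].
  have [] // := @is_derive_primitive phi x cphi _.
  by rewrite (lt_le_trans _ ax)// (lt_le_trans _ a0)// ltrN10.
rewrite mulrC -mulrBr normrM ger0_norm ?subr_ge0// ler_wpM2l ?subr_ge0//.
by apply: phie; rewrite in_itv/= in sab.
Qed.

Lemma tint_cat phi a b c : tint phi a b + tint phi b c = tint phi a c.
Proof. by rewrite /tint addrC subrKA. Qed.

(** Each cell contributes at most its length times [e]. Operators that commute with finite sums can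
    thus be carried to the integral. *)
Lemma tint_riemann phi a n e : continuous phi -> 0 <= a ->
  (forall (k : nat) s, k%:R * (a / n.+1%:R) <= s <= k.+1%:R * (a / n.+1%:R) ->
     `|phi s - phi (k%:R * (a / n.+1%:R))| <= e) ->
  `|tint phi 0 a - \sum_(k < n.+1) a / n.+1%:R * phi (k%:R * (a / n.+1%:R))| <= a * e.
Proof.
move=> cphi a0 phie; set h := a / n.+1%:R in phie *.
have h0 : 0 <= h by rewrite divr_ge0.
have aE : a = n.+1%:R * h by rewrite mulrC divfK.
rewrite aE; elim: n.+1 => [|m IHm].
  by rewrite big_ord0 mul0r /tint !subrr normr0 mul0r.
rewrite big_ord_recr/= -(tint_cat _ _ (m%:R * h)) opprD addrACA.
rewrite (le_trans (ler_normD _ _))// -natr1 mulrDl mul1r mulrDl lerD//.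
have hE : m%:R * h + h - m%:R * h = h by rewrite addrC addKr.
rewrite -[X in X * e]hE -[X in _ - X * _]hE; apply: primitive_mvt => //.
  by rewrite mulr_ge0//= lerDl.
by move=> s sm; apply: phie; rewrite -natr1 mulrDl mul1r.
Qed.

(** The difference [F] of the two primitives has derivative [psi s - phi (s + t)], which vanishes on
    [[0, a]]. Equality is asked only there because orbits of a semigroup are meaningful for
    nonnegative times only. *)
Lemma tint_shift phi psi (t a : R) : continuous phi -> continuous psi ->
  0 <= t -> 0 <= a -> (forall s, 0 <= s <= a -> psi s = phi (s + t)) ->
  tint psi 0 a = tint phi t (a + t).
Proof.
move=> cphi cpsi t0 a0 psiE.
pose F s := primitive psi s - primitive phi (s + t).
have dF (s : R) : -1 < s -> is_derive s 1 F (psi s - phi (s + t)).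
  move=> s1.
  have d1 := is_derive_primitive cpsi s1.
  have d2 : is_derive (s + t) 1 (primitive phi) (phi (s + t)).
    by apply: is_derive_primitive => //; rewrite (lt_le_trans s1)// lerDl.
  have d3 : is_derive s 1 (fun s : R => s + t) 1.
    by apply: is_derive_eq; rewrite addr0.
  have d4 : is_derive s 1 (primitive phi \o (fun s : R => s + t)) (phi (s + t)).
    by have := @is_derive1_comp R (primitive phi) (fun s : R => s + t) s _ _ d2 d3;
      rewrite mulr1.
  have -> : F = primitive psi - (primitive phi \o (fun s : R => s + t)).
    by apply/funext => u.
  exact: is_deriveB.
have a1 (x : R) : 0 <= x -> -1 < x by exact: lt_le_trans (ltrN10 R).
have [||c] := @MVT_segment R F (fun s => psi s - phi (s + t)) 0 a a0.
- by move=> x; rewrite in_itv/= => /andP[/ltW/a1 x1 _]; exact: dF.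
- apply: derivable_within_continuous => x; rewrite in_itv/= => /andP[/a1 x1 _].
  by have [] := dF x x1.
rewrite in_itv/= => /psiE ->; rewrite subrr mul0r /F add0r => /eqP.
rewrite /tint subr_eq0 => /eqP E.
apply/eqP; rewrite -subr_eq0; apply/eqP.
have -> : primitive psi a = primitive phi (a + t) + (primitive psi 0 - primitive phi t).
  by rewrite -E addrCA subrr addr0.
by ring.
Qed.

End time_integral.

(** * Feller semigroups on a compact space *)

Lemma near0_rightP (R : realType) (Q : R -> Prop) :
  (\forall t \near 0^'+, Q t) <-> exists2 d : R, 0 < d & forall t, 0 < t < d -> Q t.
Proof.
split=> [[d /= d0 h]|[d d0 h]].
  exists d => // t /andP[t0 td]; apply: h => //=.
  by rewrite sub0r normrN gtr0_norm.
exists d => //= t; rewrite /ball_/= sub0r normrN => td t0; apply: h.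
by rewrite t0 -(gtr0_norm t0).
Qed.

Lemma compact_bounded_fun (R : realType) (S : ptopologicalType) (f : S -> R) :
  compact [set: S] -> continuous f -> exists M : R, forall x, `|f x| <= M.
Proof.
move=> cS cf.
have /compact_bounded[M [_ Mf]] : compact (f @` setT).
  by apply: continuous_compact => //; exact: continuous_subspaceT.
exists (M + 1) => x; apply: Mf; last by exists x.
by rewrite ltrDl.
Qed.

Lemma uniform_limit_continuous (R : realType) (S : topologicalType) (f : S -> R) :
  (forall e, 0 < e -> exists2 g : S -> R, continuous g & forall x, `|f x - g x| <= e) ->
  continuous f.
Proof.
move=> fg x; apply/cvgrPdist_le => e e0.
have e30 : 0 < e / 3 by rewrite divr_gt0.
have [g cg gf] := fg _ e30.
have /cvgrPdist_le/(_ _ e30) := cg x; apply: filterS => y gy.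
have -> : f x - f y = (f x - g x) + (g x - g y) - (f y - g y) by ring.
have -> : e = e / 3 + e / 3 + e / 3 by field.
by rewrite (le_trans (ler_normB _ _))// lerD// (le_trans (ler_normD _ _))// lerD.
Qed.

Section feller_semigroup.
Context (R : realType) (S : ptopologicalType) (P : process R S).
Hypotheses (cS : compact [set: S]) (FP : feller P).
Implicit Types (f g : S -> R) (t s a e : R).

Lemma semigroup_continuous t f : 0 <= t -> continuous f -> continuous (semigroup P t f).
Proof. by case: FP => _ + _; exact. Qed.

Lemma semigroup_cst t c x : semigroup P t (fun=> c) x = c.
Proof. exact: (expectation_cst (process_total P x)). Qed.

Lemma semigroupD t f g x : 0 <= t -> continuous f -> continuous g ->
  semigroup P t (fun y => f y + g y) x = semigroup P t f x + semigroup P t g x.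
Proof.
move=> t0 cf cg.
have [M fM] := compact_bounded_fun cS cf; have [N gN] := compact_bounded_fun cS cg.
by apply: (@expectationD _ _ _ _ (process_total P x) _ _ M N) => //;
  exact: measurable_path_eval.
Qed.

Lemma semigroupZ t c f x : 0 <= t -> continuous f ->
  semigroup P t (fun y => c * f y) x = c * semigroup P t f x.
Proof.
move=> t0 cf; have [M fM] := compact_bounded_fun cS cf.
by apply: (@expectationZ _ _ _ _ (process_total P x) _ M) => //;
  exact: measurable_path_eval.
Qed.

Lemma semigroupB t f g x : 0 <= t -> continuous f -> continuous g ->
  semigroup P t (fun y => f y - g y) x = semigroup P t f x - semigroup P t g x.
Proof.
move=> t0 cf cg; have -> : (fun y => f y - g y) = (fun y => f y + (-1) * g y).
  by apply/funext => y; rewrite mulN1r.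
have cNg : continuous (fun y => -1 * g y).
  by move=> y; apply: cvgM; [exact: cvg_cst|exact: cg].
by rewrite semigroupD// semigroupZ// mulN1r.
Qed.

Lemma semigroup_bound t f M x : (forall y, `|f y| <= M) -> `|semigroup P t f x| <= M.
Proof.
by move=> fM; apply: (@expectation_bound _ _ _ _ (process_total P x)) => w; exact: fM.
Qed.

Lemma semigroup_near t f g c x : 0 <= t -> continuous f -> continuous g ->
  (forall y, `|f y - g y| <= c) -> `|semigroup P t f x - semigroup P t g x| <= c.
Proof. by move=> t0 cf cg fg; rewrite -semigroupB//; exact: semigroup_bound. Qed.

(** The Markov property with the trivial event from the past is this identity for sets; the law at
    time [s + t] is a mixture of the laws started from [w s]. *)
Lemma semigroup_add s t f x : 0 <= s -> 0 <= t -> continuous f ->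
  semigroup P (s + t) f x = semigroup P s (semigroup P t f) x.
Proof.
move=> s0 t0 cf; have [[_ mP] _ _] := FP.
have [M fM] := compact_bounded_fun cS cf.
have ms := @measurable_eval R S s s0.
apply: (@expectation_mixture _ _ _ _ (pathM R S) (pathM R S) (pathM R S) (borel S) R
  (P x) (P x) (fun w : Defs.path R S => P (w s)) (fun w : Defs.path R S => w (s + t))
  (fun w : Defs.path R S => w t) _ _ _ _ _ _ _ f M) => //.
- exact: process_total.
- exact: process_total.
- by move=> w; exact: process_total.
- by apply: measurable_eval; exact: addr_ge0.
- exact: measurable_eval.
- move=> B mB.
  exact: (measurableT_comp (measurable_transition P t0 mB) ms).
- move=> B mB; have := mP x s t s0 t0 setT _ B mB; rewrite setTI => -> //.
  exact: (@measurableT _ (g_sigma_algebraType _)).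
- exact: continuous_borel.
- exact: (measurableT_comp (continuous_borel (semigroup_continuous t0 cf)) ms).
Qed.

Lemma semigroup_modulus f e : 0 < e -> continuous f ->
  exists2 d : R, 0 < d & forall t, 0 < t < d -> forall x, `|semigroup P t f x - f x| <= e.
Proof.
move=> e0 cf; have [_ _ /(_ f cf e e0)] := FP.
by move=> /near0_rightP[d d0 h]; exists d => // t /h tx x; exact/ltW.
Qed.

(** Both sides are limits of [semigroup P h f] as h tends to 0: the right one by the Feller
    property, the left one because [semigroup P h f] is also the image of itself under time 0, which
    is a contraction. *)
Lemma semigroup0 f x : continuous f -> semigroup P 0 f x = f x.
Proof.
move=> cf; apply/eqP; rewrite -subr_eq0 -normr_le0; apply/ler_addgt0Pl => e e0.
rewrite addr0.
have e20 : 0 < e / 2 by rewrite divr_gt0.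
have [d d0 hd] := semigroup_modulus e20 cf.
have h : 0 < d / 2 < d by rewrite divr_gt0//= ltr_pdivrMr// ltr_pMr// ltr1n.
have d20 : 0 <= d / 2 by rewrite divr_ge0// ltW.
have h1 := hd _ h x.
have h2 : `|semigroup P (d / 2) f x - semigroup P 0 f x| <= e / 2.
  rewrite -[in X in X - _](add0r (d / 2)) semigroup_add//.
  apply: semigroup_near => //; first exact: semigroup_continuous.
  exact: hd.
rewrite distrC in h2; rewrite [e]splitr (le_trans _ (lerD h2 h1))//.
by apply: le_trans (ler_normD _ _); rewrite subrKA.
Qed.

(** For [t <= s] the difference is the image under time [t] of the increment over [s - t]; by
    contraction, a modulus at time 0 is a modulus at all times. *)
Lemma semigroup_modulus_at f e d : continuous f ->
  (forall t, 0 < t < d -> forall x, `|semigroup P t f x - f x| <= e) -> 0 < d ->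
  forall s t, 0 <= s -> 0 <= t -> `|s - t| < d ->
    forall x, `|semigroup P s f x - semigroup P t f x| <= e.
Proof.
move=> cf fd d0 s t; wlog ts : s t / t <= s.
  move=> H s0 t0 st x; have [/H|/ltW/H] := leP t s; first exact.
  by move=> h; rewrite distrC; apply: h => //; rewrite distrC.
move=> s0 t0 st x; move: ts; rewrite le_eqVlt => /predU1P[->|ts].
  rewrite subrr normr0.
  have h : 0 < d / 2 < d by rewrite divr_gt0//= ltr_pdivrMr// ltr_pMr// ltr1n.
  exact: le_trans (normr_ge0 _) (fd _ h x).
have st0 : 0 <= s - t by rewrite subr_ge0 ltW.
rewrite -(subrKC t s) semigroup_add//.
apply: semigroup_near => //; first exact: semigroup_continuous.
by move=> y; apply: fd; rewrite subr_gt0 ts (le_lt_trans _ st)// ler_norm.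
Qed.

(** The absolute value extends the orbit to a continuous function on the whole line, as the
    primitives require. *)
Let clock f x : R -> R := fun s => semigroup P `|s| f x.

Let clock_continuous f x : continuous f -> continuous (clock f x).
Proof.
move=> cf s; apply/cvgrPdist_le => e e0.
have [d d0 hd] := semigroup_modulus e0 cf.
exists d => //= t; rewrite /ball_/= => st.
by apply: (semigroup_modulus_at cf hd) => //; apply: le_lt_trans (ler_dist_dist _ _) st.
Qed.

(** This time integral lies in the domain of the generator for every continuous [f], and is the
    source of the test pairs. *)
Definition integrated a f x : R := tint (clock f x) 0 a.

Let riemann h m f x : R := \sum_(k < m) h * semigroup P (k%:R * h) f x.

Let riemann_continuous h m f : 0 <= h -> continuous f -> continuous (riemann h m f).
Proof.
move=> h0 cf; rewrite /riemann; elim: m => [|m IHm].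
  by under eq_fun do rewrite big_ord0; exact: cst_continuous.
under eq_fun do rewrite big_ord_recr/=.
move=> x; apply: cvgD; first exact: IHm.
apply: cvgM; first exact: cvg_cst.
by apply: semigroup_continuous => //; rewrite mulr_ge0.
Qed.

Let semigroup_riemann t h m f x : 0 <= t -> 0 <= h -> continuous f ->
  semigroup P t (riemann h m f) x = riemann h m (semigroup P t f) x.
Proof.
move=> t0 h0 cf; rewrite /riemann; elim: m => [|m IHm].
  by under eq_fun do rewrite big_ord0; rewrite big_ord0 semigroup_cst.
have mh0 : 0 <= m%:R * h by rewrite mulr_ge0.
under eq_fun do rewrite big_ord_recr/=.
rewrite big_ord_recr/= semigroupD//; last 2 first.
- exact: (riemann_continuous _ cf).
- by move=> y; apply: cvgM; [exact: cvg_cst|exact: semigroup_continuous].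
have cm := semigroup_continuous mh0 cf.
rewrite IHm (semigroupZ h x t0 cm).
by rewrite -semigroup_add// [t + _]addrC semigroup_add//.
Qed.

(** The number of cells depends only on the modulus of continuity of the orbit of [f], so one [n]
    serves every [g] whose orbit is no rougher, in particular the images of [f] under the
    semigroup. *)
Let riemann_approx a f e : 0 <= a -> continuous f -> 0 < e ->
  exists n : nat, forall g, continuous g ->
    (forall t c, 0 <= t -> (forall x, `|semigroup P t f x - f x| <= c) ->
      forall x, `|semigroup P t g x - g x| <= c) ->
    forall x, `|integrated a g x - riemann (a / n.+1%:R) n.+1 g x| <= e.
Proof.
move=> a0 cf e0; have a10 : 0 < a + 1 by rewrite ltr_wpDl.
(* The cells have total length [a]; the [+ 1] covers [a = 0]. *)
have e10 : 0 < e / (a + 1) by rewrite divr_gt0.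
have [d d0 hd] := semigroup_modulus e10 cf.
have [n nd] : exists n : nat, a / n.+1%:R < d.
  have d10 : 0 < d / (a + 1) by rewrite divr_gt0.
  have [n _ hn] := near_infty_natSinv_lt (PosNum d10).
  exists n; have /= := hn n (leqnn n); rewrite ltr_pdivlMr// mulrC.
  by apply: le_lt_trans; rewrite ler_wpM2r// lerDl.
exists n => g cg fg x.
have h0 : 0 <= a / n.+1%:R by rewrite divr_ge0.
have gd t : 0 < t < d -> forall x, `|semigroup P t g x - g x| <= e / (a + 1).
  by move=> td; apply: fg; [case/andP: td => /ltW|exact: hd].
rewrite (@le_trans _ _ (a * (e / (a + 1))))//; last first.
  by rewrite mulrA ler_pdivrMr// mulrC ler_pM2l// lerDl.
have -> : riemann (a / n.+1%:R) n.+1 g x =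
    \sum_(k < n.+1) a / n.+1%:R * clock g x (k%:R * (a / n.+1%:R)).
  by apply: eq_bigr => k _; rewrite /clock ger0_norm// mulr_ge0.
apply: tint_riemann => // [|k s /andP[ks sk]]; first exact: clock_continuous.
have k0 : 0 <= k%:R * (a / n.+1%:R) by rewrite mulr_ge0.
have s0 : 0 <= s by exact: le_trans ks.
rewrite /clock (ger0_norm s0) (ger0_norm k0).
apply: (semigroup_modulus_at cg gd) => //.
rewrite ger0_norm ?subr_ge0//; apply: le_lt_trans nd.
by rewrite lerBlDl; move: sk; rewrite -natr1 mulrDl mul1r.
Qed.

Lemma integrated_continuous a f : 0 <= a -> continuous f -> continuous (integrated a f).
Proof.
move=> a0 cf; apply: uniform_limit_continuous => e e0.
have [n hn] := riemann_approx a0 cf e0.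
exists (riemann (a / n.+1%:R) n.+1 f); last by move=> x; exact: hn.
by apply: riemann_continuous => //; rewrite divr_ge0.
Qed.

(** True for Riemann sums, and the same Riemann sum approximates the integrals of [f] and of
    [semigroup P t f]. *)
Lemma semigroup_integrated t a f x : 0 <= t -> 0 <= a -> continuous f ->
  semigroup P t (integrated a f) x = integrated a (semigroup P t f) x.
Proof.
move=> t0 a0 cf; apply/eqP; rewrite -subr_eq0 -normr_le0; apply/ler_addgt0Pl => e e0.
have e20 : 0 < e / 2 by rewrite divr_gt0.
have [n hn] := riemann_approx a0 cf e20.
have h0 : 0 <= a / n.+1%:R by rewrite divr_ge0.
have cSf := semigroup_continuous t0 cf.
have h1 : `|semigroup P t (integrated a f) x -
            semigroup P t (riemann (a / n.+1%:R) n.+1 f) x| <= e / 2.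
  apply: semigroup_near => //.
  - exact: integrated_continuous.
  - exact: riemann_continuous.
  - by move=> y; exact: hn.
have h2 : `|integrated a (semigroup P t f) x -
            riemann (a / n.+1%:R) n.+1 (semigroup P t f) x| <= e / 2.
  apply: hn => // s c s0 sc y.
  rewrite -semigroup_add// [s + t]addrC semigroup_add//.
  by apply: semigroup_near => //; exact: semigroup_continuous.
rewrite semigroup_riemann// in h1; rewrite distrC in h2.
rewrite addr0 [e]splitr; apply: le_trans (lerD h1 h2).
by apply: le_trans (ler_normD _ _); rewrite subrKA.
Qed.

Lemma integrated_near a f x d e : 0 <= a < d -> continuous f ->
  (forall t, 0 < t < d -> forall x, `|semigroup P t f x - f x| <= e) ->
  `|integrated a f x - a * semigroup P a f x| <= a * e.
Proof.
move=> /andP[a0 ad] cf hd.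
have := @primitive_mvt R (clock f x) 0 a (semigroup P a f x) e.
rewrite subr0; apply => //.
- exact: clock_continuous.
- by rewrite lexx.
move=> s /andP[s0 sa]; rewrite /clock (ger0_norm s0).
apply: (semigroup_modulus_at cf hd) => //; first exact: le_lt_trans ad.
by rewrite distrC ger0_norm ?subr_ge0// (le_lt_trans _ ad)// gerBl.
Qed.

(** Moving the integral over [[0, a]] by time [t] changes it by the integral over [[a, a + t]] minus
    the one over [[0, t]]; divided by [t] these tend to the values of the orbit at times [a] and
    0. *)
Lemma generator_integrated a f : 0 <= a -> continuous f ->
  generator P (integrated a f) (fun x => semigroup P a f x - f x).
Proof.
move=> a0 cf; split; first exact: integrated_continuous.
  by move=> x; apply: cvgB; [exact: semigroup_continuous|exact: cf].
move=> e e0; have e30 : 0 < e / 3 by rewrite divr_gt0.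
have [d d0 hd] := semigroup_modulus e30 cf.
apply/near0_rightP; exists d => // t /andP[t0 td] x.
have t0' := ltW t0.
have -> : semigroup P t (integrated a f) x - integrated a f x =
    tint (clock f x) a (a + t) - tint (clock f x) 0 t.
  rewrite semigroup_integrated//.
  have -> : integrated a (semigroup P t f) x = tint (clock f x) t (a + t).
    apply: tint_shift => //; [exact: clock_continuous| |].
      by apply: clock_continuous; exact: semigroup_continuous.
    move=> s /andP[s0 _]; rewrite /clock !ger0_norm ?addr_ge0//.
    by rewrite semigroup_add.
  rewrite /integrated /tint; ring.
have h1 : `|tint (clock f x) a (a + t) - t * semigroup P a f x| <= t * (e / 3).
  have := @primitive_mvt R (clock f x) a (a + t) (semigroup P a f x) (e / 3).
  rewrite (_ : a + t - a = t); last by rewrite addrAC subrr add0r.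
  apply; first exact: clock_continuous.
    by rewrite a0 lerDl.
  move=> s /andP[as_ sa]; have s0 : 0 <= s by exact: le_trans as_.
  rewrite /clock (ger0_norm s0); apply: (semigroup_modulus_at cf hd) => //.
  by rewrite ger0_norm ?subr_ge0// (le_lt_trans _ td)// lerBlDl.
have h2 : `|tint (clock f x) 0 t - t * f x| <= t * (e / 3).
  have := @primitive_mvt R (clock f x) 0 t (f x) (e / 3).
  rewrite subr0; apply; [exact: clock_continuous|by rewrite lexx|].
  move=> s /andP[s0 st]; rewrite /clock (ger0_norm s0) -[f x](semigroup0 x cf).
  by apply: (semigroup_modulus_at cf hd) => //; rewrite subr0 ger0_norm// (le_lt_trans st).
rewrite -(ltr_pM2l t0) -{1}(gtr0_norm t0) -normrM.
have -> : t * ((tint (clock f x) a (a + t) - tint (clock f x) 0 t) / t -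
    (semigroup P a f x - f x)) = (tint (clock f x) a (a + t) - t * semigroup P a f x) -
    (tint (clock f x) 0 t - t * f x) by field; rewrite gt_eqF.
rewrite (le_lt_trans (ler_normB _ _))// (le_lt_trans (lerD h1 h2))//.
by rewrite -mulrDr ltr_pM2l//; lra.
Qed.

End feller_semigroup.

(** * Means on continuous functions *)

Section continuous_functions.
Context (R : realType) (S : topologicalType).
Implicit Types f g : S -> R.

Lemma continuous_add f g : continuous f -> continuous g ->
  continuous (fun x => f x + g x).
Proof. by move=> cf cg x; apply: cvgD; [exact: cf|exact: cg]. Qed.

Lemma continuous_sub f g : continuous f -> continuous g ->
  continuous (fun x => f x - g x).
Proof. by move=> cf cg x; apply: cvgB; [exact: cf|exact: cg]. Qed.

Lemma continuous_mul f g : continuous f -> continuous g ->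
  continuous (fun x => f x * g x).
Proof. by move=> cf cg x; apply: cvgM; [exact: cf|exact: cg]. Qed.

Lemma continuous_scale (c : R) f : continuous f -> continuous (fun x => c * f x).
Proof. by move=> cf; apply: continuous_mul => //; exact: cst_continuous. Qed.

Lemma continuous_minr (c : R) f : continuous f ->
  continuous (fun x => Num.min (f x) c).
Proof.
move=> cf x; apply: (@continuous_min _ _ f (fun=> c)); first exact: cf.
exact: cst_continuous.
Qed.

Lemma continuous_sumr (n : nat) (F : nat -> S -> R) : (forall i, continuous (F i)) ->
  continuous (fun x => \sum_(i < n) F i x).
Proof.
move=> cF; elim: n => [|n IHn].
  by under eq_fun do rewrite big_ord0; exact: cst_continuous.
by under eq_fun do rewrite big_ord_recr/=; exact: continuous_add.
Qed.

Definition mean (L : (S -> R) -> R) := [/\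
  forall f g, continuous f -> continuous g -> L (fun x => f x + g x) = L f + L g,
  forall c f, continuous f -> L (fun x => c * f x) = c * L f,
  forall f, continuous f -> (forall x, 0 <= f x) -> 0 <= L f &
  L (fun=> 1) = 1].

Variable L : (S -> R) -> R.
Hypothesis mL : mean L.

Lemma meanB f g : continuous f -> continuous g ->
  L (fun x => f x - g x) = L f - L g.
Proof.
case: mL => mD mZ _ _ cf cg; rewrite -mulN1r -mZ// -mD//; last exact: continuous_scale.
by congr L; apply/funext => x; rewrite mulN1r.
Qed.

Lemma mean_cst c : L (fun=> c) = c.
Proof.
case: mL => _ mZ _ m1.
have h : L (fun=> c * 1) = c * L (fun=> 1) by apply: mZ; exact: cst_continuous.
by rewrite m1 mulr1 in h.
Qed.

Lemma mean_le f g : continuous f -> continuous g -> (forall x, f x <= g x) -> L f <= L g.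
Proof.
move=> cf cg fg; rewrite -subr_ge0 -meanB//; case: mL => _ _ m0 _; apply: m0.
  exact: continuous_sub.
by move=> x; rewrite subr_ge0.
Qed.

Lemma mean_bound f M : continuous f -> (forall x, `|f x| <= M) -> `|L f| <= M.
Proof.
move=> cf fM; rewrite ler_norml -[X in X <= _ <= _]mean_cst -[X in _ <= _ <= X]mean_cst.
apply/andP; split; apply: mean_le => // [|x];
  first [exact: cst_continuous|idtac];
  by have := fM x; rewrite ler_norml => /andP[].
Qed.

Lemma mean_sum (n : nat) (F : nat -> S -> R) : (forall i, continuous (F i)) ->
  L (fun x => \sum_(i < n) F i x) = \sum_(i < n) L (F i).
Proof.
move=> cF; elim: n => [|n IHn].
  by under eq_fun do rewrite big_ord0; rewrite big_ord0 mean_cst.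
rewrite big_ord_recr/= -IHn; under eq_fun do rewrite big_ord_recr/=.
by case: mL => mD _ _ _; rewrite mD//; exact: continuous_sumr.
Qed.

End continuous_functions.

(** * Riesz representation of a mean by a Borel probability *)

Section riesz.
Context (R : realType) (S : ptopologicalType).
Hypothesis cS : compact [set: S].
Hypothesis cozero : forall U : set S, open U -> exists u : S -> R,
  [/\ continuous u, forall x, 0 <= u x & U = [set x | 0 < u x]].
Variable L : (S -> R) -> R.
Hypothesis mL : mean L.
Implicit Types (A X : set S) (f : S -> R) (g : nat -> S -> R).

(* The outer measure of Daniell: [outer A] is the infimum of the limits of [L (g n)]
   along increasing continuous [g n >= 0] whose supremum is at least 1 on A. *)
Let covers A (c : R) := exists g, [/\ forall n, continuous (g n),
  forall n x, 0 <= g n x, forall n x, g n x <= g n.+1 x,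
  forall x, A x -> exists n, 1 <= g n x & forall n, L (g n) <= c].

Let outer A : \bar R := ereal_inf [set c%:E | c in covers A].

Let nondecreasing_cover g : (forall n x, g n x <= g n.+1 x) ->
  forall m n x, (m <= n)%N -> g m x <= g n x.
Proof.
move=> g1 m n x; elim: n => [|n IHn]; first by rewrite leqn0 => /eqP ->.
by rewrite leq_eqVlt => /predU1P[->//|/IHn/le_trans]; exact.
Qed.

Let outer_le A c : covers A c -> (outer A <= c%:E)%E.
Proof. by move=> Ac; apply: ereal_inf_lbound; exists c. Qed.

Let covers_ge0 A c : covers A c -> 0 <= c.
Proof.
move=> [g [cg g0 _ _ /(_ 0%N)]]; apply: le_trans.
by case: mL => _ _ m0 _; exact: m0.
Qed.

Let outer_ge0 A : (0 <= outer A)%E.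
Proof. by apply: le_ereal_inf_tmp => _ [c /covers_ge0 c0 <-]; rewrite lee_fin. Qed.

Let outer_le1 A : (outer A <= 1)%E.
Proof.
apply: outer_le; exists (fun _ _ => 1); split => //.
- by move=> _; exact: cst_continuous.
- by move=> x _; exists 0%N.
- by move=> _; rewrite mean_cst.
Qed.

Let outer_fin A : outer A \is a fin_num.
Proof. by rewrite ge0_fin_numE// (le_lt_trans (outer_le1 A))// ltry. Qed.

Let outer_witness A (e : R) : 0 < e -> covers A (fine (outer A) + e).
Proof.
move=> e0; have [_ [c Ac <-] ce] := lb_ereal_inf_adherent e0 (outer_fin A).
have {}ce : c < fine (outer A) + e by rewrite -lte_fin EFinD (fineK (outer_fin A)).
have [g [g1 g2 g3 g4 g5]] := Ac; exists g; split => // n.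
by rewrite (le_trans (g5 n))// ltW.
Qed.

Let outer_set0 : outer set0 = 0%E.
Proof.
apply/eqP; rewrite eq_le outer_ge0 andbT; apply: outer_le.
exists (fun _ _ => 0); split => // [_|_]; first exact: cst_continuous.
by rewrite mean_cst.
Qed.

Let outer_homo : {homo outer : A B / A `<=` B >-> (A <= B)%E}.
Proof.
move=> A B AB; apply: le_ereal_inf => _ [c [g [g1 g2 g3 g4 g5]] <-].
by exists c => //; exists g; split => // x /AB; exact: g4.
Qed.

(** Stage [n] of the new cover adds the first [n] covers, each at its stage [n]; the excesses
    [e / 2^(i+1)] sum to [e]. *)
Let outer_sigma_subadditive : sigma_subadditive outer.
Proof.
move=> A; apply/lee_addgt0Pr => e e0.
pose d i := e / (2 ^ i.+1)%:R; have d0 i : 0 < d i.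
  by rewrite divr_gt0// ltr0n expn_gt0.
have /choice[g gP] i := outer_witness (A i) (d0 i).
have H : forall n, (\sum_(i < n) (fine (outer (A i)) + d i)%:E <=
    \sum_(i <oo) outer (A i) + e%:E)%E.
  move=> n; apply: le_trans (epsilon_trick xpredT _ (ltW e0)); last first.
    by move=> i; exact: outer_ge0.
  rewrite -(big_mkord xpredT (fun i => (fine (outer (A i)) + d i)%:E)).
  rewrite (eq_bigr (fun i => outer (A i) + (d i)%:E)%E); last first.
    by move=> i _; rewrite EFinD fineK.
  apply: nneseries_lim_ge => i _; rewrite adde_ge0 ?outer_ge0// lee_fin ltW//.
have [->|] := eqVneq (\sum_(i <oo) outer (A i))%E +oo%E.
  by rewrite leey.
move=> sfin.
have sumfin : (\sum_(i <oo) outer (A i) + e%:E)%E \is a fin_num.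
  rewrite fin_numD andbT ge0_fin_numE ?ltey//.
  by apply: nneseries_ge0 => i _ _; exact: outer_ge0.
rewrite -(fineK sumfin); apply: outer_le.
exists (fun n x => \sum_(i < n) g i n x); split.
- by move=> n; apply: (@continuous_sumr _ _ n (fun i => g i n)) => i; case: (gP i).
- by move=> n x; rewrite sumr_ge0// => i _; case: (gP i).
- move=> n x; rewrite big_ord_recr/= ler_wpDr//; first by case: (gP n).
  by apply: ler_sum => i _; case: (gP i).
- move=> x [i _ Aix]; have [_ g0 g1 /(_ x Aix)[m gm] _] := gP i.
  (* Late enough to include the i-th summand and for that summand to reach 1 at [x]. *)
  exists (maxn i.+1 m); rewrite (bigD1 (Ordinal (leq_maxl i.+1 m)))//=.
  rewrite ler_wpDr//; first by rewrite sumr_ge0// => j _; case: (gP j).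
  by apply: le_trans gm _; apply: nondecreasing_cover g1 _ _ _ _; exact: leq_maxr.
- move=> n; rewrite (@mean_sum _ _ L mL n (fun i => g i n)); last first.
    by move=> i; case: (gP i).
  rewrite -lee_fin (fineK sumfin); apply: le_trans (H n).
  by rewrite sumEFin lee_fin; apply: ler_sum => i _; case: (gP i).
Qed.

Let mu : {outer_measure set S -> \bar R} := HB.pack outer
  (isOuterMeasure.Build R S outer outer_set0 outer_ge0 outer_homo
    outer_sigma_subadditive).

(** A nearly optimal cover [g] of [X] is split by functions [phi k] increasing to the indicator of
    [V]. For each fixed k, [g m * (1 - phi k)] covers the part off [V] at cost at most
    [c - L (g k * phi k)]; hence the diagonal [g k * phi k], which covers the part in [V], costs at
    most [c] minus the outer measure of the part off [V]. *)
Let open_caratheodory (U : set S) : open U -> mu.-caratheodory U.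
Proof.
move=> /cozero[u [cu u0 ->]]; apply: le_caratheodory_measurable => X.
set V := [set x | 0 < u x].
rewrite -[leRHS](fineK (outer_fin X)); apply/lee_addgt0Pr => e e0.
have [g [cg g0 g1 gX gc]] := outer_witness X e0.
set c := fine (outer X) + e in gc.
pose phi k x := Num.min (k%:R * u x) 1.
have cphi k : continuous (phi k) by apply: continuous_minr; exact: continuous_scale.
have phi0 k x : 0 <= phi k x by rewrite le_min ler01 mulr_ge0.
have phi1 k x : phi k x <= 1 by rewrite ge_min lexx orbT.
have phiS k x : phi k x <= phi k.+1 x.
  by rewrite le_min !ge_min lexx orbT andbT ler_wpM2r// ler_nat.
have cgphi m k : continuous (fun x => g m x * phi k x) by exact: continuous_mul.
have cgphi' m k : continuous (fun x => g m x * (1 - phi k x)).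
  by apply: continuous_mul => //; apply: continuous_sub => //; exact: cst_continuous.
have split m k : L (fun x => g m x * phi k x) + L (fun x => g m x * (1 - phi k x)) = L (g m).
  case: mL => mD _ _ _; rewrite -mD//; congr L; apply/funext => x.
  by rewrite -mulrDr subrKC mulr1.
have compl k : (outer (X `&` ~` V) <= (c - L (fun x => g k x * phi k x))%:E)%E.
  apply: outer_le; exists (fun m x => g m x * (1 - phi k x)); split => //.
  - by move=> m x; rewrite mulr_ge0// subr_ge0.
  - by move=> m x; rewrite ler_wpM2r// subr_ge0.
  - move=> x [/gX[m gm]] /negP; rewrite -leNgt => ux; exists m.
    have ux0 : u x = 0 by apply/eqP; rewrite eq_le ux u0.
    by rewrite /phi ux0 mulr0 min_l// subr0 mulr1.
  - move=> m; pose j := maxn m k.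
    have gmj x : g m x <= g j x by apply: nondecreasing_cover => //; exact: leq_maxl.
    have gkj x : g k x <= g j x by apply: nondecreasing_cover => //; exact: leq_maxr.
    have h1 : L (fun x => g m x * (1 - phi k x)) <= L (fun x => g j x * (1 - phi k x)).
      by apply: (mean_le mL) => // x; rewrite ler_wpM2r// subr_ge0.
    have h2 : L (fun x => g k x * phi k x) <= L (fun x => g j x * phi k x).
      by apply: (mean_le mL) => // x; rewrite ler_wpM2r.
    have := split j k; have := gc j; move: h1 h2; lra.
have inside : (outer (X `&` V) <= (c - fine (outer (X `&` ~` V)))%:E)%E.
  apply: outer_le; exists (fun k x => g k x * phi k x); split => //.
  - by move=> k x; rewrite mulr_ge0.
  - by move=> k x; rewrite ler_pM.
  - move=> x [/gX[m gm] /= ux].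
    (* From this index on [k * u x >= 1], so that [phi] equals 1 at [x]. *)
    pose k := (Num.truncn (u x)^-1).+1; exists (maxn m k).
    have -> : phi (maxn m k) x = 1.
      apply: min_r; rewrite -ler_pdivrMr// mul1r.
      have /ltW/le_trans : (u x)^-1 < k%:R by exact: truncnS_gt.
      by apply; rewrite ler_nat leq_maxr.
    rewrite mulr1; apply: le_trans gm _.
    by apply: nondecreasing_cover => //; exact: leq_maxl.
  - move=> k; have := compl k.
    by rewrite -{1}(fineK (outer_fin (X `&` ~` V))) lee_fin; lra.
suff : (outer (X `&` V) + outer (X `&` ~` V) <= c%:E)%E by [].
rewrite -[X in (_ + X)%E](fineK (outer_fin (X `&` ~` V))).
by rewrite (le_trans (leeD2r _ inside))// -EFinD subrK.
Qed.

Let borel_caratheodory (B : set (borel S)) : measurable B -> mu.-caratheodory B.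
Proof.
apply: smallest_sub; last exact: open_caratheodory.
have := @sigma_algebra_measurable _ (caratheodory_type mu); exact.
Qed.

Let borel_outer (B : set (borel S)) : \bar R := outer B.

Let borel_outer_sigma_additive : semi_sigma_additive borel_outer.
Proof.
move=> F mF tF mUF.
apply: (@caratheodory_measure_sigma_additive R S mu F) => //.
- by move=> n; exact: borel_caratheodory.
- exact: borel_caratheodory.
Qed.

(** Dini's argument: the open sets where [g n] exceeds [1 - e] increase to the whole space, so by
    compactness one of them is the whole space and [1 - e <= L (g n)]. *)
Let outerT : outer setT = 1%E.
Proof.
apply/eqP; rewrite eq_le outer_le1/=; apply: le_ereal_inf_tmp => _ [c [g [cg g0 g1 gT gc]] <-].
rewrite lee_fin; apply/ler_addgt0Pr => e e0.
have [n gn] : exists n, forall x, 1 - e <= g n x.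
  have := cS; rewrite compact_cover => /(_ nat setT (fun n => [set x | 1 - e < g n x])).
  case=> [n _|x _|D _ Dcov].
  - apply: (@open_comp _ _ (g n) [set y | 1 - e < y]); last exact: open_gt.
    by move=> x _; exact: cg.
  - have [n gn] := gT x Logic.I.
    by exists n => //=; apply: lt_le_trans gn; rewrite ltrBlDr ltrDl.
  - exists (\max_(i <- finmap.enum_fset D) i)%N => x; have [n /= Dn gn] := Dcov x Logic.I.
    apply: (le_trans (ltW gn)); apply: nondecreasing_cover => //.
    by apply: (@leq_bigmax_seq _ _ xpredT (fun i => i)).
rewrite -lerBlDr; apply: le_trans (gc n); rewrite -[leLHS](mean_cst mL).
by apply: (mean_le mL) => //; exact: cst_continuous.
Qed.

(** Slicing [f] horizontally at heights [i * h] bounds the measures of its superlevel sets by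
    increments of [L] that telescope to [L f]. This gives one inequality for values in [[0, 1]],
    then for all continuous functions by an affine change, and the reverse one by passing to
    [- f]. *)
Theorem riesz_mean : exists nu : probability (borel S) R,
  forall f, continuous f -> \int[nu]_x f x = L f.
Proof.
have b0 : borel_outer set0 = 0%E by exact: outer_set0.
have bge0 B : (0 <= borel_outer B)%E by exact: outer_ge0.
pose nu0 : {measure set (borel S) -> \bar R} := HB.pack borel_outer
  (isMeasure.Build _ (borel S) R borel_outer b0 bge0 borel_outer_sigma_additive).
have nuT : nu0 setT = 1%E by exact: outerT.
pose nu : probability (borel S) R := HB.pack borel_outer nu0
  (Measure_isProbability.Build _ (borel S) R nu0 nuT).
exists nu.
have low f : continuous f -> (forall x, 0 <= f x <= 1) -> \int[nu]_x f x <= L f.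
  move=> cf f01; apply/ler_addgt0Pr => e e0.
  have [n _ /(_ n (leqnn n)) /= ne] := near_infty_natSinv_lt (PosNum e0).
  pose h : R := n.+1%:R^-1.
  have h0 : 0 < h by rewrite invr_gt0.
  have nh : n.+1%:R * h = 1 by rewrite divff.
  pose F i x := Num.min (f x) (i%:R * h).
  have cF i : continuous (F i) by exact: continuous_minr.
  have FS i x : F i x <= F i.+1 x.
    by rewrite le_min !ge_min lexx /= ler_wpM2r ?orbT// ?ler_nat// ltW.
  pose A i := [set x | i.+1%:R <= n.+1%:R * f x].
  (* The slice between heights [i * h] and [(i + 1) * h], divided by [h], equals 1 on [A i]; the
     constant sequence of this function is a cover. *)
  have level i : fine (nu (A i)) <= n.+1%:R * (L (F i.+1) - L (F i)).
    rewrite -lee_fin fineK; last exact: outer_fin.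
    apply: outer_le; exists (fun _ x => n.+1%:R * (F i.+1 x - F i x)).
    have cD : continuous (fun x => n.+1%:R * (F i.+1 x - F i x)).
      by apply: continuous_scale; exact: continuous_sub.
    split => // [_ x|x|_].
    - by rewrite mulr_ge0// subr_ge0.
    - rewrite /A /= => fx; exists 0%N.
      have ix : i.+1%:R * h <= f x by rewrite ler_pdivrMr// mulrC.
      rewrite /F (min_r ix) min_r; last first.
        by apply: le_trans ix; rewrite ler_wpM2r ?ler_nat// ltW.
      by rewrite -mulrBl -natrB// subSnn mul1r nh.
    - case: mL => _ mZ _ _; rewrite mZ ?(meanB mL)//.
      exact: continuous_sub.
  have tele : \sum_(i < n.+1) (L (F i.+1) - L (F i)) = L f.
    rewrite -(big_mkord xpredT (fun i => L (F i.+1) - L (F i))) telescope_sumr//.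
    have -> : F n.+1 = f.
      by apply/funext => x; rewrite /F nh min_l//; case/andP: (f01 x).
    have -> : F 0%N = fun=> 0.
      by apply/funext => x; rewrite /F mul0r min_r//; case/andP: (f01 x).
    by rewrite mean_cst// subr0.
  have mA i : measurable (A i : set (borel S)).
    rewrite -[X in measurable X]setTI.
    rewrite [X in _ `&` X](_ : _ = (fun z => n.+1%:R * f z) @^-1` `[i.+1%:R, +oo[).
      by apply: measurable_funM => //; exact: continuous_borel.
    by apply/seteqP; split => z; rewrite /= in_itv/= andbT.
  have msum j : measurable_fun [set: borel S] (fun x : borel S => \sum_(i < j) \1_(A i) x : R).
    elim: j => [|j IHj]; first by (under eq_fun do rewrite big_ord0); exact: measurable_cst.
    under eq_fun do rewrite big_ord_recr/=.
    by apply: measurable_funD => //; exact: measurable_indic.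
  have i1 i x : `|\1_(A i) x : R| <= 1.
    by rewrite indicE normr_nat; case: (_ \in _).
  have bsum j x : `|\sum_(i < j) \1_(A i) x : R| <= j%:R.
    rewrite (le_trans (ler_norm_sum _ _ _))// (@le_trans _ _ (\sum_(i < j) 1))//.
      by apply: ler_sum => i _; exact: i1.
    by rewrite sumr_const card_ord.
  have isum j : \int[nu]_x (\sum_(i < j) \1_(A i) x : R) = \sum_(i < j) fine (nu (A i)).
    elim: j => [|j IHj].
      by under eq_Rintegral do rewrite big_ord0; rewrite big_ord0 expectation_cst.
    under eq_Rintegral do rewrite big_ord_recr/=.
    rewrite (@expectationD _ _ _ nu nuT _ _ j%:R 1 (msum j) (measurable_indic (mA j))
      (bsum j) (i1 j)).
    by rewrite IHj big_ord_recr/= /Rintegral integral_indic ?setIT.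
  have ile : \int[nu]_x f x <= \int[nu]_x (h * (\sum_(i < n.+1) \1_(A i) x) + h).
    apply: (@expectation_le _ _ _ nu nuT _ _ (1 + h)) => x.
    - have /andP[f0 f1] := f01 x.
      by rewrite ger0_norm// (le_trans f1)// lerDl ltW.
    - rewrite (le_trans (ler_normD _ _))// normrM gtr0_norm// lerD2r mulrC ler_pdivrMr//.
      by rewrite mul1r.
    - by have /andP[_] := staircaseP n (f01 x).
  rewrite (@expectationD _ _ _ nu nuT _ _ 1 h)// in ile; last 3 first.
  - by apply: measurable_funM.
  - by move=> x; rewrite normrM gtr0_norm// mulrC ler_pdivrMr// mul1r.
  - by move=> x; rewrite gtr0_norm.
  rewrite (@expectationZ _ _ _ nu nuT _ n.+1%:R)// isum expectation_cst// in ile.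
  apply: (le_trans ile); rewrite lerD//; last exact: ltW.
  rewrite mulrC ler_pdivrMr// -tele mulrC mulr_sumr.
  by apply: ler_sum => i _; exact: level.
have low' f : continuous f -> \int[nu]_x f x <= L f.
  move=> cf; have [M fM] := compact_bounded_fun cS cf.
  pose N := `|M| + 1; have N0 : 0 < N by rewrite ltr_pwDr.
  have N20 : 0 < 2 * N by rewrite mulr_gt0.
  have cfN : continuous (fun x => f x + N).
    by apply: continuous_add => //; exact: cst_continuous.
  have := low (fun x => (2 * N)^-1 * (f x + N)) (continuous_scale cfN).
  have fN x : `|f x| <= N by rewrite (le_trans (fM x))// (le_trans (ler_norm _))// lerDl.
  have fNN x : `|f x + N| <= N + N.
    by rewrite (le_trans (ler_normD _ _))// lerD// gtr0_norm.
  rewrite (@expectationZ _ _ _ nu nuT _ (N + N))//; last first.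
    by apply: measurable_funD => //; exact: continuous_borel.
  rewrite (@expectationD _ _ _ nu nuT _ _ N N)//; last 2 first.
  - exact: continuous_borel.
  - by move=> x; rewrite gtr0_norm.
  rewrite expectation_cst//.
  case: mL => mD mZ _ _; rewrite mZ// mD//; last exact: cst_continuous.
  rewrite (mean_cst mL) ler_pM2l ?invr_gt0// lerD2r; apply => x.
  have := fN x; rewrite ler_norml => /andP[f1 f2].
  rewrite mulr_ge0 ?invr_ge0 ?(ltW N20)//= -?lerBlDr ?sub0r//.
  by rewrite ler_pdivrMl// mulr1 mulrDl mul1r lerD2r.
move=> f cf; apply/eqP; rewrite eq_le low'//=.
have cNf : continuous (fun x => -1 * f x) by exact: continuous_scale.
have := low' _ cNf; have [M fM] := compact_bounded_fun cS cf.
rewrite (@expectationZ _ _ _ nu nuT _ M)//; last exact: continuous_borel.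
by case: mL => _ mZ _ _; rewrite mZ// !mulN1r lerN2.
Qed.

End riesz.

(** * Invariant means and unique ergodicity *)

Section invariant_mean.
Context (R : realType) (S : ptopologicalType).
Hypothesis cS : compact [set: S].
Hypothesis cozero : forall U : set S, open U -> exists u : S -> R,
  [/\ continuous u, forall x, 0 <= u x & U = [set x | 0 < u x]].

(** The functions [min (k * u) 1] increase to the indicator of the open set where [u] is positive,
    and open sets are stable under intersection and generate the Borel sets. *)
Lemma eq_measure_continuous (m1 m2 : {measure set (borel S) -> \bar R}) :
  m1 setT = 1%E -> m2 setT = 1%E ->
  (forall f : S -> R, continuous f -> \int[m1]_x f x = \int[m2]_x f x) ->
  forall B : set (borel S), measurable B -> m1 B = m2 B.
Proof.
move=> m1T m2T m12 B mB.
have openE (U : set S) : open U -> m1 U = m2 U.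
  move=> /cozero[u [cu u0 UE]].
  pose f (k : nat) x := Num.min (k%:R * u x) 1.
  have cf k : continuous (f k) by apply: continuous_minr; exact: continuous_scale.
  have f01 k x : 0 <= f k x <= 1.
    by rewrite le_min ler01 mulr_ge0//= ge_min lexx orbT.
  have fle k x : `|f k x| <= 1 by have /andP[f0 f1] := f01 k x; rewrite ger0_norm.
  have mU : measurable (U : set (borel S)).
    by rewrite UE; apply: open_borel; apply: (@open_comp _ _ u [set y | 0 < y]);
      [by move=> x _; exact: cu|exact: open_gt].
  have lim (m : {measure set (borel S) -> \bar R}) : m setT = 1%E ->
      (\int[m]_x (f k x)%:E)%E @[k --> \oo] --> m U.
    move=> mT.
    have -> : m U = (\int[m]_x (\1_(U : set (borel S)) x)%:E)%E by rewrite integral_indic ?setIT.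
    have [] // := @dominated_convergence _ (borel S) R m setT measurableT
      (fun k x => (f k x)%:E) (fun x => (\1_U x)%:E) (cst 1%E).
    - by move=> k; apply/measurable_EFinP; exact: continuous_borel.
    - by apply/measurable_EFinP; exact: measurable_indic.
    - apply: aeW => x _; apply: cvg_near_cst.
      have [xU|xU] := boolP (x \in U); last first.
        apply: nearW => k; rewrite indicE (negbTE xU) /f.
        have -> : u x = 0.
          apply/eqP; rewrite eq_le u0 andbT leNgt; apply/negP => ux.
          by move/negP: xU; apply; rewrite inE UE.
        by rewrite mulr0 min_l.
      have ux : 0 < u x by move: xU; rewrite inE UE.
      exists (Num.truncn (u x)^-1).+1 => // k /= k1.
      rewrite indicE xU /f min_r// -ler_pdivrMr// mul1r.
      have /ltW/le_trans : (u x)^-1 < (Num.truncn (u x)^-1).+1%:R by exact: truncnS_gt.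
      by apply; rewrite ler_nat.
    - by apply: (@bounded_integrable _ _ _ _ mT (fun=> 1) 1) => // x; rewrite normr1.
    - by apply: aeW => x k _; rewrite lee_fin.
  have fin (m : {measure set (borel S) -> \bar R}) k : m setT = 1%E ->
      (\int[m]_x (f k x)%:E)%E = (\int[m]_x f k x)%:E.
    move=> mT; rewrite /Rintegral fineK//.
    have := bounded_integrable mT (continuous_borel (cf k)) (fle k).
    exact: integrable_fin_num.
  have l1 := lim m1 m1T; have l2 := lim m2 m2T.
  have E : (fun k => (\int[m1]_x (f k x)%:E)%E) = (fun k => (\int[m2]_x (f k x)%:E)%E).
    by apply/funext => k; rewrite !fin// m12.
  rewrite E in l1.
  exact: (cvg_unique _ l1 l2).
apply: (@g_sigma_algebra_measure_unique _ R (borel S) (@open S) _ (fun=> setT)) => //.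
- by move=> U oU; exact: open_borel.
- by move=> _; exact: openT.
- by rewrite bigcup_const.
- by move=> U V oU oV; exact: openI.
- by move=> k; rewrite [ltLHS]m1T ltry.
Qed.

Variable P : process R S.
Hypothesis FP : feller P.

(** The representing measure [nu] and its law after time [t] integrate continuous functions equally,
    so [nu] is invariant and uniqueness identifies it with [mu]. *)
Lemma invariant_mean (L : (S -> R) -> R) (mu : probability (borel S) R) :
  mean L -> (forall (t : R) (f : S -> R), 0 <= t -> continuous f -> L (semigroup P t f) = L f) ->
  unique_ergodic P mu -> forall f : S -> R, continuous f -> L f = \int[mu]_x f x.
Proof.
move=> mL LP [_ uniq] f cf.
have [nu nuE] := riesz_mean cS cozero mL.
rewrite -nuE//; rewrite /Rintegral; congr fine; apply: eq_measure_integral => B mB _.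
apply: uniq => // t t0 {mB}B mB.
pose e := fun (w : Defs.path R S) => (w t : borel S).
have me : measurable_fun [set: pathM R S] e by exact: measurable_eval.
have mpre (C : set (borel S)) : measurable C -> measurable (e @^-1` C : set (pathM R S)).
  by move=> mC; rewrite -[X in measurable X]setTI; exact: me.
(* The law at time [t] of the process started from [nu]. *)
pose m (C : set (borel S)) := (\int[nu]_x P x (e @^-1` C))%E.
have m0 : m set0 = 0%E.
  by rewrite /m; apply: integral0_eq => x _; rewrite preimage_set0 measure0.
have mge0 C : (0 <= m C)%E by apply: integral_ge0 => x _; exact: measure_ge0.
have madd : semi_sigma_additive m.
  move=> F mF tF mUF.
  have -> : m (\bigcup_n F n) = (\sum_(n <oo) m (F n))%E.
    rewrite /m -integral_nneseries//; last by move=> n; exact: measurable_transition.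
    apply: eq_integral => x _; rewrite preimage_bigcup measure_semi_bigcup//.
    - by move=> n; exact: mpre.
    - move=> i j _ _ [w [wi wj]]; apply: (tF i j) => //; by exists (e w).
    - by rewrite -preimage_bigcup; exact: mpre.
  by apply: is_cvg_nneseries => n _ _; exact: mge0.
pose M : {measure set (borel S) -> \bar R} := HB.pack m
  (isMeasure.Build _ (borel S) R m m0 mge0 madd).
have nuT : nu setT = 1%E by exact: probability_setT.
have MT : M setT = 1%E.
  rewrite /M /= /m preimage_setT (eq_integral (cst 1%E)); last first.
    by move=> x _; exact: process_total.
  by rewrite integral_cst// mul1e.
apply: (@eq_measure_continuous M nu MT nuT) => // g cg.
rewrite [RHS]nuE// -(LP t)// -nuE//; last exact: semigroup_continuous.
have [N gN] := compact_bounded_fun cS cg.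
apply: (@expectation_mixture _ _ _ _ (borel S) (borel S) (pathM R S) (borel S) R
  nu M P id e _ _ _ _ _ _ _ g N) => //.
- exact: process_total.
- by move=> C mC; exact: measurable_transition.
- exact: continuous_borel.
- by apply: continuous_borel; exact: semigroup_continuous.
Qed.

End invariant_mean.

(** * Bounded arrays with an approximate mean value property *)

Section coupling_harmonic.
Context (R : realType).
Variables (c : nat -> R -> R) (M : R).
Hypothesis cM : forall k s, 0 <= s -> `|c k s| <= M.
Hypothesis c_step : forall e, 0 < e -> exists p a, [/\ 0 < p <= 1 / 2, 0 <= a &
  forall k s, 0 <= s ->
    `|c k s - ((1 - p) * c k (s + a) + p * c k.+1 (s + a))| <= p * e].

Let gap d : set R := [set `|c ks.1 ks.2 - c (ks.1 + d)%N ks.2| |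
  ks in [set ks : nat * R | 0 <= ks.2]].

Let m d : R := sup (gap d).

Let gap_has_sup d : has_sup (gap d).
Proof.
split; first by exists `|c 0%N 0 - c (0 + d)%N 0|; exists (0%N, 0) => //=.
exists (M + M) => _ [[k s] /= s0 <-].
by rewrite (le_trans (ler_normB _ _))// lerD// cM.
Qed.

Let gap_le d k s : 0 <= s -> `|c k s - c (k + d)%N s| <= m d.
Proof. by move=> s0; apply: sup_upper_bound => //; exists (k, s). Qed.

Let m_le d b : (forall k s, 0 <= s -> `|c k s - c (k + d)%N s| <= b) -> m d <= b.
Proof.
move=> h; apply: ge_sup; first by case: (gap_has_sup d).
by move=> _ [[k s] /= s0 <-]; exact: h.
Qed.

Let m0 : m 0 = 0.
Proof.
apply/eqP; rewrite eq_le; apply/andP; split.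
  by apply: m_le => k s s0; rewrite addn0 subrr normr0.
by apply: le_trans (@gap_le 0 0%N 0 _).
Qed.

(* Let the two copies k and k + d of the walk jump independently. *)
Let m_convex e d : 0 < e -> 2 * m d.+1 <= m d.+2 + m d + 4 * e.
Proof.
move=> e0; have [p [a [/andP[p0 p2] a0 step]]] := c_step e0.
have q0 : 0 <= 1 - p by lra.
have pq : 0 < p * (1 - p) by rewrite mulr_gt0//; lra.
suff : m d.+1 <= ((1 - p) ^+ 2 + p ^+ 2) * m d.+1 +
    p * (1 - p) * (m d.+2 + m d) + 2 * (p * e).
  have -> : (1 - p) ^+ 2 + p ^+ 2 = 1 - 2 * (p * (1 - p)) by ring.
  move=> H.
  have : p * ((1 - p) * (2 * m d.+1)) <= p * ((1 - p) * (m d.+2 + m d) + 2 * e) by lra.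
  rewrite ler_pM2l// => {}H.
  (* Division by [1 - p >= 1/2] turns the error [2 * e] into at most [4 * e]. *)
  rewrite -(@ler_pM2l _ (1 - p))//; last by lra.
  apply: (le_trans H).
  have : 0 <= (1 - p - 1 / 2) * (4 * e) by rewrite mulr_ge0//; lra.
  by lra.
apply: m_le => k s s0; have sa0 : 0 <= s + a by exact: addr_ge0.
have hk := step k s s0; have hkd := step (k + d.+1)%N s s0.
have h00 := gap_le d.+1 k sa0; have h11 := gap_le d.+1 k.+1 sa0.
have h01 := gap_le d.+2 k sa0; have h10 := gap_le d k.+1 sa0.
rewrite addSn -addnS in h11; rewrite addSn -addnS in h10; rewrite addnS in h11.
rewrite addnS in h01.
set x0 := c k (s + a) in hk h00 h01; set x1 := c k.+1 (s + a) in hk h11 h10.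
set y0 := c (k + d.+1)%N (s + a) in hkd h00 h10.
set y1 := c (k + d.+1).+1 (s + a) in hkd h11 h01.
(* The four products stand for: neither copy jumps, both jump, only the upper one, only the lower
   one. The distance changes by 0, 0, 1 and -1. *)
have -> : c k s - c (k + d.+1)%N s =
  (c k s - ((1 - p) * x0 + p * x1)) - (c (k + d.+1)%N s - ((1 - p) * y0 + p * y1)) +
  ((1 - p) ^+ 2 * (x0 - y0) + p ^+ 2 * (x1 - y1) + p * (1 - p) * (x0 - y1) +
   p * (1 - p) * (x1 - y0)) by ring.
rewrite (le_trans (ler_normD _ _))// addrC lerD//; last first.
  by rewrite (le_trans (ler_normB _ _))//; lra.
rewrite (le_trans (ler_normD _ _))// [X in _ <= X](_ : _ =
  ((1 - p) ^+ 2 * m d.+1 + p ^+ 2 * m d.+1 + p * (1 - p) * m d.+2) +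
   p * (1 - p) * m d); last by ring.
rewrite lerD//; last by rewrite normrM gtr0_norm// ler_pM2l.
rewrite (le_trans (ler_normD _ _))// lerD//; last by rewrite normrM gtr0_norm// ler_pM2l.
by rewrite (le_trans (ler_normD _ _))// lerD//
  normrM (ger0_norm (sqr_ge0 _)) ler_wpM2l ?sqr_ge0.
Qed.

(** A convex function of [d] that is 0 at 0 has all its increments at least [m 1], so boundedness
    forces [m 1 = 0]. The error in the convexity accumulates to order [e * n^2], and [e] may be
    chosen after [n]. *)
Lemma coupling_harmonic : c 0 0 = c 1 0.
Proof.
have bnd e n : 0 < e -> n.+1%:R * m 1 <= m n.+1 + 4 * e * n.+1%:R ^+ 2 /\
    m 1 <= m n.+1 - m n + 4 * e * n%:R.
  move=> e0; elim: n => [|n [IH1 IH2]].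
    by split; rewrite ?m0 ?mul1r; [rewrite lerDl !mulr_ge0//; lra|rewrite subr0 mulr0 addr0].
  have h := m_convex n e0.
  have IH2' : m 1 <= m n.+2 - m n.+1 + 4 * e * n.+1%:R.
    by rewrite -natr1; lra.
  split => //; rewrite -natr1 mulrDl mul1r.
  have : 4 * e * n.+2%:R ^+ 2 = 4 * e * n.+1%:R ^+ 2 + 4 * e * n.+1%:R + 4 * e * (n.+1%:R + 1).
    by rewrite -[n.+2%:R]natr1; ring.
  have : 0 <= 4 * e * (n.+1%:R + 1) by rewrite !mulr_ge0// ?addr_ge0// ltW.
  by lra.
have mle2M d : m d <= M + M.
  by apply: m_le => k s s0; rewrite (le_trans (ler_normB _ _))// lerD// cM.
have m1 n : n.+1%:R * m 1 <= M + M.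
  apply/ler_addgt0Pr => e e0.
  (* With this choice the accumulated error is exactly [e]. *)
  have e' : 0 < e / (4 * n.+1%:R ^+ 2) by rewrite divr_gt0// mulr_gt0// exprn_gt0.
  have [h _] := bnd _ n e'; apply: (le_trans h); rewrite lerD//.
  have : n.+1%:R != 0 :> R by rewrite pnatr_eq0.
  move: (n.+1%:R : R) => N N0.
  by have -> : 4 * (e / (4 * N ^+ 2)) * N ^+ 2 = e by field.
have m1_ge0 : 0 <= m 1 by exact: le_trans (@gap_le 1 0%N 0 (lexx _)).
have m10 : m 1 <= 0.
  rewrite leNgt; apply/negP => m1pos.
  have := m1 (Num.truncn ((M + M) / m 1)).
  rewrite -ler_pdivlMr// leNgt => /negP; apply; exact: truncnS_gt.
apply/eqP; rewrite -subr_eq0 -normr_le0; apply: le_trans m10.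
exact: (@gap_le 1 0%N 0 (lexx _)).
Qed.

End coupling_harmonic.

(** * Stationary means of a process with jumps that commute with it *)

Section stationary_mean.
Context (R : realType) (S : ptopologicalType) (P : process R S).
Hypotheses (cS : compact [set: S]) (FP : feller P).
Variables (L : (S -> R) -> R) (K : (S -> R) -> S -> R) (lam : R).
Hypotheses (mL : mean L) (lam0 : 0 < lam).
Hypotheses (K_continuous : forall f : S -> R, continuous f -> continuous (K f))
  (KB : forall f g : S -> R, continuous f -> continuous g ->
     K (fun x => f x - g x) = fun x => K f x - K g x)
  (KZ : forall (c : R) (f : S -> R), continuous f -> K (fun x => c * f x) = fun x => c * K f x)
  (K_bound : forall (f : S -> R) (M : R), continuous f -> (forall x, `|f x| <= M) -> forall x, `|K f x| <= M)
  (KP : forall (t : R) (f : S -> R), 0 <= t -> continuous f -> semigroup P t (K f) = K (semigroup P t f)).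
(* L annihilates the generator G + lam (K - 1) F of the process that follows P
   and jumps according to K at rate lam. *)
Hypothesis L_stationary : forall F G : S -> R, generator P F G ->
  L G + lam * (L (K F) - L F) = 0.

Implicit Types (f g h F G : S -> R) (t s a e : R) (k : nat).

Let iterK_continuous k f : continuous f -> continuous (iter k K f).
Proof. by move=> cf; elim: k => //= k; exact: K_continuous. Qed.

Let iterKB k f g : continuous f -> continuous g ->
  iter k K (fun x => f x - g x) = fun x => iter k K f x - iter k K g x.
Proof. by move=> cf cg; elim: k => //= k ->; rewrite KB//; exact: iterK_continuous. Qed.

Let iterK_bound k f (M : R) : continuous f -> (forall x, `|f x| <= M) ->
  forall x, `|iter k K f x| <= M.
Proof. by move=> cf fM; elim: k => //= k IH; apply: K_bound => //; exact: iterK_continuous. Qed.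

Let iterKP k t f : 0 <= t -> continuous f ->
  semigroup P t (iter k K f) = iter k K (semigroup P t f).
Proof. by move=> t0 cf; elim: k => //= k <-; rewrite KP//; exact: iterK_continuous. Qed.

(** Stationarity is tested on the integral [F] over [[0, a]] of the orbit of [phi], the k-th jump
    image of the orbit of [h] at time [s]. As [F] is nearly [a] times the orbit of [phi] at time
    [a], it says that [c k s] is close to [(1 - p) * c k (s + a) + p * c k.+1 (s + a)] with
    [p = a * lam], up to [p * e]. *)
Lemma mean_jump h : continuous h -> L (K h) = L h.
Proof.
move=> ch; have [M hM] := compact_bounded_fun cS ch.
pose c k s := L (iter k K (semigroup P s h)).
suff : c 0%N 0 = c 1%N 0.
  have S0 : semigroup P 0 h = h by apply/funext => x; exact: semigroup0.
  by rewrite /c /= S0.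
apply: (@coupling_harmonic R c M) => [k s s0|e e0].
  have cS' := semigroup_continuous FP s0 ch.
  apply: (mean_bound mL); first exact: iterK_continuous.
  by apply: iterK_bound => // x; exact: semigroup_bound.
have e20 : 0 < e / 2 by rewrite divr_gt0.
have [d d0 hd] := semigroup_modulus FP e20 ch.
(* The first bound keeps [a] within the modulus of continuity, the second makes [a * lam] at most
   1/2. *)
pose a := Num.min (d / 2) (1 / (2 * lam)).
have a0 : 0 < a by rewrite lt_min !divr_gt0// mulr_gt0.
have ad : a < d by rewrite gt_min ltr_pdivrMr// ltr_pMr// ltr1n.
have a0' := ltW a0.
exists (a * lam), a; split => //.
  rewrite mulr_gt0//=; have : a <= 1 / (2 * lam) by rewrite ge_min lexx orbT.
  by rewrite !ler_pdivlMr ?mulr_gt0//; lra.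
move=> k s s0; rewrite /c.
have cSh := semigroup_continuous FP s0 ch.
set phi := iter k K (semigroup P s h).
have cphi : continuous phi by exact: iterK_continuous.
have Sphi (t : R) : 0 <= t -> semigroup P t phi = iter k K (semigroup P (s + t) h).
  move=> t0; rewrite iterKP//; congr (iter k K _); apply/funext => x.
  by rewrite -semigroup_add// addrC.
(* The modulus of [h] serves every [k] and [s] because jumps and semigroup commute and are
   contractions. *)
have modphi (t : R) : 0 < t < d -> forall x, `|semigroup P t phi x - phi x| <= e / 2.
  move=> td x; have t0 : 0 <= t by case/andP: td => /ltW.
  have cth := semigroup_continuous FP t0 ch.
  have -> : semigroup P t phi x - phi x = iter k K (semigroup P s (fun x => semigroup P t h x - h x)) x.
    rewrite Sphi// /phi.
    have -> : semigroup P s (fun x => semigroup P t h x - h x) =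
        fun x => semigroup P (s + t) h x - semigroup P s h x.
      by apply/funext => y; rewrite (semigroupB P cS)// semigroup_add.
    rewrite iterKB//.
    by apply: semigroup_continuous => //; exact: addr_ge0.
  apply: iterK_bound.
    by apply: semigroup_continuous => //; exact: continuous_sub.
  by move=> y; apply: semigroup_bound => z; exact: hd.
have genF := generator_integrated cS FP a0' cphi.
have := L_stationary genF; set F := integrated P a phi.
have cF : continuous F by exact: integrated_continuous.
have cSp : continuous (semigroup P a phi) by exact: semigroup_continuous.
rewrite (meanB mL)// => LE.
have near x : `|F x - a * semigroup P a phi x| <= a * (e / 2).
  by apply: (@integrated_near _ _ _ cS FP a phi x d); rewrite ?a0'.
have caS : continuous (fun x => a * semigroup P a phi x) by exact: continuous_scale.
have h1 : `|L F - a * L (semigroup P a phi)| <= a * (e / 2).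
  have [_ mZ _ _] := mL.
  rewrite -mZ// -(meanB mL)//; apply: (mean_bound mL) => //; exact: continuous_sub.
have h2 : `|L (K F) - a * L (K (semigroup P a phi))| <= a * (e / 2).
  have [_ mZ _ _] := mL.
  rewrite -mZ//; last exact: K_continuous.
  rewrite -KZ// -(meanB mL)//; try exact: K_continuous.
  rewrite -KB//; apply: (mean_bound mL); first by apply: K_continuous; exact: continuous_sub.
  by apply: K_bound => //; exact: continuous_sub.
rewrite -Sphi// -[iter k.+1 K _]/(K (iter k K (semigroup P (s + a) h))) -Sphi//.
set A := L (semigroup P a phi) in LE h1 *; set B := L (K (semigroup P a phi)) in h2 *.
have -> : L phi - ((1 - a * lam) * A + a * lam * B) =
    lam * ((L (K F) - a * B) - (L F - a * A)) by lra.
rewrite normrM gtr0_norm// mulrAC mulrC ler_pM2r//.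
by rewrite (le_trans (ler_normB _ _))// (le_trans (lerD h2 h1))//; lra.
Qed.

(** Once the jump term vanishes, stationarity of the integrated orbit over [[0, t]] is the claim. *)
Lemma mean_semigroup t f : 0 <= t -> continuous f -> L (semigroup P t f) = L f.
Proof.
move=> t0 cf; have gF := generator_integrated cS FP t0 cf.
have := L_stationary gF; rewrite mean_jump; last exact: integrated_continuous.
rewrite subrr mulr0 addr0 (meanB mL)//; last exact: semigroup_continuous.
by move=> /eqP; rewrite subr_eq0 => /eqP.
Qed.

End stationary_mean.

(** * Configurations *)

(** The witness is the distance to the complement, cut off at 1 since it is infinite when the
    complement is empty. *)
Lemma open_cozero (R : realType) (S : pseudoMetricType R) (U : set S) : open U ->
  exists u : S -> R, [/\ continuous u, forall x, 0 <= u x & U = [set x | 0 < u x]].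
Proof.
move=> oU; pose f x := mine (edist_inf (~` U) x) 1%E.
have f0 x : (0 <= f x)%E by rewrite le_min edist_inf_ge0 lee01.
have f1 x : (f x <= 1)%E by rewrite ge_min lexx orbT.
have ff x : f x \is a fin_num by rewrite ge0_fin_numE// (le_lt_trans (f1 x))// ltry.
exists (fine \o f); split=> [x|x|].
- apply/cvgrPdist_le => e e0.
  have lip y z : ball y e z -> fine (f y) <= fine (f z) + e.
    move=> /(@edist_fin R S e (y, z) e0) yz.
    rewrite -lee_fin EFinD !fineK// /f.
    have [z1|z1] := leP (edist_inf (~` U) z) 1%E.
      rewrite ge_min (le_trans (edist_inf_triangle _ y z))//.
      by rewrite [leLHS]addeC; apply: leeD2l.
    by rewrite ge_min leeDl ?orbT// lee_fin ltW.
  have /nbhs_ballP : nbhs_ball x (ball x e) by exists e.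
  apply: filterS => y xy /=; rewrite ler_distl lerBlDr; apply/andP.
  by split; apply: lip => //; exact: ball_sym.
- by rewrite /= fine_ge0.
- apply/seteqP; split=> x /=.
    move=> Ux; have [r /= r0 rU] : nbhs_ball x U by apply/nbhs_ballP; exact: open_nbhs_nbhs.
    rewrite -lte_fin fineK// lt_min lte01 andbT.
    apply: (@lt_le_trans _ _ r%:E); first by rewrite lte_fin.
    apply: le_ereal_inf_tmp => _ [a aU <-]; rewrite leNgt; apply/negP => /edist_lt_ball/=.
    by move=> /rU.
  move=> fx; apply: contrapT => xU; move: fx.
  by rewrite /f (edist_inf0 (xU : (~` U) x)) min_l ?lee01//= ltxx.
Qed.

Section configurations.
Context (R : realType) (E : pmetricType R).
Local Notation Omega := (config E).

Lemma config_compact : compact [set: E] -> compact [set: Omega].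
Proof.
move=> cE; have := @tychonoff int (fun=> E) (fun=> setT) (fun=> cE).
by congr compact; apply/seteqP; split.
Qed.

Lemma config_cozero (U : set Omega) : open U ->
  exists u : Omega -> R, [/\ continuous u, forall x, 0 <= u x & U = [set x | 0 < u x]].
Proof. exact: (@open_cozero R (prod_topology (fun _ : int => E))). Qed.

Lemma config_cvg (T : Type) (F : set_system T) (f : T -> Omega) (eta : Omega) :
  Filter F -> (forall x : int, (fun t => f t x) @ F --> eta x) -> f @ F --> eta.
Proof.
move=> FF fx; apply/cvg_sup => x; apply/cvg_image.
  by apply/seteqP; split => // y _; exists (fun=> y).
move=> A /= /fx; rewrite /= nbhs_simpl /= => FA.
exists [set h : Omega | A (h x)] => //.
apply/seteqP; split => [y [h Ah <-]//|y Ay].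
by exists (fun=> y).
Qed.

Lemma config_eval_continuous (x : int) : continuous (fun eta : Omega => eta x).
Proof. exact: (@proj_continuous int (fun=> E) x). Qed.

Lemma shift_continuous (x : int) : continuous (Defs.shift x : Omega -> Omega).
Proof.
move=> eta.
have H y : (fun xi : Omega => Defs.shift x xi y) @ nbhs eta --> Defs.shift x eta y.
  exact: (@config_eval_continuous (y - x) eta).
exact: (@config_cvg Omega (nbhs eta) (Defs.shift x) (Defs.shift x eta) _ H).
Qed.

Lemma shiftD (x y : int) (eta : Omega) : Defs.shift x (Defs.shift y eta) = Defs.shift (x + y) eta.
Proof. by apply/funext => z; rewrite /Defs.shift opprD addrA. Qed.

Lemma shift0 (eta : Omega) : Defs.shift 0 eta = eta.
Proof. by apply/funext => z; rewrite /Defs.shift subr0. Qed.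

Lemma continuous_shift (f : Omega -> R) x : continuous f ->
  continuous (fun eta => f (Defs.shift x eta)).
Proof. by move=> cf eta; apply: continuous_comp; [exact: shift_continuous|exact: cf]. Qed.

Variable P : process R Omega.
Hypotheses (cE : compact [set: E]) (TP : translation_invariant P).

(** A mixture with a constant kernel, used only to pass from sets to functions. *)
Lemma semigroup_shift (t : R) (f : Omega -> R) (x : int) eta : 0 <= t -> continuous f ->
  semigroup P t (fun xi => f (Defs.shift x xi)) eta = semigroup P t f (Defs.shift x eta).
Proof.
move=> t0 cf; have [M fM] := compact_bounded_fun (config_compact cE) cf.
have me := @measurable_eval R Omega t t0.
have ms : measurable_fun [set: borel Omega] (Defs.shift x : borel Omega -> borel Omega).
  apply: (@measurability _ _ _ (borel Omega) _ _ (@open Omega)) => //.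
  move=> _ [U oU <-]; rewrite setTI; apply: open_borel.
  by apply: open_comp => // ? _; exact: shift_continuous.
transitivity (\int[P eta]_(w in setT) semigroup P t f (Defs.shift x eta)); last first.
  by rewrite expectation_cst//; exact: process_total.
apply: (@expectation_mixture _ _ _ _ (pathM R Omega) (pathM R Omega) (pathM R Omega)
  (borel Omega) R (P eta) (P eta) (fun=> P (Defs.shift x eta))
  (fun w : Defs.path R Omega => Defs.shift x (w t)) (fun w : Defs.path R Omega => w t)
  _ _ _ _ _ _ _ f M) => //.
- exact: process_total.
- exact: process_total.
- by move=> _; exact: process_total.
- exact: (measurableT_comp ms me).
- move=> B mB; rewrite integral_cst// [X in (_ * X)%E](process_total P eta) mule1.
  exact: TP.
- exact: continuous_borel.
Qed.

(** A test pair seen from any position of the walker is again a test pair, which admits it to the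
    forward equation. *)
Lemma generator_shift (F G : Omega -> R) (x : int) : generator P F G ->
  generator P (fun eta => F (Defs.shift x eta)) (fun eta => G (Defs.shift x eta)).
Proof.
move=> [cF cG FG]; split; [exact: continuous_shift|exact: continuous_shift|].
move=> e /FG /near0_rightP[d d0 hd]; apply/near0_rightP; exists d => // t td eta.
by rewrite semigroup_shift//; [exact: hd|case/andP: td => /ltW].
Qed.

End configurations.

(** * Unconditional sums over the integers *)

Section unconditional_sum.
Context (R : realType).
Implicit Types (u v M : int -> R).

Definition sumR u : R := fine (sumZ (fun z => (u z)%:E)).

Definition dominating M := (forall z, 0 <= M z) /\
  (\esum_(z in [set: int]) (M z)%:E < +oo)%E.

Lemma dominating_fin M (A : set int) : dominating M ->
  (\esum_(z in A) (M z)%:E)%E \is a fin_num.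
Proof.
move=> [M0 Moo]; rewrite ge0_fin_numE; last first.
  by apply: esum_ge0 => z _; rewrite lee_fin.
apply: le_lt_trans Moo; rewrite esum_mkcond; apply: le_esum => z _.
by case: ifPn => //; rewrite lee_fin.
Qed.

Lemma dominatingD M N : dominating M -> dominating N ->
  dominating (fun z => M z + N z).
Proof.
move=> [M0 Moo] [N0 Noo]; split; first by move=> z; exact: addr_ge0.
under eq_esum do rewrite EFinD.
by rewrite esumD ?lte_add_pinfty// => z _; rewrite lee_fin.
Qed.

Lemma dominating_le M N : (forall z, 0 <= N z) -> (forall z, N z <= M z) ->
  dominating M -> dominating N.
Proof.
move=> N0 NM [M0 Moo]; split => //.
by apply: le_lt_trans Moo; apply: le_esum => z _; rewrite lee_fin.
Qed.

Lemma esumZl (c : R) (A : set int) M : 0 < c -> (forall z, 0 <= M z) ->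
  (\esum_(z in A) (c * M z)%:E = c%:E * \esum_(z in A) (M z)%:E)%E.
Proof.
move=> c0 M0; have le (c' : R) (N : int -> R) : 0 < c' -> (forall z, 0 <= N z) ->
    (\esum_(z in A) (c' * N z)%:E <= c'%:E * \esum_(z in A) (N z)%:E)%E.
  move=> c'0 N0; apply: ge_ereal_sup => _ [F FA <-].
  rewrite (_ : \sum_(x \in F) _ = c'%:E * \sum_(x \in F) (N x)%:E)%E; last first.
    rewrite ge0_mule_fsumr; last by move=> z; rewrite lee_fin.
    by under eq_fsbigr do rewrite EFinM.
  by rewrite lee_pmul2l//; apply: ereal_sup_ubound; exists F.
apply/eqP; rewrite eq_le le//= -lee_pdivlMl//.
have := le c^-1 (fun z => c * M z); rewrite invr_gt0 => /(_ c0 _)/=.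
under eq_esum do rewrite mulKf ?gt_eqF//.
by apply => z; rewrite mulr_ge0// ltW.
Qed.

Lemma dominatingZ (c : R) M : 0 <= c -> dominating M -> dominating (fun z => c * M z).
Proof.
(* [esumZl] divides by its constant, so [c] is replaced by the positive [c + 1]. *)
move=> c0 dM; have c1 : 0 < c + 1 by rewrite ltr_wpDl.
apply: (@dominating_le (fun z => (c + 1) * M z)); case: dM => M0 Moo.
- by move=> z; rewrite mulr_ge0.
- by move=> z; rewrite ler_wpM2r// lerDl.
- split; first by move=> z; rewrite mulr_ge0// ltW.
  by rewrite esumZl// lte_mul_pinfty// lee_fin ltW.
Qed.

(** Since [u + M] lies between 0 and [2 * M], the signed sum is a difference of two convergent
    nonnegative sums, whose tails differ by at most the tail of [M]. *)
Lemma sumR_near M u (F : set int) : dominating M -> (forall z, `|u z| <= M z) ->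
  finite_set F ->
  `|sumR u - \sum_(z \in F) u z| <= fine (\esum_(z in ~` F) (M z)%:E)%E.
Proof.
move=> dM uM finF; have [M0 Moo] := dM.
have N0 z : 0 <= u z + M z.
  by have := uM z; rewrite ler_norml => /andP[+ _]; rewrite -subr_ge0 opprK.
have NM z : u z + M z <= 2 * M z.
  rewrite mulrDl mul1r lerD2r; exact: le_trans (ler_norm _) (uM z).
have dN : dominating (fun z => u z + M z).
  by apply: dominating_le (dominatingZ _ dM) => //; rewrite ler0n.
have E : sumR u = fine (\esum_(z in setT) (u z + M z)%:E)%E -
                  fine (\esum_(z in setT) (M z)%:E)%E.
  rewrite /sumR /sumZ -fineB; [|exact: dominating_fin..].
  have summ N : dominating N -> summable setT (fun z => (N z)%:E).
    move=> [N0' Noo]; rewrite /summable (eq_esum (b := fun z => (N z)%:E))//.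
    by move=> z _; rewrite gee0_abs// lee_fin.
  have := esumB (summ _ dN) (summ _ dM) (fun z _ => N0 z) (fun z _ => M0 z).
  have <- : (fun z => (u z)%:E) = ((fun z => (u z + M z)%:E) \- (fun z => (M z)%:E))%E.
    by apply/funext => z; rewrite /= -EFinB addrK.
  by move=> <-.
have split N : dominating N -> fine (\esum_(z in setT) (N z)%:E)%E =
    \sum_(z \in F) N z + fine (\esum_(z in ~` F) (N z)%:E)%E.
  move=> dN'; rewrite (esumID F)//; last by case: dN' => N0' _ z _; rewrite lee_fin.
  rewrite !setTI fineD; [|exact: dominating_fin..].
  congr (_ + _); rewrite esum_fset//; last by case: dN' => N0' _ z _; rewrite lee_fin.
  by rewrite fsumEFin.
rewrite E split// split//.
have -> : \sum_(z \in F) (u z + M z) = \sum_(z \in F) u z + \sum_(z \in F) M z.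
  by rewrite -fsbig_split.
set a := \sum_(z \in F) u z; set b := \sum_(z \in F) M z.
set c := fine _; set d := fine _.
have -> : a + b + c - (b + d) - a = c - d by ring.
have c0 : 0 <= c by rewrite fine_ge0// esum_ge0// => z _; rewrite lee_fin.
have cd : c <= 2 * d.
  rewrite -lee_fin EFinM !fineK; [|exact: dominating_fin..].
  rewrite -esumZl//; apply: le_esum => z _; rewrite lee_fin; exact: NM.
by rewrite ler_norml; apply/andP; split; lra.
Qed.

(** One finite list serves all [u] dominated by [M]; linearity, continuity and exchange with
    expectations follow from finite sums by this uniformity. *)
Lemma sumR_approx M (e : R) : dominating M -> 0 < e ->
  exists s : seq int, forall u, (forall z, `|u z| <= M z) ->
    `|sumR u - \sum_(z <- s) u z| <= e.
Proof.
move=> dM e0; have [M0 Moo] := dM.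
have [_ [F [finF _] <-]] := ub_ereal_sup_adherent e0 (dominating_fin setT dM).
rewrite -/(esum setT (fun z => (M z)%:E)) (esumID F)//; last first.
  by move=> z _; rewrite lee_fin.
rewrite !setTI esum_fset//; last by move=> z _; rewrite lee_fin.
move=> H; exists (finmap.enum_fset (fset_set F)) => u uM.
rewrite -fsbig_finite//; apply: le_trans (sumR_near dM uM finF) _.
have fF : (\sum_(z \in F) (M z)%:E)%E \is a fin_num.
  by rewrite fsumEFin.
move: fF H; have fT := dominating_fin (~` F) dM.
move: fT; case: (\esum_(z in ~` F) (M z)%:E)%E => // t _.
case: (\sum_(z \in F) (M z)%:E)%E => // r _.
move=> H; have {}H : ((r + t - e)%:E < r%:E)%E := H.
by move: H; rewrite lte_fin /=; lra.
Qed.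

Lemma sumR_bound M u : dominating M -> (forall z, `|u z| <= M z) ->
  `|sumR u| <= fine (\esum_(z in setT) (M z)%:E)%E.
Proof.
move=> dM uM; have := sumR_near dM uM (finite_set0 _).
by rewrite fsbig_set0 subr0 setC0.
Qed.

Lemma sumRD M N u v : dominating M -> dominating N ->
  (forall z, `|u z| <= M z) -> (forall z, `|v z| <= N z) ->
  sumR (fun z => u z + v z) = sumR u + sumR v.
Proof.
move=> dM dN uM vN; apply/eqP; rewrite -subr_eq0 -normr_le0.
apply/ler_addgt0Pr => e e0; rewrite add0r.
have e30 : 0 < e / 3 by rewrite divr_gt0.
have [s hs] := sumR_approx (dominatingD dM dN) e30.
have [M0 _] := dM; have [N0 _] := dN.
have h1 := hs (fun z => u z + v z); have h2 := hs u; have h3 := hs v.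
have {}h1 : `|sumR (fun z => u z + v z) - (\sum_(z <- s) u z + \sum_(z <- s) v z)| <= e / 3.
  by rewrite -big_split/=; apply: h1 => z; rewrite (le_trans (ler_normD _ _))// lerD.
have {}h2 : `|sumR u - \sum_(z <- s) u z| <= e / 3.
  by apply: h2 => z; rewrite (le_trans (uM z))// lerDl.
have {}h3 : `|sumR v - \sum_(z <- s) v z| <= e / 3.
  by apply: h3 => z; rewrite (le_trans (vN z))// lerDr.
move: h1 h2 h3; rewrite !ler_norml => /andP[? ?] /andP[? ?] /andP[? ?].
by apply/andP; split; lra.
Qed.

Lemma sumRZ M c u : dominating M -> (forall z, `|u z| <= M z) ->
  sumR (fun z => c * u z) = c * sumR u.
Proof.
move=> dM uM; apply/eqP; rewrite -subr_eq0 -normr_le0.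
apply/ler_addgt0Pr => e e0; rewrite add0r.
have c1 : 0 < `|c| + 1 by rewrite ltr_wpDl.
have e'0 : 0 < e / 2 / (`|c| + 1) by rewrite !divr_gt0.
have [M0 _] := dM.
have [s hs] := sumR_approx (dominatingZ (ltW c1) dM) e'0.
have h1 : `|sumR (fun z => c * u z) - c * \sum_(z <- s) u z| <= e / 2 / (`|c| + 1).
  rewrite mulr_sumr; apply: hs => z; rewrite normrM ler_pM//.
  by rewrite lerDl.
have h2 : `|sumR u - \sum_(z <- s) u z| <= e / 2 / (`|c| + 1).
  by apply: hs => z; rewrite (le_trans (uM z))// ler_peMl// lerDr.
have -> : sumR (fun z => c * u z) - c * sumR u =
  (sumR (fun z => c * u z) - c * \sum_(z <- s) u z) - c * (sumR u - \sum_(z <- s) u z) by ring.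
rewrite (le_trans (ler_normB _ _))// normrM.
have h3 : `|c| * `|sumR u - \sum_(z <- s) u z| <= `|c| * (e / 2 / (`|c| + 1)).
  by rewrite ler_wpM2l.
apply: (le_trans (lerD h1 h3)).
have -> : e / 2 / (`|c| + 1) + `|c| * (e / 2 / (`|c| + 1)) = e / 2.
  by field; rewrite gt_eqF.
by rewrite ler_pdivrMr// ler_pMr// ler1n.
Qed.

Lemma sumRB M N u v : dominating M -> dominating N ->
  (forall z, `|u z| <= M z) -> (forall z, `|v z| <= N z) ->
  sumR (fun z => u z - v z) = sumR u - sumR v.
Proof.
move=> dM dN uM vN; have vN' z : `|-1 * v z| <= N z by rewrite mulN1r normrN.
rewrite -[- sumR v]mulN1r -(sumRZ _ dN vN) -(sumRD dM dN uM vN').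
by congr sumR; apply/funext => z; rewrite mulN1r.
Qed.

Lemma sumR_norm_le u v : dominating v -> (forall z, `|u z| <= v z) -> `|sumR u| <= sumR v.
Proof.
move=> dv uv; apply/ler_addgt0Pr => e e0.
have e20 : 0 < e / 2 by rewrite divr_gt0.
have [v0 _] := dv; have [s hs] := sumR_approx dv e20.
have h1 := hs u uv; have h2 : `|sumR v - \sum_(z <- s) v z| <= e / 2.
  by apply: hs => z; rewrite ger0_norm.
have h3 : `|\sum_(z <- s) u z| <= \sum_(z <- s) v z.
  by rewrite (le_trans (ler_norm_sum _ _ _))//; apply: ler_sum => z _.
have h4 := ler_normD (sumR u - \sum_(z <- s) u z) (\sum_(z <- s) u z).
rewrite subrK in h4; move: h2; rewrite ler_norml => /andP[? ?]; lra.
Qed.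

Lemma sumR_ge0E u : dominating u -> sumR u = fine (\esum_(z in setT) (u z)%:E)%E.
Proof.
move=> [u0 _]; rewrite /sumR /sumZ; congr fine.
rewrite [X in (_ - X)%E](_ : _ = 0%E) ?sube0; last first.
  apply: esum1 => z _; apply: (@ge0_funenegE _ _ setT); rewrite ?inE//.
  by move=> y _; rewrite lee_fin.
apply: eq_esum => z _; apply: (@ge0_funeposE _ _ setT); rewrite ?inE//.
by move=> y _; rewrite lee_fin.
Qed.

Lemma sumR_continuous (S : topologicalType) M (F : S -> int -> R) :
  dominating M -> (forall x z, `|F x z| <= M z) ->
  (forall z, continuous (F ^~ z)) -> continuous (fun x => sumR (F x)).
Proof.
move=> dM FM cF; apply: uniform_limit_continuous => e e0.
have [s hs] := sumR_approx dM e0.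
exists (fun x => \sum_(z <- s) F x z); last by move=> x; exact: hs.
elim: s {hs} => [|z s IHs].
  by under eq_fun do rewrite big_nil; exact: cst_continuous.
by under eq_fun do rewrite big_cons; apply: continuous_add => //; exact: cF.
Qed.

End unconditional_sum.

Definition absz_ {R : realType} (z : int) : R := `|z|%:~R.

Lemma absz_ge0 (R : realType) (z : int) : 0 <= absz_ z :> R.
Proof. by rewrite /absz_ ler0z. Qed.

Lemma absz_ge1 (R : realType) (z : int) : z != 0 -> 1 <= absz_ z :> R.
Proof. by move=> z0; rewrite /absz_ -[1]/(1%:~R) ler_int -gtz0_ge1 normr_gt0. Qed.

(** * The walk with rates that do not depend on the environment *)

Section independent_walk.
Context (R : realType) (E : pmetricType R) (P : process R (config E)).
Local Notation Omega := (config E).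
Hypotheses (cE : compact [set: E]) (FP : feller P) (TP : translation_invariant P).
Variable a0 : int -> R.
Hypotheses (a0_ge0 : forall z, 0 <= a0 z)
  (a0_sum : dominating (fun z => absz_ z * a0 z)).
Implicit Types (f g : Omega -> R) (eta : Omega).

Let cO := config_compact cE.

Definition jumps f eta : R :=
  sumR (fun z => a0 z * (f (Defs.shift (- z) eta) - f eta)).

(** A jump by 0 moves nothing, and without it the weighted rates [|z| * a0 z] dominate the rates
    themselves. *)
Let rate (z : int) : R := if z == 0 then 0 else a0 z.

Let rate_ge0 z : 0 <= rate z.
Proof. by rewrite /rate; case: ifP. Qed.

Let rate_le z : rate z <= absz_ z * a0 z.
Proof.
rewrite /rate; case: eqVneq => [->|z0]; first by rewrite mulr_ge0// absz_ge0.
by rewrite ler_peMl// absz_ge1.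
Qed.

Let rate_sum : dominating rate.
Proof. exact: dominating_le rate_ge0 rate_le a0_sum. Qed.

Let jump_term f eta z : a0 z * (f (Defs.shift (- z) eta) - f eta) =
  rate z * (f (Defs.shift (- z) eta) - f eta).
Proof.
rewrite /rate; case: eqVneq => // ->.
by rewrite oppr0 shift0 subrr !mulr0.
Qed.

Let jumpsE f eta :
  jumps f eta = sumR (fun z => rate z * (f (Defs.shift (- z) eta) - f eta)).
Proof. by congr sumR; apply/funext => z; rewrite jump_term. Qed.

Let rate_bound f (M : R) eta (z : int) : (forall xi, `|f xi| <= M) ->
  `|rate z * (f (Defs.shift (- z) eta) - f eta)| <= (2 * M) * rate z.
Proof.
move=> fM; rewrite normrM ger0_norm// mulrC ler_wpM2r//.
by rewrite (le_trans (ler_normB _ _))// mulrDl mul1r lerD.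
Qed.

Let rate_sumM (M : R) : 0 <= M -> dominating (fun z => (2 * M) * rate z).
Proof. by move=> M0; apply: dominatingZ => //; rewrite mulr_ge0. Qed.

Let bound_ge0 f (M : R) : (forall xi, `|f xi| <= M) -> 0 <= M.
Proof. by move=> fM; exact: le_trans (normr_ge0 _) (fM point). Qed.

Lemma jumps_continuous f : continuous f -> continuous (jumps f).
Proof.
move=> cf; have [M fM] := compact_bounded_fun cO cf.
rewrite (_ : jumps f = fun eta => sumR (fun z => rate z * (f (Defs.shift (- z) eta) - f eta))).
  apply: (sumR_continuous (rate_sumM (bound_ge0 fM))) => [eta z|z].
    exact: rate_bound.
  apply: continuous_scale; apply: continuous_sub => //.
  exact: (@continuous_shift R E f (- z)).
by apply/funext => eta; exact: jumpsE.
Qed.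

Let jumpsB f g eta : continuous f -> continuous g ->
  jumps (fun xi => f xi - g xi) eta = jumps f eta - jumps g eta.
Proof.
move=> cf cg; have [M fM] := compact_bounded_fun cO cf.
have [N gN] := compact_bounded_fun cO cg.
rewrite !jumpsE -(sumRB (rate_sumM (bound_ge0 fM)) (rate_sumM (bound_ge0 gN))).
- by congr sumR; apply/funext => z; ring.
- by move=> z; exact: rate_bound.
- by move=> z; exact: rate_bound.
Qed.

Let jumpsZ c f eta : continuous f -> jumps (fun xi => c * f xi) eta = c * jumps f eta.
Proof.
move=> cf; have [M fM] := compact_bounded_fun cO cf.
rewrite !jumpsE -(sumRZ c (rate_sumM (bound_ge0 fM))).
- by congr sumR; apply/funext => z; ring.
- by move=> z; exact: rate_bound.
Qed.

(** Translation invariance gives the identity for finitely many jumps, and the remaining ones are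
    uniformly small. *)
Let semigroup_jumps t f eta : 0 <= t -> continuous f ->
  semigroup P t (jumps f) eta = jumps (semigroup P t f) eta.
Proof.
move=> t0 cf; have [M fM] := compact_bounded_fun cO cf.
apply/eqP; rewrite -subr_eq0 -normr_le0; apply/ler_addgt0Pr => e e0; rewrite add0r.
have e20 : 0 < e / 2 by rewrite divr_gt0.
have [s hs] := sumR_approx (rate_sumM (bound_ge0 fM)) e20.
pose J g xi := \sum_(z <- s) rate z * (g (Defs.shift (- z) xi) - g xi).
have cterm g z : continuous g ->
    continuous (fun xi => rate z * (g (Defs.shift (- z) xi) - g xi)).
  move=> cg; apply: continuous_scale; apply: continuous_sub => //.
  exact: (@continuous_shift R E g (- z)).
have cJ g : continuous g -> continuous (J g).
  move=> cg; rewrite /J; elim: (s) => [|z r IHr].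
    by under eq_fun do rewrite big_nil; exact: cst_continuous.
  by under eq_fun do rewrite big_cons; apply: continuous_add => //; exact: cterm.
have near g xi : (forall xi, `|g xi| <= M) -> `|jumps g xi - J g xi| <= e / 2.
  by move=> gM; rewrite jumpsE; apply: hs => z; exact: rate_bound.
have SJ : semigroup P t (J f) eta = J (semigroup P t f) eta.
  rewrite /J; elim: (s) => [|z r IHr].
    by under eq_fun do rewrite big_nil; rewrite big_nil semigroup_cst.
  have cr : continuous (fun xi => \sum_(z <- r) rate z * (f (Defs.shift (- z) xi) - f xi)).
    elim: (r) => [|y q IHq].
      by under eq_fun do rewrite big_nil; exact: cst_continuous.
    by under eq_fun do rewrite big_cons; apply: continuous_add => //; exact: cterm.
  under eq_fun do rewrite big_cons.
  rewrite big_cons (semigroupD P cO)//; last exact: cterm.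
  have cs := @continuous_shift R E f (- z) cf.
  rewrite IHr (semigroupZ P cO)//; last exact: continuous_sub.
  by rewrite (semigroupB P cO)// (semigroup_shift cE TP).
have h1 : `|semigroup P t (jumps f) eta - semigroup P t (J f) eta| <= e / 2.
  apply: (semigroup_near P cO) => //; [exact: jumps_continuous|exact: cJ|].
  by move=> xi; exact: near.
have h2 : `|jumps (semigroup P t f) eta - J (semigroup P t f) eta| <= e / 2.
  by apply: near => xi; exact: semigroup_bound.
rewrite SJ in h1; rewrite distrC in h2.
by rewrite [e]splitr (le_trans _ (lerD h1 h2))//; apply: le_trans (ler_normD _ _); rewrite subrKA.
Qed.

(** Any positive bound on the total rate would do. *)
Let lam : R := 1 + fine (\esum_(z in [set: int]) (absz_ z * a0 z)%:E)%E.

Let lam_gt0 : 0 < lam.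
Proof.
rewrite ltr_pwDl// fine_ge0// esum_ge0// => z _; rewrite lee_fin.
by case: a0_sum => + _; apply.
Qed.

(** The transition operator of the walk observed at the jumps of a clock of rate [lam]: a convex
    combination of [f] and its translates, because [lam] is at least the total rate. *)
Let kernel f eta : R := f eta + lam^-1 * jumps f eta.

Let kernel_bound f (M : R) : continuous f -> (forall eta, `|f eta| <= M) ->
  forall eta, `|kernel f eta| <= M.
Proof.
move=> cf fM eta; have M0 := bound_ge0 fM.
have rM xi z : `|rate z * f xi| <= M * rate z.
  by rewrite normrM ger0_norm// mulrC ler_wpM2r.
have dM : dominating (fun z => M * rate z) by exact: dominatingZ.
have rM' z : `|rate z * f (Defs.shift (- z) eta)| <= M * rate z by exact: rM.
have s0 : 0 <= sumR rate by rewrite sumR_ge0E// fine_ge0// esum_ge0// => z _; rewrite lee_fin.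
have slam : sumR rate <= lam.
  apply: le_trans (ler_norm _) _; apply: le_trans (sumR_bound a0_sum _) _.
    by move=> z; rewrite ger0_norm.
  by rewrite lerDr.
have -> : kernel f eta = (1 - lam^-1 * sumR rate) * f eta +
    lam^-1 * sumR (fun z => rate z * f (Defs.shift (- z) eta)).
  rewrite /kernel jumpsE.
  have -> : sumR (fun z => rate z * (f (Defs.shift (- z) eta) - f eta)) =
      sumR (fun z => rate z * f (Defs.shift (- z) eta)) - sumR (fun z => rate z * f eta).
    rewrite -(sumRB dM dM)//.
    by congr sumR; apply/funext => z; rewrite mulrBr.
  have -> : sumR (fun z => rate z * f eta) = sumR rate * f eta.
    rewrite mulrC -(sumRZ (f eta) rate_sum); last by move=> z; rewrite ger0_norm.
    by congr sumR; apply/funext => z; rewrite mulrC.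
  by ring.
have l1 : 0 <= 1 - lam^-1 * sumR rate by rewrite subr_ge0 ler_pdivrMl// mulr1.
have h : `|sumR (fun z => rate z * f (Defs.shift (- z) eta))| <= M * sumR rate.
  rewrite -(sumRZ M rate_sum); last by move=> z; rewrite ger0_norm.
  exact: sumR_norm_le.
have h1 : `|(1 - lam^-1 * sumR rate) * f eta| <= (1 - lam^-1 * sumR rate) * M.
  by rewrite normrM ger0_norm// ler_wpM2l.
have h2 : `|lam^-1 * sumR (fun z => rate z * f (Defs.shift (- z) eta))| <=
    lam^-1 * (M * sumR rate).
  by rewrite normrM gtr0_norm ?invr_gt0// ler_wpM2l// invr_ge0 ltW.
rewrite (le_trans (ler_normD _ _))// (le_trans (lerD h1 h2))//.
by rewrite (_ : _ + _ = M)//; ring.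
Qed.

(** As [jumps] is [lam] times [kernel - 1], the hypothesis on [L] is the stationarity required by
    [mean_semigroup], and [invariant_mean] concludes. *)
Theorem stationary_mean (L : (Omega -> R) -> R) (mu : probability (borel Omega) R) :
  mean L ->
  (forall F G, generator P F G -> L (fun eta => G eta + jumps F eta) = 0) ->
  unique_ergodic P mu -> forall f, continuous f -> L f = \int[mu]_eta f eta.
Proof.
move=> mL LG ue f cf.
have ck g : continuous g -> continuous (kernel g).
  by move=> cg; apply: continuous_add => //; apply: continuous_scale; exact: jumps_continuous.
apply: (invariant_mean cO (@config_cozero R E) FP mL _ ue) => // t g t0 cg.
apply: (@mean_semigroup R Omega P cO FP L kernel lam mL lam_gt0) => //.
- move=> h1 h2 c1 c2; apply/funext => eta.
  by rewrite /kernel jumpsB//; ring.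
- by move=> c h ch; apply/funext => eta; rewrite /kernel jumpsZ//; ring.
- move=> s h s0 ch; apply/funext => eta.
  have cj := jumps_continuous ch.
  have clj := @continuous_scale R Omega lam^-1 _ cj.
  by rewrite /kernel (semigroupD P cO)// (semigroupZ P cO)// semigroup_jumps.
- move=> F G FG; have [cF cG _] := FG.
  have [mD mZ _ _] := mL; have cj := jumps_continuous cF.
  rewrite /kernel mD//; last exact: continuous_scale.
  rewrite mZ// addrAC subrr add0r mulrA divff ?gt_eqF// mul1r -mD//.
  exact: LG.
Qed.

End independent_walk.

(** * Uniformity of the derivative of the rates *)

Section esum_extra.
Context (R : realType).

Lemma ge0_esumZl (T : choiceType) (A : set T) (c : R) (a : T -> \bar R) : 0 <= c ->
  (forall x, (0 <= a x)%E) ->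
  (\esum_(x in A) (c%:E * a x) = c%:E * \esum_(x in A) a x)%E.
Proof.
move=> c0 a0; have le (c' : R) (b : T -> \bar R) : 0 <= c' -> (forall x, (0 <= b x)%E) ->
    (\esum_(x in A) (c'%:E * b x) <= c'%:E * \esum_(x in A) b x)%E.
  move=> c'0 b0; apply: ge_ereal_sup => _ [F FA <-].
  rewrite -ge0_mule_fsumr//.
  by rewrite lee_wpmul2l ?lee_fin//; apply: ereal_sup_ubound; exists F.
move: c0; rewrite le_eqVlt => /predU1P[<-|c0].
  rewrite mul0e; apply: esum1 => x _; exact: mul0e.
apply/eqP; rewrite eq_le le ?(ltW c0)//= -lee_pdivlMl//.
have := le c^-1 (fun x => c%:E * a x)%E; rewrite invr_ge0 => /(_ (ltW c0) _)/=.
under eq_esum do rewrite muleA -EFinM mulVf ?gt_eqF// mul1e.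
by apply => x; rewrite mule_ge0// lee_fin ltW.
Qed.

Lemma esum_exchange (T1 T2 : choiceType) (a : T1 -> T2 -> \bar R) :
  (forall x y, (0 <= a x y)%E) ->
  (\esum_(x in setT) \esum_(y in setT) a x y =
   \esum_(y in setT) \esum_(x in setT) a x y)%E.
Proof.
move=> a0; rewrite !esum_esum//.
pose Q : set (T1 * T2) := [set: T1] `*`` (fun=> [set: T2]).
pose Q' : set (T2 * T1) := [set: T2] `*`` (fun=> [set: T1]).
have bij : set_bij Q' Q (fun k => (k.2, k.1)).
  split; first by move=> [x y].
  - by move=> [x y] [x' y'] _ _ [-> ->].
  - by move=> [x y] _; exists (y, x).
exact: (reindex_esum Q' Q _ (fun k => a k.1 k.2) bij).
Qed.

Lemma esum_compl (T : choiceType) (A : set T) (a : T -> \bar R) :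
  (forall x, (0 <= a x)%E) ->
  (\esum_(x in setT) a x = \esum_(x in A) a x + \esum_(x in ~` A) a x)%E.
Proof. by move=> a0; rewrite (esumID A)// !setTI. Qed.

End esum_extra.

Section lipschitz.
Context (R : realType) (E : pmetricType R).
Hypothesis mdist_le1 : forall a b : E, mdist a b <= 1.
Local Notation Omega := (config E).
Implicit Types (f : Omega -> R) (eta xi : Omega).

Lemma delta_ge0 f x : (0 <= Defs.delta f x)%E.
Proof. by apply: ereal_sup_ubound; left. Qed.

(** [delta] is a supremum of signed quotients; exchanging the two configurations gives the other
    sign. *)
Lemma delta_site f x eta xi : (forall y, y != x -> eta y = xi y) ->
  (`|f eta - f xi|%:E <= Defs.delta f x * (mdist (eta x) (xi x))%:E)%E.
Proof.
move=> exi; have [e|ne] := eqVneq (eta x) (xi x).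
  have -> : eta = xi by apply/funext => y; have [->|/exi] := eqVneq y x.
  by rewrite subrr normr0 mdistxx mule0.
have d0 : 0 < mdist (eta x) (xi x) by rewrite mdist_gt0.
rewrite -lee_pdivrMr// -EFinM; have [h|h] := leP 0 (f eta - f xi).
  apply: ereal_sup_ubound; right; exists (eta, xi) => /=.
    by split => //=; exact/eqP.
  by rewrite ger0_norm.
apply: ereal_sup_ubound; right; exists (xi, eta) => /=.
  by split => /= [|y yx]; [apply/eqP; rewrite eq_sym|rewrite exi].
by rewrite metric_sym ltr0_norm// opprB.
Qed.

(** The sites of [eta] are changed into those of [xi] one at a time, in the order of the codes
    [pickle]; each change costs one term, and continuity handles the limit. *)
Lemma continuous_lipschitz f eta xi : continuous f ->
  (`|f eta - f xi|%:E <=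
   \esum_(x in [set: int]) (Defs.delta f x * (mdist (eta x) (xi x))%:E))%E.
Proof.
move=> cf; pose mix n : Omega := fun x => if (pickle x < n)%N then xi x else eta x.
pose a x := (Defs.delta f x * (mdist (eta x) (xi x))%:E)%E.
have a0 x : (0 <= a x)%E by rewrite mule_ge0 ?delta_ge0// lee_fin mdist_ge0.
have mixn n : (`|f eta - f (mix n)|%:E <= \esum_(x in [set x | (pickle x < n)%N]) a x)%E.
  elim: n => [|n IHn].
    have -> : mix 0%N = eta by apply/funext.
    by rewrite subrr normr0 esum_ge0.
  (* A number that codes no integer leaves the configuration unchanged. *)
  case nx : (@pickle_inv int n) => [x|]; last first.
    have nN (y : int) : pickle y != n.
      by apply/eqP => yn; move: nx; rewrite -yn pickleK_inv.
    have -> : mix n.+1 = mix n.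
      by apply/funext => y; rewrite /mix ltnS (leq_eqVlt (pickle y) n) (negbTE (nN y)).
    apply: (le_trans IHn); rewrite (_ : [set _ | _] = [set x | (pickle x < n.+1)%N])//.
    by apply/seteqP; split => y /=; rewrite ltnS (leq_eqVlt (pickle y) n) (negbTE (nN y)).
  have xn : pickle x = n by have := @pickle_invK int n; rewrite nx.
  have xE (y : int) : y != x -> (pickle y != n).
    by move=> yx; apply/eqP => yn; move: nx; rewrite -yn pickleK_inv => -[yx']; rewrite yx' eqxx in yx.
  rewrite (esumID [set x])//.
  have -> : [set x | (pickle x < n.+1)%N] `&` [set x] = [set x].
    by apply/seteqP; split => y /=; [case|move=> ->; split => //; rewrite xn].
  have -> : [set x | (pickle x < n.+1)%N] `&` ~` [set x] = [set x | (pickle x < n)%N].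
    apply/seteqP; split => y /=.
      by case; rewrite ltnS leq_eqVlt => /orP[/eqP yn /eqP/xE|//]; rewrite yn eqxx.
    by move=> yn; split; [rewrite ltnS ltnW|move=> yx; move: yn; rewrite yx xn ltnn].
  rewrite esum_set1//.
  have h : (`|f (mix n) - f (mix n.+1)|%:E <= a x)%E.
    have := @delta_site f x (mix n) (mix n.+1); rewrite /a.
    have -> : mix n x = eta x by rewrite /mix xn ltnn.
    have -> : mix n.+1 x = xi x by rewrite /mix xn ltnSn.
    by apply => y /xE yn; rewrite /mix ltnS (leq_eqVlt (pickle y) n) (negbTE yn).
  rewrite addeC; apply: le_trans (leeD IHn h).
  by rewrite -EFinD lee_fin; apply: le_trans (ler_normD _ _); rewrite subrKA.
have lim : mix @ \oo --> xi.
  apply: config_cvg => x; apply: cvg_near_cst.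
  by exists (pickle x).+1 => // n /= xn; rewrite /mix xn.
have flim : `|f eta - f (mix n)| @[n --> \oo] --> `|f eta - f xi|.
  apply: cvg_norm; apply: cvgB; first exact: cvg_cst.
  by apply: (cvg_comp _ _ lim); exact: cf.
have [->|fin] := eqVneq (\esum_(x in [set: int]) a x)%E +oo%E; first by rewrite leey.
have finE : (\esum_(x in [set: int]) a x)%E \is a fin_num.
  by rewrite ge0_fin_numE ?ltey// esum_ge0.
rewrite -(fineK finE) lee_fin.
apply: (cvgr_to_le flim); apply: nearW => n.
rewrite -lee_fin (fineK finE); apply: le_trans (mixn n) _.
by rewrite esum_mkcond; apply: le_esum => x _; case: ifPn.
Qed.

End lipschitz.

(** * The gliding hump *)

Section gliding_hump.
Context (R : realType) (E : pmetricType R).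
Hypothesis mdist_le1 : forall a b : E, mdist a b <= 1.
Hypothesis cE : compact [set: E].
Local Notation Omega := (config E).
Variables (d : nat -> Omega -> R) (w : nat -> int -> \bar R) (B : R).
Hypothesis w0 : forall k x, (0 <= w k x)%E.
Hypothesis wB : forall k, (\esum_(x in [set: int]) w k x <= B%:E)%E.
Hypothesis d_lip : forall k eta xi, (`|d k eta - d k xi|%:E <=
  \esum_(x in [set: int]) (w k x * (mdist (eta x) (xi x))%:E))%E.
Hypothesis d_cvg : forall eta, d k eta @[k --> \oo] --> 0.

Let box (n : nat) : set int := [set x | (absz x <= n)%N].

Let mass k (A : set int) : \bar R := \esum_(x in A) w k x.

Let mass_le k (A A' : set int) : A `<=` A' -> (mass k A <= mass k A')%E.
Proof.
move=> AA'; rewrite /mass [leLHS]esum_mkcond [leRHS]esum_mkcond.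
apply: le_esum => x _; case: ifPn => [xA|_]; last by case: ifPn.
by rewrite ifT// inE; apply: AA'; rewrite inE in xA.
Qed.

Let mass_ge0 k A : (0 <= mass k A)%E.
Proof. exact: esum_ge0. Qed.

Let massB k A : (mass k A <= B%:E)%E.
Proof. exact: le_trans (mass_le k (@subsetT _ A)) (wB k). Qed.

Let mass_fin k A : mass k A \is a fin_num.
Proof. by rewrite ge0_fin_numE// (le_lt_trans (massB k A))// ltry. Qed.

Let weight k A : R := fine (mass k A).

Let weight_split k (A A' : set int) : A `<=` A' ->
  weight k A' = weight k A + weight k (A' `\` A).
Proof.
move=> AA'; rewrite /weight -fineD//; congr fine.
by rewrite /mass (esumID A)// (setIidr AA').
Qed.

Let weight_ge0 k A : 0 <= weight k A.
Proof. exact: fine_ge0. Qed.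

Let weightB k A : weight k A <= B.
Proof. by rewrite -lee_fin fineK. Qed.

Let weight_tail k (e : R) (n : nat) : 0 < e -> exists2 m : nat, (n < m)%N & weight k (~` box m) <= e.
Proof.
move=> e0; have [_ [F [finF _] <-] hF] := ub_ereal_sup_adherent e0 (mass_fin k setT).
have [m Fm] : exists m, F `<=` box m.
  exists (\max_(x <- finmap.enum_fset (fset_set F)) absz x)%N => x Fx.
  rewrite /box /=; apply: (@leq_bigmax_seq _ _ xpredT absz) => //.
  by rewrite in_fset_set// inE.
exists (maxn m n).+1; first by rewrite ltnS leq_maxr.
have Fm' : F `<=` box (maxn m n).+1.
  by move=> x /Fm; rewrite /box /= => /leq_trans; apply; rewrite leqW// leq_maxl.
have hw : weight k setT - e < weight k (box (maxn m n).+1).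
  apply: (@lt_le_trans _ _ (weight k F)).
    rewrite -lte_fin EFinB !fineK//.
    by rewrite [X in (_ < X)%E]/mass esum_fset.
  by apply: fine_le => //; exact: mass_le.
have := weight_split k (@subsetT _ (box (maxn m n).+1)); rewrite setTD.
by move: hw; lra.
Qed.

(** The line is cut into four regions: in box m the configurations are close, in the first annulus
    and outside box p they are arbitrary and only the weight counts, in the second annulus they
    agree. *)
Let d_near k eta xi (rho : R) (m n p : nat) : 0 <= rho -> (m <= n)%N -> (n <= p)%N ->
  (forall x, box m x -> mdist (eta x) (xi x) <= rho) ->
  (forall x, box p x -> ~ box n x -> eta x = xi x) ->
  `|d k eta - d k xi| <= rho * B + weight k (box n `\` box m) + weight k (~` box p).
Proof.
move=> rho0 mn np exm exp_.
rewrite -lee_fin; apply: le_trans (d_lip k eta xi) _.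
set g := fun x => (w k x * (mdist (eta x) (xi x))%:E)%E.
have g0 x : (0 <= g x)%E by rewrite mule_ge0// lee_fin mdist_ge0.
have gw x : (g x <= w k x)%E by rewrite -[leRHS]mule1 lee_wpmul2l// lee_fin.
rewrite (esum_compl (box m) g0).
rewrite (esumID (box n) (~` box m) g)//.
rewrite (esumID (box p) (~` box m `&` ~` box n) g)//.
have h1 : (\esum_(x in box m) g x <= (rho * B)%:E)%E.
  apply: (@le_trans _ _ (\esum_(x in box m) (rho%:E * w k x))%E).
    apply: le_esum => x xm; rewrite /g muleC lee_wpmul2r// lee_fin; exact: exm.
  by rewrite ge0_esumZl// EFinM lee_wpmul2l ?lee_fin//; exact: massB.
have h2 : (\esum_(x in ~` box m `&` box n) g x <= (weight k (box n `\` box m))%:E)%E.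
  by rewrite fineK// /mass setDE setIC; apply: le_esum => x _; exact: gw.
have h3 : (\esum_(x in ~` box m `&` ~` box n `&` box p) g x = 0)%E.
  apply: esum1 => x [[_ xn] xp]; rewrite /g exp_// mdistxx mule0//.
have h4 : (\esum_(x in ~` box m `&` ~` box n `&` ~` box p) g x <=
    (weight k (~` box p))%:E)%E.
  rewrite fineK//; apply: (@le_trans _ _ (mass k (~` box m `&` ~` box n `&` ~` box p))).
    by apply: le_esum => x _; exact: gw.
  by apply: mass_le => x [].
by rewrite h3 add0e !EFinD -addeA leeD// leeD.
Qed.

Let box_nbhs (eta : Omega) (n : nat) (rho : R) : 0 < rho ->
  nbhs eta [set xi : Omega | forall x, box n x -> mdist (eta x) (xi x) < rho].
Proof.
move=> rho0.
have site (x : int) : nbhs eta [set xi : Omega | mdist (eta x) (xi x) < rho].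
  have h : nbhs (eta x) [set y | mdist (eta x) y < rho].
    by apply/nbhs_ballP; exists rho => //= y; rewrite ballEmdist.
  exact: (@config_eval_continuous R E x eta _ h).
elim: n => [|n IHn].
  apply: filterS (site 0) => xi h x; rewrite /box /= leqn0 absz_eq0 => /eqP ->.
  exact: h.
apply: filterS3 IHn (site n.+1%:Z) (site (- n.+1%:Z)) => xi h1 h2 h3 x.
rewrite /box /= leq_eqVlt ltnS => /orP[/eqP xn|]; last exact: h1.
by move: xn; case: x => x /=; [move=> ->; exact: h2|move=> [->]; rewrite NegzE; exact: h3].
Qed.

(* Otherwise there are configurations [bad k] with [e < |d k (bad k)|]. Choose a box
   that carries, for infinitely many k, almost the largest weight which a fixed box
   can carry infinitely often. For these k the remaining weight escapes to infinity,
   hence up to c it sits in disjoint annuli along a subsequence. The configuration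
   that is a cluster point of [bad] in the box and [bad (k j)] on the j-th annulus
   contradicts the pointwise convergence of d. *)
Lemma gliding_hump (e : R) : 0 < e -> exists k, forall eta, `|d k eta| <= e.
Proof.
move=> e0; apply: contrapT => H.
have /choice[bad badP] k : exists xi, e < `|d k xi|.
  apply: contrapT => Hk; apply: H; exists k => eta; rewrite leNgt; apply/negP => h.
  by apply: Hk; exists eta.
(* The errors are [c] in the box, [2 * c] on the first annulus and [c] outside, which leaves [c] out
   of [e]. *)
pose c := e / 5; have c0 : 0 < c by rewrite divr_gt0.
have B0 : 0 <= B by exact: le_trans (weight_ge0 0%N setT) (weightB _ _).
(* The levels that some fixed box exceeds for infinitely many [k]. *)
pose frequent := [set r : R | exists m, forall K, exists2 k, (K <= k)%N & r < weight k (box m)].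
have fsup : has_sup frequent.
  split.
    exists (-1), 0%N => K; exists K => //.
    by rewrite (lt_le_trans _ (weight_ge0 _ _))// ltrN10.
  exists B => r [m /(_ 0%N)[k _ /ltW/le_trans]]; apply; exact: weightB.
have [r [m rm] rs] := sup_adherent c0 fsup.
have rare n : exists K, forall k, (K <= k)%N -> weight k (box n) <= sup frequent + c.
  apply: contrapT => Hn.
  have : frequent (sup frequent + c).
    exists n => K; apply: contrapT => HK; apply: Hn; exists K => k Kk.
    by rewrite leNgt; apply/negP => h; apply: HK; exists k.
  by move=> /(sup_upper_bound fsup); rewrite leNgt ltrDl c0.
pose good k := r < weight k (box m).
(* A good [k] puts more than [sup frequent - c] on box m, whereas a larger box eventually carries at
   most [sup frequent + c]. *)
have good_tail n : exists K, forall k, (K <= k)%N -> good k -> (m <= n)%N ->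
    weight k (box n `\` box m) <= 2 * c.
  have [K hK] := rare n; exists K => k Kk gk mn.
  have mn' : box m `<=` box n by move=> x; rewrite /box /= => /leq_trans; exact.
  have := weight_split k mn'; have := hK k Kk; move: gk rs; rewrite /good; lra.
(* The filter of properties of [bad k] for all large good [k]; it is proper since good indices are
   infinitely many. *)
pose FF := [set A : set Omega | exists K, forall k, (K <= k)%N -> good k -> A (bad k)].
have FFF : ProperFilter FF.
  apply: Build_ProperFilter.
    move=> [K hK]; have [k Kk gk] := rm K; exact: (hK k Kk gk).
  split; first by exists 0%N.
  - move=> A A' [K hK] [K' hK']; exists (maxn K K') => k; rewrite geq_max => /andP[Kk K'k] gk.
    by split; [exact: hK|exact: hK'].
  - by move=> A A' AA' [K hK]; exists K => k Kk gk; apply: AA'; exact: hK.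
have FT : FF setT by exists 0%N.
have [xi [_ xi_cluster]] := config_compact cE FFF FT.
pose rho := c / (B + 1).
have rho0 : 0 < rho by rewrite divr_gt0// ltr_wpDl.
have rhoB : rho * B <= c.
  by rewrite /rho mulrAC ler_pdivrMr ?ltr_wpDl// ler_pM2l// lerDl.
have near_bad K : exists2 k, (K <= k)%N & good k /\ forall x, box m x -> mdist (xi x) (bad k x) < rho.
  have := xi_cluster [set zeta | exists2 k, (K <= k)%N & good k /\ zeta = bad k] _ _
    (box_nbhs xi m rho0).
  case; first by exists K => k Kk gk; exists k.
  by move=> zeta [[k Kk [gk ->]] h]; exists k.
have step n j : exists kp : nat * nat, [/\ (j <= kp.1)%N, (n < kp.2)%N,
    (m <= n)%N -> weight kp.1 (box n `\` box m) <= 2 * c,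
    forall x, box m x -> mdist (xi x) (bad kp.1 x) < rho &
    weight kp.1 (~` box kp.2) <= c].
  have [K hK] := good_tail n.
  have [k Kk [gk kx]] := near_bad (maxn K j).
  have [p np hp] := weight_tail k n c0.
  move: Kk; rewrite geq_max => /andP[Kk jk].
  by exists (k, p); split => //=; exact: hK.
have /choice[s sP] nj := step nj.1 nj.2.
(* Radii of nested boxes: [k j] is chosen for the box of radius [N j], and [N j.+1] so that the
   weight of index [k j] outside the next box is at most [c]. *)
pose N := fix N j := if j is j'.+1 then (s (N j', j')).2 else m.
pose k j := (s (N j, j)).1.
have NS j : (N j < N j.+1)%N by have [] := sP (N j, j).
have jN j : (j <= N j)%N by elim: j => // j IHj; exact: leq_ltn_trans (NS j).
have Nhomo i j : (i <= j)%N -> (N i <= N j)%N.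
  elim: j => [|j IHj]; first by rewrite leqn0 => /eqP ->.
  by rewrite leq_eqVlt => /predU1P[->//|/IHj/leq_trans]; apply; exact: ltnW.
have idx x : exists j, (absz x <= N j.+1)%N by exists (absz x); exact: leq_trans (jN _) (ltnW (NS _)).
pose eta : Omega := fun x => if (absz x <= m)%N then xi x else bad (k (ex_minn (idx x))) x.
have etaE j x : box (N j.+1) x -> ~ box (N j) x -> eta x = bad (k j) x.
  rewrite /box /eta /= => xj /negP xj'.
  have xm : ~~ (absz x <= m)%N.
    by apply: contra xj' => /leq_trans; apply; exact: (Nhomo 0%N j (leq0n j)).
  rewrite (negbTE xm); case: ex_minnP => i xi' imin.
  suff -> : i = j by [].
  apply/eqP; rewrite eqn_leq imin//=; rewrite leqNgt; apply/negP => ij.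
  by move/negP: xj'; apply; exact: leq_trans xi' (Nhomo _ _ ij).
have large j : c <= `|d (k j) eta|.
  have [_ _ h1 h2 h3] := sP (N j, j).
  have mN : (m <= N j)%N by exact: (Nhomo 0%N j (leq0n j)).
  have := @d_near (k j) eta (bad (k j)) rho m (N j) (N j.+1) (ltW rho0) mN (ltnW (NS j)) _ (etaE j).
  have dist x : box m x -> mdist (eta x) (bad (k j) x) <= rho.
    by move=> xm; rewrite /eta; have := xm; rewrite /box /= => ->; exact/ltW/h2.
  move=> /(_ dist) h.
  have hb := badP (k j).
  have := h1 mN; rewrite /= in h3 *; move=> h4.
  have h5 : `|d (k j) (bad (k j))| <= `|d (k j) eta| + `|d (k j) eta - d (k j) (bad (k j))|.
    rewrite [X in _ <= _ + X]distrC addrC.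
    by apply: le_trans (ler_normD _ _); rewrite subrK.
  have ce : e = 5 * c by rewrite /c; field.
  rewrite -/(k j) in h3 h4.
  by move: h h3 h4 h5 hb rhoB; rewrite ce /=; lra.
have /cvgrPdist_lt/(_ _ c0)[K _ hK] := d_cvg eta.
have Kk : (K <= k K)%N by have [] := sP (N K, K).
have := hK (k K) Kk; rewrite sub0r normrN => /(le_lt_trans (large K)).
by rewrite ltxx.
Qed.

End gliding_hump.

(** * Difference quotients of the rates *)

Section rates.
Context (R : realType) (E : pmetricType R).
Hypotheses (cE : compact [set: E]) (mdist_le1 : forall a b : E, mdist a b <= 1).
Local Notation Omega := (config E).

Section one_rate.
Variable a : Omega -> int -> R.
Hypothesis a_adm : (rates_norm1 a < +oo)%E.

Definition rate_sup (z : int) : R :=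
  fine ((absz_ z)%:E * ereal_sup [set `|a eta z|%:E | eta in [set: Omega]])%E.

Let term_ge0 z : (0 <= (absz_ z : R)%:E * ereal_sup [set `|a eta z|%:E | eta in [set: Omega]])%E.
Proof.
rewrite mule_ge0 ?lee_fin ?absz_ge0//.
by apply: (@le_trans _ _ `|a point z|%:E) => //; apply: ereal_sup_ubound; exists point.
Qed.

Let term_fin z : ((absz_ z : R)%:E * ereal_sup [set `|a eta z|%:E | eta in [set: Omega]])%E \is a fin_num.
Proof.
rewrite ge0_fin_numE//; apply: le_lt_trans a_adm.
rewrite /rates_norm1 (esum_compl [set z] term_ge0) esum_set1//.
by rewrite leeDl//; apply: esum_ge0.
Qed.

Lemma rate_sup_dominating : dominating rate_sup.
Proof.
split=> [z|]; first by rewrite fine_ge0.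
by under eq_esum do rewrite fineK//.
Qed.

Lemma rate_le_sup eta z : absz_ z * `|a eta z| <= rate_sup z.
Proof.
rewrite -lee_fin fineK// EFinM lee_wpmul2l ?lee_fin ?absz_ge0//.
by apply: ereal_sup_ubound; exists eta.
Qed.

End one_rate.

Variables (alpha : R -> Omega -> int -> R) (alpha' : Omega -> int -> R) (C : R).
Hypotheses (alpha_rates : forall e, 0 <= e -> jump_rates (alpha e))
  (alpha_admissible : forall e, 0 <= e -> admissible (alpha e))
  (alpha_diff1 : forall eta,
     (\esum_(z in [set: int])
        (`|z|%:~R * `|(alpha e eta z - alpha 0 eta z) / e - alpha' eta z|)%:E)%E
       @[e --> 0^'+] --> 0%E)
  (alpha_lip : forall e, 0 <= e ->
     (rates_tnorm1 (fun eta z => alpha e eta z - alpha 0 eta z)%R <=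
      (C * e)%:E)%E).

Definition slope e eta z : R := (alpha e eta z - alpha 0 eta z) / e.

(** The factor [e^-1] makes this majorant suitable for a fixed [e], not for the limit. *)
Definition slope_sup e z : R := e^-1 * (rate_sup (alpha e) z + rate_sup (alpha 0) z).

Lemma slope_sup_dominating e : 0 < e -> dominating (slope_sup e).
Proof.
move=> e0; apply: dominatingZ; first by rewrite invr_ge0 ltW.
have [ae _] := alpha_admissible (ltW e0); have [a0 _] := alpha_admissible (lexx 0).
by apply: dominatingD; exact: rate_sup_dominating.
Qed.

Lemma slope_le_sup e eta z : 0 < e -> absz_ z * `|slope e eta z| <= slope_sup e z.
Proof.
move=> e0; have [ae _] := alpha_admissible (ltW e0).
have [a0 _] := alpha_admissible (lexx 0).
rewrite /slope /slope_sup normrM normfV (gtr0_norm e0) mulrA mulrC.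
rewrite ler_wpM2l ?invr_ge0 ?(ltW e0)//.
apply: (@le_trans _ _ (absz_ z * (`|alpha e eta z| + `|alpha 0 eta z|))).
  by rewrite ler_wpM2l ?absz_ge0// ler_normB.
by rewrite mulrDr lerD//; exact: rate_le_sup.
Qed.

Let slope_gap e e' eta z : R := absz_ z * `|slope e eta z - slope e' eta z|.

Let slope_gap_sup e e' z : R := slope_sup e z + slope_sup e' z.

Let slope_gap_le e e' eta z : 0 < e -> 0 < e' -> slope_gap e e' eta z <= slope_gap_sup e e' z.
Proof.
move=> e0 e'0; rewrite /slope_gap.
apply: (@le_trans _ _ (absz_ z * (`|slope e eta z| + `|slope e' eta z|))).
  by rewrite ler_wpM2l ?absz_ge0// ler_normB.
by rewrite mulrDr lerD// slope_le_sup.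
Qed.

Let slope_gap_ge0 e e' eta z : 0 <= slope_gap e e' eta z.
Proof. by rewrite mulr_ge0 ?absz_ge0. Qed.

Lemma slope_gap_dominating e e' eta : 0 < e -> 0 < e' ->
  dominating (fun z => absz_ z * `|slope e eta z - slope e' eta z|).
Proof.
move=> e0 e'0; apply: (@dominating_le _ (slope_gap_sup e e')).
- by move=> z; exact: slope_gap_ge0.
- by move=> z; exact: slope_gap_le.
- by apply: dominatingD; exact: slope_sup_dominating.
Qed.

(** The Lipschitz weight at site [x] of the whole slope in the l^1 norm weighted by [|z|].
    Exchanging the sums over [x] and [z], the bound by [C * e] on the triple norm becomes a total
    mass of at most [C]. *)
Let weight e x : \bar R := ((e^-1)%:E * \esum_(z in [set: int])
  ((absz_ z)%:E * Defs.delta (fun eta => alpha e eta z - alpha 0 eta z)%R x))%E.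

Let weight_ge0 e x : 0 < e -> (0 <= weight e x)%E.
Proof.
move=> e0; rewrite mule_ge0 ?lee_fin ?invr_ge0 ?(ltW e0)//.
by apply: esum_ge0 => z _; rewrite mule_ge0 ?lee_fin ?absz_ge0 ?delta_ge0.
Qed.

Let weight_sum e : 0 < e -> (\esum_(x in [set: int]) weight e x <= C%:E)%E.
Proof.
move=> e0.
have d0 z x : (0 <= (absz_ z : R)%:E *
    Defs.delta (fun eta => alpha e eta z - alpha 0 eta z)%R x)%E.
  by rewrite mule_ge0 ?lee_fin ?absz_ge0 ?delta_ge0.
rewrite ge0_esumZl; [|by rewrite invr_ge0 ltW|by move=> x; exact: esum_ge0].
rewrite esum_exchange//.
rewrite (_ : esum _ _ = rates_tnorm1 (fun eta z => alpha e eta z - alpha 0 eta z)).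
  by rewrite lee_pdivrMl// -EFinM mulrC; exact: alpha_lip (ltW e0).
apply: eq_esum => z _; rewrite ge0_esumZl ?absz_ge0// => x.
exact: delta_ge0.
Qed.

(** [continuous_lipschitz] for each [z], summed over [z] with the sums exchanged. *)
Let slope_lip e eta xi : 0 < e ->
  (\esum_(z in [set: int]) (absz_ z * `|slope e eta z - slope e xi z|)%:E <=
   \esum_(x in [set: int]) (weight e x * (mdist (eta x) (xi x))%:E))%E.
Proof.
move=> e0; have d0 z x : (0 <= (absz_ z : R)%:E *
    Defs.delta (fun eta => alpha e eta z - alpha 0 eta z)%R x)%E.
  by rewrite mule_ge0 ?lee_fin ?absz_ge0 ?delta_ge0.
have -> : (\esum_(x in [set: int]) (weight e x * (mdist (eta x) (xi x))%:E) =
    (e^-1)%:E * \esum_(z in [set: int]) ((absz_ z)%:E * \esum_(x in [set: int])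
    (Defs.delta (fun eta => alpha e eta z - alpha 0 eta z)%R x * (mdist (eta x) (xi x))%:E)))%E.
  pose t x := mdist (eta x) (xi x).
  pose D z x := Defs.delta (fun eta => alpha e eta z - alpha 0 eta z) x.
  have t0 x : 0 <= t x by exact: mdist_ge0.
  have tD z x : (0 <= (t x)%:E * ((absz_ z)%:E * D z x))%E.
    by apply: mule_ge0; [rewrite lee_fin|exact: d0].
  transitivity ((e^-1)%:E * \esum_(x in [set: int]) \esum_(z in [set: int])
      ((t x)%:E * ((absz_ z)%:E * D z x)))%E.
    rewrite -ge0_esumZl ?invr_ge0 ?(ltW e0)//; last by move=> x; exact: esum_ge0.
    apply: eq_esum => x _; rewrite (ge0_esumZl _ (t0 x) (d0 ^~ x)) /weight -muleA.
    congr (_ * _)%E; exact: muleC.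
  rewrite esum_exchange//; congr (_ * _)%E; apply: eq_esum => z _.
  rewrite -ge0_esumZl ?absz_ge0//; last first.
    by move=> x; apply: mule_ge0; [exact: delta_ge0|rewrite lee_fin mdist_ge0].
  by apply: eq_esum => x _; rewrite muleCA; congr (_ * _)%E; exact: muleC.
rewrite -ge0_esumZl; last 2 first.
- by rewrite invr_ge0 ltW.
- move=> z; apply: mule_ge0; first by rewrite lee_fin absz_ge0.
  apply: esum_ge0 => x _; apply: mule_ge0; first exact: delta_ge0.
  by rewrite lee_fin mdist_ge0.
apply: le_esum => z _.
have cf : continuous (fun eta => alpha e eta z - alpha 0 eta z).
  have [_ ce] := alpha_rates (ltW e0); have [_ c0] := alpha_rates (lexx 0).
  by apply: continuous_sub; [exact: ce|exact: c0].
have := continuous_lipschitz eta xi cf => h.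
have -> : absz_ z * `|slope e eta z - slope e xi z| = e^-1 * (absz_ z *
    `|alpha e eta z - alpha 0 eta z - (alpha e xi z - alpha 0 xi z)|).
  by rewrite /slope -mulrBl normrM normfV (gtr0_norm e0) mulrA mulrC.
rewrite EFinM; apply: lee_wpmul2l; first by rewrite lee_fin invr_ge0 ltW.
by rewrite EFinM; apply: lee_wpmul2l => //; rewrite lee_fin absz_ge0.
Qed.
(** The real functions fed to the gliding hump: their Lipschitz weights are the sums of the weights
    of the two slopes. *)
Let gap e e' eta : R := sumR (slope_gap e e' eta).

Let gap_lip e e' eta xi : 0 < e -> 0 < e' ->
  (`|gap e e' eta - gap e e' xi|%:E <= \esum_(x in [set: int])
     ((weight e x + weight e' x) * (mdist (eta x) (xi x))%:E))%E.
Proof.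
move=> e0 e'0.
pose M z := absz_ z * `|slope e eta z - slope e xi z| +
            absz_ z * `|slope e' eta z - slope e' xi z|.
have part f : 0 < f -> dominating (fun z => absz_ z * `|slope f eta z - slope f xi z|).
  move=> f0; apply: (@dominating_le _ (fun z => slope_sup f z + slope_sup f z)).
  - by move=> z; rewrite mulr_ge0 ?absz_ge0.
  - move=> z; apply: (@le_trans _ _ (absz_ z * (`|slope f eta z| + `|slope f xi z|))).
      by rewrite ler_wpM2l ?absz_ge0// ler_normB.
    by rewrite mulrDr lerD// slope_le_sup.
  - by apply: dominatingD; exact: slope_sup_dominating.
have dM : dominating M by apply: dominatingD; exact: part.
have uM z : `|slope_gap e e' eta z - slope_gap e e' xi z| <= M z.
  rewrite /slope_gap -mulrBr normrM (ger0_norm (absz_ge0 _ _)) /M -mulrDr.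
  rewrite ler_wpM2l ?absz_ge0//; apply: le_trans (ler_dist_dist _ _) _.
  by apply: le_trans _ (ler_normB _ _); rewrite le_eqVlt; apply/orP; left; apply/eqP; congr `|_|; ring.
have id_le f zeta z : dominating f -> `|f z| <= f z by case=> f0 _; rewrite ger0_norm.
rewrite /gap -(sumRB (slope_gap_dominating eta e0 e'0) (slope_gap_dominating xi e0 e'0)); last 2 first.
- by move=> z; rewrite ger0_norm.
- by move=> z; rewrite ger0_norm.
apply: (@le_trans _ _ (\esum_(z in [set: int]) (M z)%:E)%E).
  rewrite -[leRHS]fineK; last exact: dominating_fin.
  by rewrite lee_fin; exact: sumR_bound.
rewrite /M; under eq_esum do rewrite EFinD.
rewrite esumD; last 2 first.
- by move=> z _; rewrite lee_fin mulr_ge0 ?absz_ge0.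
- by move=> z _; rewrite lee_fin mulr_ge0 ?absz_ge0.
apply: le_trans (leeD (slope_lip _ _ e0) (slope_lip _ _ e'0)) _.
rewrite -esumD; last 2 first.
- by move=> x _; rewrite mule_ge0 ?lee_fin ?mdist_ge0// weight_ge0.
- by move=> x _; rewrite mule_ge0 ?lee_fin ?mdist_ge0// weight_ge0.
by apply: le_esum => x _; rewrite ge0_muleDl// weight_ge0.
Qed.

Let alpha_diff1_near eta e : 0 < e -> exists2 d : R, 0 < d & forall f, 0 < f < d ->
  (\esum_(z in [set: int]) (absz_ z * `|slope f eta z - alpha' eta z|)%:E <= e%:E)%E.
Proof.
move=> e0; have /fine_cvgP[+ +] := alpha_diff1 eta.
move=> /near0_rightP[d1 d10 h1] /cvgrPdist_lt/(_ e e0)/near0_rightP[d2 d20 h2].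
exists (Num.min d1 d2); first by rewrite lt_min d10.
move=> f /andP[f0]; rewrite lt_min => /andP[fd1 fd2].
have fin := h1 f; rewrite f0 fd1 in fin; have {}fin := fin isT.
rewrite -[leLHS](fineK fin) lee_fin.
have := h2 f; rewrite f0 fd2 => /(_ isT); rewrite sub0r normrN => /ltW.
exact: le_trans (ler_norm _).
Qed.

Let gap_cvg eta e : 0 < e -> exists2 d : R, 0 < d & forall f f', 0 < f < d -> 0 < f' < d ->
  gap f f' eta <= e.
Proof.
move=> e0; have e20 : 0 < e / 2 by rewrite divr_gt0.
have [d d0 hd] := alpha_diff1_near eta e20; exists d => // f f' fd f'd.
have f0 : 0 < f by case/andP: fd. have f'0 : 0 < f' by case/andP: f'd.
rewrite /gap sumR_ge0E; last exact: slope_gap_dominating.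
rewrite -lee_fin fineK; last by apply: dominating_fin; exact: slope_gap_dominating.
rewrite [e]splitr EFinD; apply: le_trans (leeD (hd f fd) (hd f' f'd)).
rewrite -esumD; last 2 first.
- by move=> z _; rewrite lee_fin mulr_ge0 ?absz_ge0.
- by move=> z _; rewrite lee_fin mulr_ge0 ?absz_ge0.
apply: le_esum => z _; rewrite -EFinD lee_fin -mulrDr ler_wpM2l ?absz_ge0//.
by rewrite [X in _ <= _ + X]distrC; apply: le_trans (ler_normD _ _); rewrite subrKA.
Qed.

(** A failure yields pairs of parameters below [1/(k+1)] whose gaps exceed [e] somewhere. These gaps
    tend to 0 pointwise, so the gliding hump makes one of them small everywhere. *)
Lemma slope_uniform_cauchy e : 0 < e -> exists2 d : R, 0 < d & forall f f', 0 < f < d ->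
  0 < f' < d -> forall eta, sumR (fun z => absz_ z * `|slope f eta z - slope f' eta z|) <= e.
Proof.
move=> e0; apply: contrapT => H.
have /choice[s sP] (k : nat) : exists s : R * R, [/\ 0 < s.1 < k.+1%:R^-1,
    0 < s.2 < k.+1%:R^-1 & exists eta, e < gap s.1 s.2 eta].
  apply: contrapT => Hk; apply: H; exists k.+1%:R^-1; first by rewrite invr_gt0.
  move=> f f' fk f'k eta; rewrite leNgt; apply/negP => h; apply: Hk.
  by exists (f, f'); split => //; exists eta.
have s10 k : 0 < (s k).1 by have [/andP[]] := sP k.
have s20 k : 0 < (s k).2 by have [_ /andP[]] := sP k.
have [||||k hk] := @gliding_hump R E mdist_le1 cE (fun k => gap (s k).1 (s k).2)
  (fun k x => weight (s k).1 x + weight (s k).2 x)%E (C + C) _ _ _ _ e e0.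
- by move=> k x; rewrite adde_ge0 ?weight_ge0.
- move=> k; rewrite esumD; last 2 first.
  + by move=> x _; rewrite weight_ge0.
  + by move=> x _; rewrite weight_ge0.
  by rewrite EFinD leeD// weight_sum.
- by move=> k eta xi; exact: gap_lip.
- move=> eta; apply/cvgrPdist_le => e' e'0.
  have [d d0 hd] := gap_cvg eta e'0.
  have [n _ hn] := near_infty_natSinv_lt (PosNum d0).
  exists n => // k nk; rewrite sub0r normrN ger0_norm; last first.
    rewrite /gap sumR_ge0E; last exact: slope_gap_dominating.
    by rewrite fine_ge0// esum_ge0// => z _; rewrite lee_fin.
  have := hn k nk => /= kd; have [/andP[h1 h2] /andP[h3 h4] _] := sP k.
  by apply: hd; rewrite ?h1 ?h3/=; exact: lt_trans kd.
- by have [_ _ [eta]] := sP k; rewrite ltNge => /negP; apply; apply: le_trans (ler_norm _) (hk eta).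
Qed.

(** The second parameter of the Cauchy estimate may depend on [eta]: it is chosen where its slope is
    already close to [alpha'] at that configuration. *)
Lemma slope_uniform e : 0 < e -> exists2 d : R, 0 < d & forall f, 0 < f < d -> forall eta,
  (\esum_(z in [set: int]) (absz_ z * `|slope f eta z - alpha' eta z|)%:E <= e%:E)%E.
Proof.
move=> e0; have e20 : 0 < e / 2 by rewrite divr_gt0.
have [d d0 hd] := slope_uniform_cauchy e20; exists d => // f fd eta.
have [d' d'0 hd'] := alpha_diff1_near eta e20.
pose f' := Num.min d d' / 2.
have m0 : 0 < Num.min d d' by rewrite lt_min d0.
have f'm : f' < Num.min d d' by rewrite ltr_pdivrMr// ltr_pMr// ltr1n.
have f'0 : 0 < f' by rewrite divr_gt0.
have f'd : 0 < f' < d by rewrite f'0 (lt_le_trans f'm)// ge_min lexx.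
have f'd' : 0 < f' < d' by rewrite f'0 (lt_le_trans f'm)// ge_min lexx orbT.
have f0 : 0 < f by case/andP: fd.
have h1 := hd f f' fd f'd eta.
rewrite sumR_ge0E in h1; last exact: slope_gap_dominating.
rewrite -lee_fin fineK in h1; last by apply: dominating_fin; exact: slope_gap_dominating.
rewrite [e]splitr EFinD; apply: le_trans (leeD h1 (hd' f' f'd')).
rewrite -esumD; last 2 first.
- by move=> z _; rewrite lee_fin mulr_ge0 ?absz_ge0.
- by move=> z _; rewrite lee_fin mulr_ge0 ?absz_ge0.
apply: le_esum => z _; rewrite -EFinD lee_fin -mulrDr ler_wpM2l ?absz_ge0//.
by apply: le_trans (ler_normD _ _); rewrite subrKA.
Qed.

End rates.

(** * Time averages and the speed of the walker *)

Section right_continuous.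
Context (R : realType).

Lemma at_rightP (s : R) (Q : R -> Prop) :
  (\forall t \near s^'+, Q t) <-> exists2 d : R, 0 < d & forall t, s < t < s + d -> Q t.
Proof.
split=> [[d /= d0 h]|[d d0 h]].
  exists d => // t /andP[st td]; apply: h => //=.
  by rewrite distrC gtr0_norm ?subr_gt0// ltrBlDl.
exists d => //= t; rewrite /ball_/= distrC => td st; apply: h.
by rewrite st -ltrBlDl -[_ - _]gtr0_norm// subr_gt0.
Qed.

(** [u n s] is the next grid point strictly to the right of [s], so [k] is the pointwise limit of
    functions that are constant on the cells of the grid. *)
Lemma right_continuous_measurable (k : R -> R) :
  (forall s, 0 <= s -> k t @[t --> s^'+] --> k s) ->
  measurable_fun (`[0, +oo[%classic : set R) k.
Proof.
move=> rk; pose u (n : nat) (s : R) : R := (Num.truncn (n.+1%:R * s)).+1%:R / n.+1%:R.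
have mu_ n : measurable_fun (`[0, +oo[%classic : set R) (fun s => k (u n s)).
  move=> _ B mB.
  have -> : `[0, +oo[%classic `&` (fun s => k (u n s)) @^-1` B =
     \bigcup_(j in [set j : nat | B (k (j.+1%:R / n.+1%:R))])
       `[j%:R / n.+1%:R : R, j.+1%:R / n.+1%:R[%classic.
    apply/seteqP; split=> s /=.
      rewrite in_itv/= andbT => -[s0 Bs]; exists (Num.truncn (n.+1%:R * s)) => //=.
      rewrite in_itv/= ler_pdivrMr// ltr_pdivlMr// mulrC.
      by apply: truncn_itv; rewrite mulr_ge0.
    move=> [j /= Bj]; rewrite !in_itv/= ler_pdivrMr// ltr_pdivlMr// => /andP[js sj].
    have s0 : 0 <= s by rewrite -(@pmulr_lge0 _ n.+1%:R)//; exact: le_trans js.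
    rewrite andbT; split => //; rewrite /u (_ : Num.truncn _ = j)//.
    by apply/eqP; rewrite truncn_eq ?mulr_ge0// mulrC js.
  by apply: bigcup_measurable => j _; exact: measurable_itv.
suff lim s : (`[0, +oo[%classic : set R) s -> k (u n s) @[n --> \oo] --> k s.
  exact: measurable_fun_cvg mu_ lim.
rewrite /= in_itv/= andbT => s0; apply/cvgrPdist_lt => e e0.
have /cvgrPdist_lt/(_ e e0)/at_rightP[d d0 hd] := rk s s0.
have [N _ hN] := near_infty_natSinv_lt (PosNum d0).
exists N => // n Nn; apply: hd.
have /andP[t1 t2] : (Num.truncn (n.+1%:R * s))%:R <= n.+1%:R * s < (Num.truncn (n.+1%:R * s)).+1%:R.
  by apply: truncn_itv; rewrite mulr_ge0.
rewrite /u ltr_pdivlMr// mulrC t2/= ltr_pdivrMr//.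
have -> : (Num.truncn (n.+1%:R * s)).+1%:R = (Num.truncn (n.+1%:R * s))%:R + 1 :> R by rewrite natr1.
have /= := hN n Nn; rewrite -[X in X < _]mul1r ltr_pdivrMr// mulrC => nd.
by move: t1 nd; lra.
Qed.

End right_continuous.

Section time_average.
Context (R : realType) (S : ptopologicalType) (W : process R S) (p : S).
Implicit Types (f g : S -> R) (t s : R).

(** Paths are right-continuous, so dominated convergence applies under the path measure. *)
Lemma semigroup_right_continuous f (M : R) s : continuous f -> (forall x, `|f x| <= M) ->
  0 <= s -> semigroup W t f p @[t --> s^'+] --> semigroup W s f p.
Proof.
move=> cf fM s0; apply/cvg_at_rightP => u [us uS].
have u0 n : 0 <= u n by rewrite ltW// (le_lt_trans s0).
have [] // := @dominated_convergence _ (pathM R S) R (W p) setT measurableT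
  (fun n w => (f (w (u n)))%:E) (fun w => (f (w s))%:E) (fun=> M%:E).
- by move=> n; apply/measurable_EFinP; exact: measurable_path_eval.
- by apply/measurable_EFinP; exact: measurable_path_eval.
- apply: aeW => w _; apply: cvg_EFin; first by apply: nearW.
  have [wr _] := path_cadlag w s0.
  have fw : f (w t) @[t --> s^'+] --> f (w s) by exact: (cvg_comp _ _ wr (cf _)).
  by move/cvg_at_rightP : fw; apply.
- apply: (bounded_integrable (process_total W p) (M := `|M|)) => // w.
- by apply: aeW => w n _; rewrite lee_fin.
move=> _ _ lim; apply: fine_cvg; rewrite fineK//.
have := bounded_integrable (process_total W p) (measurable_path_eval cf s0) (fun w => fM (w s)).
exact: integrable_fin_num.
Qed.

Definition time_mean f t : R :=
  t^-1 * \int[@lebesgue_measure R]_(s in `[0%R, t]) semigroup W s f p.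

Let itv_fin t : 0 <= t -> (@lebesgue_measure R `[0%R, t] < +oo)%E.
Proof. by move=> t0; rewrite lebesgue_measure_itv/=; case: ifP => _; rewrite ltry. Qed.

Let measurable_semigroup f (M : R) t : continuous f -> (forall x, `|f x| <= M) ->
  measurable_fun (`[0, t]%classic : set R) (fun s => semigroup W s f p).
Proof.
move=> cf fM.
have h : measurable_fun (`[0, +oo[%classic : set R) (fun s => semigroup W s f p).
  by apply: right_continuous_measurable => s s0; exact: semigroup_right_continuous fM s0.
apply: measurable_funS h => //.
by move=> s /=; rewrite !in_itv/= => /andP[->].
Qed.

Let semigroup_le f (M : R) s : (forall x, `|f x| <= M) -> `|semigroup W s f p| <= M.
Proof. by move=> fM; apply: (expectation_bound (process_total W p)) => w; exact: fM. Qed.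

Let integrable_semigroup f (M : R) t : 0 <= t -> continuous f -> (forall x, `|f x| <= M) ->
  (@lebesgue_measure R).-integrable `[0, t] (EFin \o (fun s => semigroup W s f p)).
Proof.
move=> t0 cf fM; apply: measurable_bounded_integrable => //.
- exact: itv_fin.
- exact: measurable_semigroup.
exists M; split; first exact: num_real.
by move=> N MN s _ /=; rewrite (le_trans (semigroup_le _ fM))// ltW.
Qed.

Lemma time_meanD f g (M N : R) t : 0 <= t -> continuous f -> continuous g ->
  (forall x, `|f x| <= M) -> (forall x, `|g x| <= N) ->
  time_mean (fun x => f x + g x) t = time_mean f t + time_mean g t.
Proof.
move=> t0 cf cg fM gN; rewrite /time_mean -mulrDr; congr (_ * _).
rewrite -RintegralD//; [|exact: integrable_semigroup fM|exact: integrable_semigroup gN].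
apply: eq_Rintegral => s; rewrite inE/= in_itv/= => /andP[s0 _].
by apply: (@expectationD _ _ _ _ (process_total W p) _ _ M N) => //;
  exact: measurable_path_eval.
Qed.

Lemma time_meanZ f (M c : R) t : 0 <= t -> continuous f -> (forall x, `|f x| <= M) ->
  time_mean (fun x => c * f x) t = c * time_mean f t.
Proof.
move=> t0 cf fM; rewrite /time_mean mulrCA; congr (_ * _).
rewrite -RintegralZl//; last exact: integrable_semigroup fM.
apply: eq_Rintegral => s; rewrite inE/= in_itv/= => /andP[s0 _].
by apply: (@expectationZ _ _ _ _ (process_total W p) _ M) => //;
  exact: measurable_path_eval.
Qed.

Lemma time_mean_ge0 f t : 0 <= t -> (forall x, 0 <= f x) -> 0 <= time_mean f t.
Proof.
move=> t0 f0; rewrite mulr_ge0 ?invr_ge0//; apply: Rintegral_ge0 => s _.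
exact: Rintegral_ge0.
Qed.

(** The crude error [D] is allowed only during the initial time [r], and dividing by [t] makes its
    contribution negligible. [k] need not be measurable. *)
Lemma time_mean_near (k : R -> R) f (M N D e r : R) t : 0 < t -> continuous f ->
  (forall x, `|f x| <= M) -> (forall s, 0 <= s <= t -> `|k s| <= N) ->
  0 <= D -> 0 <= e -> 0 <= r <= t ->
  (forall s, 0 <= s <= t -> `|k s - semigroup W s f p| <= D * \1_(`[0, r[%classic : set R) s + e) ->
  `|t^-1 * \int[@lebesgue_measure R]_(s in `[0%R, t]) k s - time_mean f t| <= D * r / t + e.
Proof.
move=> t0 cf fM kN D0 e0 /andP[r0 rt] kf.
have t0' := ltW t0.
have M0 : 0 <= M by exact: le_trans (normr_ge0 _) (fM point).
pose A := (`[0, r[%classic : set R).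
pose h (s : R) : R := D * \1_A s + e.
have mI : measurable (`[0%R, t]%classic : set R) by exact: measurable_itv.
have mA : measurable A by exact: measurable_itv.
have ind1 s : 0 <= (\1_A s : R) <= 1 by rewrite indicE; case: (_ \in _); rewrite ?lexx ler01.
have h0 s : 0 <= h s by rewrite addr_ge0// mulr_ge0//; case/andP: (ind1 s).
have hDe s : h s <= D + e by rewrite lerD2r ler_piMr//; case/andP: (ind1 s).
have hnorm s : `|h s| <= D + e by rewrite ger0_norm.
have iA : (@lebesgue_measure R).-integrable `[0%R, t] (EFin \o (\1_A : R -> R)).
  apply: measurable_bounded_integrable => //; first exact: itv_fin.
  exists 1; split; first exact: num_real.
  move=> x x1 s _ /=; rewrite ger0_norm; last by case/andP: (ind1 s).
  by apply: le_trans (ltW x1); case/andP: (ind1 s).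
have icst (c : R) : (@lebesgue_measure R).-integrable `[0%R, t] (EFin \o (fun=> c)).
  apply: measurable_bounded_integrable => //; first exact: itv_fin.
  exists `|c|; split; first exact: num_real.
  by move=> x x1 s _ /=; exact: ltW.
have iDA : (@lebesgue_measure R).-integrable `[0%R, t] (EFin \o (fun s => D * \1_A s)).
  exact: (integrableZl _ _ iA).
have ih : (@lebesgue_measure R).-integrable `[0%R, t] (EFin \o h).
  exact: (integrableD _ iDA (icst e)).
have inth : \int[@lebesgue_measure R]_(s in `[0%R, t]) h s = D * r + e * t.
  rewrite RintegralD// RintegralZl// Rintegral_cst//.
  have Lt : @lebesgue_measure R `[0%R, t] = t%:E.
    by rewrite lebesgue_measure_itv/= lte_fin t0 -EFinB subr0.
  have Lr : @lebesgue_measure R A = r%:E.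
    rewrite /A lebesgue_measure_itv/= lte_fin.
    case: ltP => [_|r0']; first by rewrite -EFinB subr0.
    by congr EFin; apply/esym/eqP; rewrite eq_le r0'.
  congr (D * _ + e * _); last exact: (congr1 fine Lt).
  rewrite /Rintegral integral_indic//.
  rewrite (_ : A `&` _ = A); first exact: (congr1 fine Lr).
  apply/seteqP; split => [s []//|s]; rewrite /A /= !in_itv/= => /andP[s0 sr].
  by split; rewrite ?s0//= ltW// (lt_le_trans sr).
have iS := integrable_semigroup t0' cf fM.
have bS s : `|semigroup W s f p| <= M + N + D + e.
  apply: le_trans (semigroup_le s fM) _; rewrite -!addrA lerDl.
  have := kN 0; rewrite lexx => /(_ t0') /(le_trans (normr_ge0 _)); lra.
have N0 : 0 <= N by have := kN 0; rewrite lexx => /(_ t0') /(le_trans (normr_ge0 _)).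
have up : \int[@lebesgue_measure R]_(s in `[0%R, t]) k s <=
    \int[@lebesgue_measure R]_(s in `[0%R, t]) (semigroup W s f p + h s).
  apply: (@le_Rintegral_nm _ _ _ _ _ _ _ (M + N + D + e)) => //; first exact: itv_fin.
  - move=> s /=; rewrite in_itv/= => /kN ks; apply: (le_trans ks); lra.
  - move=> s _; rewrite (le_trans (ler_normD _ _))//.
    have := semigroup_le s fM; have := hnorm s; lra.
  - move=> s /=; rewrite in_itv/= => /kf; rewrite ler_norml => /andP[_].
    by rewrite lerBlDl.
have down : \int[@lebesgue_measure R]_(s in `[0%R, t]) (semigroup W s f p - h s) <=
    \int[@lebesgue_measure R]_(s in `[0%R, t]) k s.
  apply: (@le_Rintegral_nm _ _ _ _ _ _ _ (M + N + D + e)) => //; first exact: itv_fin.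
  - move=> s _; rewrite (le_trans (ler_normB _ _))//.
    have := semigroup_le s fM; have := hnorm s; lra.
  - move=> s /=; rewrite in_itv/= => /kN ks; apply: (le_trans ks); lra.
  - move=> s /=; rewrite in_itv/= => /kf; rewrite ler_norml => /andP[+ _].
    by rewrite lerBrDl.
rewrite RintegralD// inth in up; rewrite RintegralB// inth in down.
rewrite /time_mean -mulrBr normrM gtr0_norm ?invr_gt0//.
rewrite mulrC ler_pdivrMr// mulrDl -[D * r / t * t]mulrA mulVf ?gt_eqF// mulr1.
by rewrite ler_norml; apply/andP; split; [rewrite lerBrDl|rewrite lerBlDl].
Qed.

End time_average.

Lemma expectation_dist d (T : measurableType d) (R : realType)
    (mu : {measure set T -> \bar R}) (f g h : T -> R) (M N D : R) :
  mu setT = 1%E -> (forall x, `|f x| <= M) ->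
  measurable_fun setT g -> (forall x, `|g x| <= N) ->
  measurable_fun setT h -> (forall x, `|h x| <= D) ->
  (forall x, `|f x - g x| <= h x) ->
  `|\int[mu]_x f x - \int[mu]_x g x| <= \int[mu]_x h x.
Proof.
move=> mu1 fM mg gN mh hD fg.
have x0 := [the T of point].
have M0 : 0 <= M by exact: le_trans (normr_ge0 _) (fM x0).
have N0 : 0 <= N by exact: le_trans (normr_ge0 _) (gN x0).
have D0 : 0 <= D by exact: le_trans (normr_ge0 _) (hD x0).
have ig := bounded_integrable mu1 mg gN; have ih := bounded_integrable mu1 mh hD.
have fB x : `|f x| <= M + N + D by apply: le_trans (fM x) _; lra.
have up : \int[mu]_x f x <= \int[mu]_x (g x + h x).
  apply: (expectation_le mu1 fB) => x.
    by rewrite (le_trans (ler_normD _ _))//; have := gN x; have := hD x; lra.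
  by have := fg x; rewrite ler_norml => /andP[_]; rewrite lerBlDl.
have down : \int[mu]_x (g x - h x) <= \int[mu]_x f x.
  apply: (expectation_le mu1 (M := M + N + D)) => // x.
    by rewrite (le_trans (ler_normB _ _))//; have := gN x; have := hD x; lra.
  by have := fg x; rewrite ler_norml => /andP[+ _]; rewrite lerBrDl.
rewrite RintegralD// in up; rewrite RintegralB// in down.
by rewrite ler_norml lerBrDl down lerBlDl.
Qed.

(** * The forward equation for functions seen from the walker *)

Section walker.
Context (R : realType) (E : pmetricType R) (P : process R (config E)).
Local Notation Omega := (config E).
Hypotheses (cE : compact [set: E]) (TP : translation_invariant P).
Variables (a : Omega -> int -> R) (W : process R (Omega * site)%type).
Hypotheses (a_rates : jump_rates a) (a_adm : (rates_norm1 a < +oo)%E)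
  (W_walker : walker P a W).
Implicit Types (f : Omega -> R) (eta : Omega) (q : Omega * site).

Let cO := config_compact cE.

(** The sites are discrete, so a neighbourhood of a point may be taken inside one fibre. *)
Lemma site_continuous (F : Omega * site -> R) :
  (forall x : site, continuous (fun eta => F (eta, x))) -> continuous F.
Proof.
move=> cF [eta x] A FA.
have FA' : nbhs eta [set xi | A (F (xi, x))] := cF x eta A FA.
have Bx : nbhs (x : site) [set x].
  by rewrite nbhs_principalE.
exists ([set xi | A (F (xi, x))], [set x]).
  by split.
by case=> xi y [/= h yx]; rewrite /= yx.
Qed.

Definition seen f : Omega * site -> R := fun q => f (Defs.shift (- (q.2 : int)) q.1).

Lemma seen_continuous f : continuous f -> continuous (seen f).
Proof. by move=> cf; apply: site_continuous => x; exact: (@continuous_shift R E f (- (x : int)) cf). Qed.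

Lemma position_continuous (F : int -> R) : continuous (fun q : Omega * site => F q.2).
Proof.
apply: site_continuous => x; change (continuous (cst (F x) : Omega -> R)).
exact: cst_continuous.
Qed.

Definition drift eta : R := sumR (fun z => z%:~R * a eta z).

Lemma drift_term eta z : `|z%:~R * a eta z| <= rate_sup a z.
Proof.
rewrite normrM; apply: le_trans (rate_le_sup a_adm eta z).
by rewrite /absz_ -intr_norm.
Qed.

Let dM := rate_sup_dominating a_adm.

Lemma drift_continuous : continuous drift.
Proof.
apply: (sumR_continuous dM drift_term) => z; apply: continuous_scale.
by case: a_rates => _; exact.
Qed.

Definition walk_jumps f eta : R :=
  sumR (fun z => a eta z * (f (Defs.shift (- z) eta) - f eta)).

(** By the forward equation the time integral of [G] plus the jump term is the increment of the
    expectation of [F], at most [2 * M], and the average vanishes as t grows. The continuous [H]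
    leaves room for replacing the rates by nearby ones at the price [kappa]. *)
Lemma time_mean_generator F G H (M kappa t : R) p : generator P F G -> 0 < t ->
  (forall eta, `|F eta| <= M) -> continuous H ->
  (forall eta, `|G eta + walk_jumps F eta - H eta| <= kappa) ->
  `|time_mean W p (seen H) t| <= 2 * M / t + kappa.
Proof.
move=> FG t0 FM cH GH; have t0' := ltW t0.
have [cF cG _] := FG.
have [N HN] := compact_bounded_fun cO cH; have [N' GN'] := compact_bounded_fun cO cG.
have M0 : 0 <= M by exact: le_trans (normr_ge0 _) (FM point).
have k0 : 0 <= kappa by exact: le_trans (normr_ge0 _) (GH point).
have [_ _ fwd] := W_walker.
have bnd : exists M0 : R, forall q, `|seen F q| <= M0 /\ `|seen G q| <= M0.
  exists (Num.max M N') => q; rewrite /seen; split.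
    by rewrite (le_trans (FM _))// le_max lexx.
  by rewrite (le_trans (GN' _))// le_max lexx orbT.
have gen (x : site) : generator P (fun eta => seen F (eta, x)) (fun eta => seen G (eta, x)).
  exact: (generator_shift cE TP (- (x : int)) FG).
have eqF := fwd (seen F) (seen G) bnd gen p t t0'.
pose k s := semigroup W s (seen G \+ jump_part a (seen F)) p.
(* A jump of the walker by [z] shifts the environment that it sees by [- z]. *)
have jE q : (seen G \+ jump_part a (seen F)) q = seen (fun eta => G eta + walk_jumps F eta) q.
  rewrite /= /seen; congr (_ + _); rewrite /jump_part /walk_jumps; congr (fine (sumZ _)).
  apply/funext => z; have -> : Defs.shift (- z) (Defs.shift (- (q.2 : int)) q.1) =
      Defs.shift (- ((q.2 : int) + z)) q.1 by rewrite shiftD opprD addrC.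
  by [].
have kb eta : `|G eta + walk_jumps F eta| <= N + kappa.
  rewrite -[X in `|X|](subrK (H eta)) (le_trans (ler_normD _ _))// addrC lerD//.
have kN s : 0 <= s <= t -> `|k s| <= N + kappa.
  move=> _; apply: (expectation_bound (process_total W p)) => w; rewrite jE; exact: kb.
have near := @time_mean_near R _ W p k (seen H) N (N + kappa) 0 kappa 0 t t0
  (seen_continuous cH) (fun q => HN _) kN (lexx _) k0.
have {}near : `|t^-1 * \int[@lebesgue_measure R]_(s in `[0%R, t]) k s - time_mean W p (seen H) t| <= kappa.
  have := near; rewrite lexx t0' mul0r mul0r add0r; apply => // s /andP[s0 _].
  rewrite mul0r add0r; apply: (@expectation_near _ _ _ _ (process_total W p) _ _ (N + kappa)).
  - by move=> w; rewrite jE; exact: kb.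
  - by apply: measurable_path_eval => //; exact: seen_continuous.
  - by move=> w; rewrite jE; exact: GH.
have SF : `|semigroup W t (seen F) p| <= M.
  by apply: (expectation_bound (process_total W p)) => w; exact: FM.
have Fp : `|seen F p| <= M by exact: FM.
have int_le : `|t^-1 * \int[@lebesgue_measure R]_(s in `[0%R, t]) k s| <= 2 * M / t.
  rewrite normrM gtr0_norm ?invr_gt0// mulrC ler_pM2r ?invr_gt0//.
  have -> : \int[@lebesgue_measure R]_(s in `[0%R, t]) k s = semigroup W t (seen F) p - seen F p.
    by rewrite eqF addrC addKr.
  by rewrite (le_trans (ler_normB _ _))// mulrDl mul1r lerD.
move: near int_le; set I := t^-1 * _; set J := time_mean _ _ _ _ => h1 h2.
rewrite -[J](subKr I) (le_trans (ler_normB _ _))// lerD//.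
Qed.

End walker.

(** * Truncated position and speed *)

Section clip.
Context (R : realType).
Implicit Types K x y : R.

(** It replaces the position, which is unbounded, in the forward equation. Being 1-Lipschitz, it
    keeps the jump terms below [|z|] times the rates. *)
Definition clip K x : R := Num.max (- K) (Num.min K x).

Lemma clip_bound K x : 0 <= K -> `|clip K x| <= K.
Proof.
move=> K0; rewrite ler_norml /clip le_max lexx/= ge_max ge_min lexx andbT.
by rewrite ge0_cp.
Qed.

Lemma clip_id K x : `|x| <= K -> clip K x = x.
Proof.
by rewrite ler_norml => /andP[Kx xK]; rewrite /clip (min_idPr xK); apply/max_idPr.
Qed.

Lemma clip_dist K x y : `|clip K x - clip K y| <= `|x - y|.
Proof.
wlog yx : x y / y <= x.
  move=> H; have [yx|/ltW xy] := leP y x; first exact: H.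
  by rewrite distrC [leRHS]distrC; exact: H.
have min_le : Num.min K x <= Num.min K y + (x - y).
  rewrite addr_minl le_min !ge_min lerDl subr_ge0 yx.
  by rewrite [y + _]addrC subrK lexx orbT.
rewrite [leRHS]ger0_norm ?subr_ge0// ger0_norm ?subr_ge0.
  rewrite lerBlDl /clip ge_max; apply/andP; split.
    by rewrite ler_wpDr ?subr_ge0// le_max lexx.
  by apply: le_trans min_le _; rewrite lerD2r le_max lexx orbT.
by rewrite /clip le_max2// le_min2.
Qed.

End clip.

Section speed.
Context (R : realType) (E : pmetricType R) (P : process R (config E)).
Local Notation Omega := (config E).
Variables (a : Omega -> int -> R) (W : process R (Omega * site)%type) (v : R).
Hypotheses (a_rates : jump_rates a) (a_adm : (rates_norm1 a < +oo)%E)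
  (W_walker : walker P a W) (W_speed : asymptotic_speed W v).
Implicit Types (q : Omega * site).

Let p0 : Omega * site := (point, 0 : site).
Let pos q : R := (q.2 : int)%:~R.

Let far (e s : R) q : R := (e < `|pos q / s - v|)%R%:R.

Let far_continuous e s : continuous (far e s).
Proof. exact: (@position_continuous R E (fun x => (e < `|x%:~R / s - v|)%R%:R)). Qed.

Let far01 e s q : 0 <= far e s q <= 1.
Proof. by rewrite /far; case: (_ < _); rewrite ?lexx ?ler01. Qed.

Let far_norm e s q : `|far e s q| <= 1.
Proof. by rewrite ger0_norm; case/andP: (far01 e s q). Qed.

(** Almost sure convergence implies convergence in probability: bad times tending to infinity would
    contradict dominated convergence. *)
Let far_rare e d : 0 < e -> 0 < d -> exists2 s0 : R, 0 < s0 &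
  forall s, s0 <= s -> semigroup W s (far e s) p0 <= d.
Proof.
move=> e0 d0; apply: contrapT => H.
have /choice[u uP] (n : nat) : exists s : R, n.+1%:R <= s /\ d < semigroup W s (far e s) p0.
  apply: contrapT => Hn; apply: H; exists n.+1%:R => // s ns.
  by rewrite leNgt; apply/negP => h; apply: Hn; exists s.
have u0 n : 0 <= u n by have [h _] := uP n; apply: le_trans h.
have [] // := @dominated_convergence _ (pathM R (Omega * site)%type) R (W p0) setT measurableT
  (fun n w => (far e (u n) (w (u n)))%:E) (fun=> 0%E) (fun=> 1%:E).
- by move=> n; apply/measurable_EFinP; apply: measurable_path_eval; [exact: far_continuous|].
- have [N [mN N0 sub]] := W_speed point; exists N; split => //.
  move=> w /= hw; apply: sub => wv; apply: hw => _.
  have unoo : u n @[n --> \oo] --> +oo.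
    apply: (@ger_cvgy _ _ _ _ (fun n => n%:R)); last exact: cvgr_idn.
    by apply: nearW => n; have [h _] := uP n; apply: le_trans h; rewrite ler_nat.
  move/cvg_pinftyP : wv => /(_ u unoo) /cvgrPdist_le/(_ e e0) near_v.
  apply: cvg_near_cst; apply: filterS near_v => n h.
  by rewrite /far ltNge distrC h.
- by apply: (bounded_integrable (process_total W p0) (M := 1)) => // w; rewrite normr1.
- by apply: aeW => w n _; rewrite lee_fin far_norm.
move=> _ _; rewrite integral0 => /fine_cvg/= /cvgrPdist_lt/(_ d d0)[n _ /(_ n (leqnn n))].
rewrite /= sub0r normrN => h; have [_] := uP n; rewrite ltNge => /negP; apply.
exact: le_trans (ler_norm _) (ltW h).
Qed.

Let Bd : R := fine (\esum_(z in [set: int]) (rate_sup a z)%:E)%E.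
(** Up to time [T] the walker mostly stays within [(|v| + 1) * T]; the further [T] is a margin in
    which no jump of size at most [T] is truncated. *)
Let M : R := `|v| + 2.

Let f T q : R := clip (M * T) (pos q).

Let term_bound K eta x z : `|a eta z * (clip K (x + z%:~R) - clip K x)| <= rate_sup a z.
Proof.
rewrite normrM mulrC; apply: le_trans (rate_le_sup a_adm eta z).
rewrite ler_wpM2r//; apply: le_trans (clip_dist _ _ _) _.
by rewrite addrC addKr /absz_ -intr_norm.
Qed.

Let dM := rate_sup_dominating a_adm.

Let Bd_ge0 : 0 <= Bd.
Proof.
by case: dM => r0 _; rewrite fine_ge0// esum_ge0// => z _; rewrite lee_fin.
Qed.

Let jumpE T q : jump_part a (f T) q = sumR (fun z =>
  a (Defs.shift (- (q.2 : int)) q.1) z * (clip (M * T) (pos q + z%:~R) - clip (M * T) (pos q))).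
Proof.
rewrite /jump_part /sumR; congr (fine (sumZ _)); apply/funext => z.
by rewrite /f /pos /= intrD.
Qed.

Let jump_bound T q : `|jump_part a (f T) q| <= Bd.
Proof. by rewrite jumpE; apply: sumR_bound => // z; exact: term_bound. Qed.

Let drift_bound q : `|seen (drift a) q| <= Bd.
Proof. by apply: sumR_bound => // z; exact: (drift_term a_adm). Qed.

Let outer T q : R := ((`|v| + 1) * T < `|pos q|)%R%:R.

Let outer_continuous T : continuous (outer T).
Proof. exact: (@position_continuous R E (fun x => ((`|v| + 1) * T < `|x%:~R|)%R%:R)). Qed.

Let outer01 T q : 0 <= outer T q <= 1.
Proof. by rewrite /outer; case: (_ < _); rewrite ?lexx ?ler01. Qed.

Let outer_far T s q : 0 < s <= T -> outer T q <= far 1 s q.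
Proof.
move=> /andP[s0 sT]; rewrite /outer /far ler_nat; case: ltP => //= h.
case: ltP => //; rewrite leNgt => /negP[].
have : (`|v| + 1) * s < `|pos q| by apply: le_lt_trans h; rewrite ler_wpM2l// addr_ge0.
move=> {}h; have hs : `|v| + 1 < `|pos q / s|.
  by rewrite normrM normfV (gtr0_norm s0) ltr_pdivlMr.
by move: (ler_dist_dist (pos q / s) v); have := ler_norm (`|pos q / s| - `|v|); lra.
Qed.

(** Up to [e / 2] on either side only the finitely many jumps in [s] matter, and inside the margin
    these are not truncated. Where the position is too large, both terms are bounded by [Bd]. *)
Let jump_near e : 0 < e -> exists2 T0 : R, 0 < T0 & forall T q, T0 <= T ->
  `|jump_part a (f T) q - seen (drift a) q| <= e + 2 * Bd * outer T q.
Proof.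
move=> e0; have e20 : 0 < e / 2 by rewrite divr_gt0.
have [s hs] := sumR_approx dM e20.
(* At least the size of every jump in [s]. *)
pose T0 : R := 1 + \sum_(z <- s) `|z|%:~R.
have T00 : 0 < T0 by rewrite ltr_wpDr ?ltr01// sumr_ge0// => z _; rewrite ler0z.
exists T0 => // T q T0T; have T0' := lt_le_trans T00 T0T.
rewrite /outer; case: ltP => /= [_|small].
  rewrite mulr1; apply: le_trans (ler_normB _ _) _.
  by have := jump_bound T q; have := drift_bound q; lra.
rewrite mulr0 addr0 jumpE; set u := (X in sumR X).
have h1 := hs u (term_bound _ _ _).
have h2 := hs _ (drift_term a_adm (Defs.shift (- (q.2 : int)) q.1)).
have us : \sum_(z <- s) u z = \sum_(z <- s) (z%:~R * a (Defs.shift (- (q.2 : int)) q.1) z).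
  apply: eq_big_seq => z zs; rewrite /u.
  have zT : `|z%:~R| <= T :> R.
    apply: le_trans T0T; rewrite -intr_norm /T0.
    rewrite (big_rem z zs)/= addrCA lerDl addr_ge0// sumr_ge0// => y _; by rewrite ler0z.
  have xT : `|pos q| <= M * T by apply: le_trans small _; rewrite ler_pM2r// /M; lra.
  have yT : `|pos q + z%:~R| <= M * T.
    by apply: le_trans (ler_normD _ _) _; rewrite /M; move: small zT; lra.
  by rewrite !clip_id// addrC addKr mulrC.
rewrite us in h1; move: h1 h2; rewrite /seen/drift.
set A := sumR u; set B := sumR _; set D := \sum_(_ <- _) _ => h1 h2.
by rewrite (_ : A - B = (A - D) - (B - D)); [apply: le_trans (ler_normB _ _) _; lra|ring].
Qed.

Let generator_cst (c : R) : generator P (fun=> c) (fun=> 0).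
Proof.
split; [exact: cst_continuous|exact: cst_continuous|].
move=> e e0; apply: nearW => t x.
by rewrite (semigroup_cst P) subrr mul0r subr0 normr0.
Qed.

Let f_bound T q : 0 <= T -> `|f T q| <= M * T.
Proof. by move=> T0; apply: clip_bound; rewrite mulr_ge0// /M addr_ge0. Qed.

Let f_continuous T : continuous (f T).
Proof. exact: (@position_continuous R E (fun x => clip (M * T) x%:~R)). Qed.

Let M_ge0 : 0 <= M.
Proof. by rewrite /M addr_ge0. Qed.

(** The truncated position does not depend on the environment, so its environment generator is 0; it
    starts from 0. *)
Let forward T : 0 < T ->
  T^-1 * \int[@lebesgue_measure R]_(s in `[0%R, T]) semigroup W s (jump_part a (f T)) p0 =
  T^-1 * semigroup W T (f T) p0.
Proof.
move=> T0; have [_ _ fwd] := W_walker.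
have -> : \int[@lebesgue_measure R]_(s in `[0%R, T]) semigroup W s (jump_part a (f T)) p0 =
    \int[@lebesgue_measure R]_(s in `[0%R, T]) semigroup W s (cst 0 \+ jump_part a (f T)) p0.
  apply: eq_Rintegral => s _; congr semigroup; apply/funext => q /=.
  by rewrite add0r.
rewrite (fwd (f T) (cst 0)) ?(ltW T0)//.
- by rewrite {2}/f /pos /p0 /= clip_id ?normr0 ?mulr_ge0 ?(ltW T0)// add0r.
- exists (M * T) => q; rewrite f_bound ?(ltW T0)// normr0; split => //.
  by rewrite mulr_ge0// ltW.
- by move=> x; exact: (generator_cst (clip (M * T) (x : int)%:~R)).
Qed.

(** Unless the walker is far from [v * T], the truncation is inactive and the error is at most [e];
    otherwise it is at most [2 * M], with probability at most [d]. *)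
Let displacement e d T : 0 < e <= 1 -> 0 < T -> semigroup W T (far e T) p0 <= d ->
  `|T^-1 * semigroup W T (f T) p0 - v| <= e + 2 * M * d.
Proof.
move=> /andP[e0 e1] T0 hd; have mass := process_total W p0.
have mf : measurable_fun [set: pathM R (Omega * site)%type]
    (fun w : Defs.path R (Omega * site)%type => f T (w T)).
  by apply: measurable_path_eval; [exact: f_continuous|exact: ltW].
have mfar : measurable_fun [set: pathM R (Omega * site)%type]
    (fun w : Defs.path R (Omega * site)%type => far e T (w T)).
  by apply: measurable_path_eval; [exact: far_continuous|exact: ltW].
have b w : `|T^-1 * f T w| <= M.
  rewrite normrM gtr0_norm ?invr_gt0// mulrC ler_pdivrMr//.
  by apply: f_bound; exact: ltW.
have vM : `|v| <= M by rewrite /M lerDl.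
have M20 : 0 <= 2 * M by rewrite mulr_ge0.
have -> : T^-1 * semigroup W T (f T) p0 =
    \int[W p0]_(w in [set: pathM R (Omega * site)%type]) (T^-1 * f T (w T)).
  rewrite (@expectationZ _ _ _ _ mass _ (M * T))// => w.
  by apply: f_bound; exact: ltW.
rewrite -[X in _ - X](expectation_cst mass v).
have mh : measurable_fun [set: pathM R (Omega * site)%type]
    (fun w : Defs.path R (Omega * site)%type => 2 * M * far e T (w T)).
  exact: measurable_funM.
apply: (@le_trans _ _ (\int[W p0]_(w in [set: pathM R (Omega * site)%type])
    (e + 2 * M * far e T (w T)))).
  apply: (@expectation_dist _ _ _ (W p0) _ _ _ M `|v| (e + 2 * M)) => //.
  - exact: measurable_funD.
  - move=> w; apply: le_trans (ler_normD _ _) _; rewrite (gtr0_norm e0) lerD2l.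
    by rewrite normrM ger0_norm// ler_piMr.
  move=> w; rewrite /far; case: ltP => /= h.
    rewrite mulr1; apply: le_trans (ler_normB _ _) _.
    by rewrite -[leLHS]add0r lerD ?(ltW e0)// mulr_natl mulr2n lerD// b.
  rewrite mulr0 addr0 /f clip_id 1?mulrC//.
  have : `|pos (w T) / T| <= e + `|v|.
    by rewrite -[X in `|X|](subrK v); apply: le_trans (ler_normD _ _) _; rewrite lerD2r.
  rewrite normrM normfV (gtr0_norm T0) ler_pdivrMr// => h'; apply: le_trans h' _.
  by rewrite [leRHS]mulrC ler_pM2r// /M; lra.
rewrite (@expectationD _ _ _ _ mass _ _ e (2 * M)) => //; last 2 first.
- by move=> w; rewrite ger0_norm// ltW.
- by move=> w; rewrite normrM ger0_norm// ler_piMr.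
rewrite (expectation_cst mass) (@expectationZ _ _ _ _ mass _ 1)//.
by rewrite lerD2l ler_wpM2l.
Qed.

(** The mean displacement per unit time tends to [v]; by the forward equation it is the time average
    of the truncated jump term, which is close to the drift after the initial time [s1]. *)
Lemma drift_speed e : 0 < e -> exists2 T0 : R, 0 < T0 & forall T, T0 <= T ->
  `|time_mean W p0 (seen (drift a)) T - v| <= e.
Proof.
move=> e0; have mass := process_total W p0.
(* The error is [2 * e1] plus [(2 * Bd + 2 * M) * d] plus the initial contribution, at most [e / 4]
   each. *)
pose e1 := Num.min 1 (e / 8); pose d := e / 4 / (2 * Bd + 2 * M + 1).
have den0 : 0 < 2 * Bd + 2 * M + 1 by rewrite ltr_wpDl// addr_ge0// mulr_ge0.
have e10 : 0 < e1 by rewrite lt_min ltr01 divr_gt0.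
have e11 : e1 <= 1 by rewrite ge_min lexx.
have e18 : e1 <= e / 8 by rewrite ge_min lexx orbT.
have d0 : 0 < d by rewrite !divr_gt0.
have [s1 s10 h1] := far_rare ltr01 d0; have [s2 s20 h2] := far_rare e10 d0.
have [T1 T10 h3] := jump_near e10.
(* Beyond [T3] the initial time [s1] contributes at most [e / 4] to the average. *)
pose T3 := 2 * Bd * s1 / (e / 4).
have e40 : 0 < e / 4 by rewrite divr_gt0.
have T30 : 0 <= T3 by rewrite /T3 mulr_ge0 ?invr_ge0 ?(ltW e40)// mulr_ge0 ?(ltW s10)// mulr_ge0.
exists (s1 + s2 + T1 + T3); first by rewrite ltr_wpDr// !addr_gt0.
move=> T hT; have T0 : 0 < T by move: hT; lra.
have T1T : T1 <= T by move: hT; lra.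
have s1T : s1 <= T by move: hT; lra.
have s2T : s2 <= T by move: hT; lra.
have T3T : T3 <= T by move: hT; lra.
have disp : `|T^-1 * semigroup W T (f T) p0 - v| <= e1 + 2 * M * d.
  by apply: displacement => //; [rewrite e10 e11|exact: h2].
have cd : continuous (seen (drift a)).
  by apply: seen_continuous; exact: drift_continuous.
have near : `|T^-1 * \int[@lebesgue_measure R]_(s in `[0%R, T]) semigroup W s (jump_part a (f T)) p0
    - time_mean W p0 (seen (drift a)) T| <= 2 * Bd * s1 / T + (e1 + 2 * Bd * d).
  have B20 : 0 <= 2 * Bd by rewrite mulr_ge0.
  apply: (@time_mean_near _ _ _ _ _ _ Bd Bd (2 * Bd) (e1 + 2 * Bd * d) s1) => //.
  - by move=> s _; apply: (expectation_bound mass) => w; exact: jump_bound.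
  - by rewrite addr_ge0 ?(ltW e10)// mulr_ge0// ltW.
  - by rewrite (ltW s10).
  move=> s /andP[s0 sT].
  have mo : measurable_fun [set: pathM R (Omega * site)%type]
      (fun w : Defs.path R (Omega * site)%type => outer T (w s)).
    by apply: measurable_path_eval => //; exact: outer_continuous.
  have mh : measurable_fun [set: pathM R (Omega * site)%type]
      (fun w : Defs.path R (Omega * site)%type => 2 * Bd * outer T (w s)).
    exact: measurable_funM.
  have on w : `|outer T w| <= 1 by rewrite ger0_norm; case/andP: (outer01 T w).
  apply: (@le_trans _ _ (\int[W p0]_(w in [set: pathM R (Omega * site)%type])
      (e1 + 2 * Bd * outer T (w s)))).
    apply: (@expectation_dist _ _ _ (W p0) _ _ _ Bd Bd (e1 + 2 * Bd)) => //.
    - by apply: measurable_path_eval.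
    - exact: measurable_funD.
    - move=> w; apply: le_trans (ler_normD _ _) _; rewrite (gtr0_norm e10) lerD2l.
      by rewrite normrM ger0_norm// ler_piMr.
    - by move=> w; exact: h3.
  rewrite (@expectationD _ _ _ _ mass _ _ e1 (2 * Bd)) => //; last 2 first.
  - by move=> w; rewrite gtr0_norm.
  - by move=> w; rewrite normrM ger0_norm// ler_piMr.
  rewrite (expectation_cst mass) (@expectationZ _ _ _ _ mass _ 1)// addrCA lerD2l.
  rewrite -mulrDr; apply: ler_wpM2l => //.
  have [ss1|s1s] := ltP s s1.
    rewrite indicE mem_set ?mulr1n; last by rewrite /= in_itv/= s0.
    apply: (@le_trans _ _ 1); last by rewrite lerDl ltW.
    by apply: le_trans (ler_norm _) (expectation_bound mass _) => w.
  rewrite indicE memNset ?mulr0n ?add0r; last by rewrite /= in_itv/= s0/= ltNge s1s.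
  apply: le_trans (h1 s s1s).
  apply: (@expectation_le _ _ _ _ mass _ _ 1) => // w.
  by apply: outer_far; rewrite sT (lt_le_trans s10).
rewrite forward// in near.
have dB : (2 * Bd + 2 * M) * d <= e / 4.
  rewrite /d mulrCA -[leRHS]mulr1 ler_wpM2l ?(ltW e40)//.
  by rewrite ler_pdivrMr// mul1r lerDl.
have sT : 2 * Bd * s1 / T <= e / 4 by rewrite ler_pdivrMr// [leRHS]mulrC -ler_pdivrMr.
move: near disp dB sT; rewrite [(_ + 2 * M) * d]mulrDl.
set A := T^-1 * _; set B := time_mean _ _ _ _ => near disp dB sT.
rewrite (_ : B - v = (A - v) - (A - B)); last by ring.
apply: le_trans (ler_normB _ _) _; move: near disp dB sT e18 e0.
move: (2 * Bd * d) (2 * M * d) (2 * Bd * s1 / T) `|_ - _| `|_ - _| => x1 x2 x3 x4 x5.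
by clearbody e1; lra.
Qed.

End speed.

(** * Limits of means along an ultrafilter *)

Lemma ultra_map (T U : Type) (f : T -> U) (F : set_system T) :
  UltraFilter F -> UltraFilter (f @ F).
Proof.
move=> uF; split; first exact: fmap_proper_filter.
move=> G pG FG; apply/seteqP; split=> // B GB.
have [//|FnB] := in_ultra_setVsetC (f @^-1` B) uF.
have /FG GnB : (f @ F) (~` B) by [].
have : G (B `&` ~` B) by exact: filterI.
by rewrite setICr => /filter_not_empty.
Qed.

Section mean_limit.
Context (R : realType) (S : ptopologicalType) (T : Type) (F : set_system T)
  (PF : ProperFilter F).
Hypothesis cS : compact [set: S].
Variable A : T -> (S -> R) -> R.
Hypotheses
  (A_add : forall f g : S -> R, continuous f -> continuous g ->
    \forall t \near F, A t (fun x => f x + g x) = A t f + A t g)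
  (A_scale : forall (c : R) (f : S -> R), continuous f -> \forall t \near F, A t (fun x => c * f x) = c * A t f)
  (A_ge0 : forall f : S -> R, continuous f -> (forall x, 0 <= f x) -> \forall t \near F, 0 <= A t f)
  (A_1 : \forall t \near F, A t (fun=> 1) = 1).

(** Positivity is tested on [f + M]. *)
Let A_lower (f : S -> R) (M : R) : continuous f -> (forall x, - M <= f x) ->
  \forall t \near F, - M <= A t f.
Proof.
move=> cf fM.
have c1 : continuous ((fun=> 1) : S -> R) by move=> x; exact: cst_continuous.
have cM : continuous (fun x : S => M * 1 : R) by exact: continuous_scale.
have h1 := A_add cf cM; have h2 := A_scale M c1.
have h3 : \forall t \near F, 0 <= A t (fun x => f x + M * 1).
  apply: A_ge0; first exact: continuous_add.
  by move=> x; rewrite mulr1 -lerBlDr sub0r.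
near=> t; have : 0 <= A t (fun x => f x + M * 1) by near: t.
have -> : A t (fun x => f x + M * 1) = A t f + A t (fun x => M * 1) by near: t.
have -> : A t (fun x => M * 1) = M * A t (fun=> 1) by near: t.
have -> : A t (fun=> 1) = 1 by near: t.
by rewrite mulr1 -lerBlDr sub0r.
Unshelve. all: by end_near. Qed.

Let A_bound (f : S -> R) (M : R) : continuous f -> (forall x, `|f x| <= M) ->
  \forall t \near F, `|A t f| <= M.
Proof.
move=> cf fM; have h1 : \forall t \near F, - M <= A t f.
  by apply: A_lower => // x; have := fM x; rewrite ler_norml => /andP[].
have h2 : \forall t \near F, - M <= A t (fun x => -1 * f x).
  apply: A_lower; first exact: continuous_scale.
  by move=> x; have := fM x; rewrite mulN1r lerN2 ler_norml => /andP[].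
have h3 := A_scale (-1) cf.
near=> t; rewrite ler_norml; apply/andP; split; first by near: t.
rewrite -lerN2 -[- A t f]mulN1r.
by have <- : A t (fun x => -1 * f x) = -1 * A t f; near: t.
Unshelve. all: by end_near. Qed.

(** The values of each continuous function eventually stay in a compact segment, so along an
    ultrafilter they all converge at once. The axioms of a mean are asked only eventually, as time
    averages satisfy them for positive times. *)
Lemma mean_limit : exists (U : set_system T) (L : (S -> R) -> R),
  [/\ ProperFilter U, F `<=` U, mean L &
      forall f : S -> R, continuous f -> A t f @[t --> U] --> L f].
Proof.
have [U [uU FU]] := ultraFilterLemma PF; have pU : ProperFilter U := @ultra_proper _ _ uU.
have cvgA (f : S -> R) : continuous f -> cvg (A t f @[t --> U]).
  move=> cf; have [M fM] := compact_bounded_fun cS cf.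
  have := @segment_compact R (- M) M; rewrite compact_ultra => /(_ (A ^~ f @ U)).
  have uA : UltraFilter (A ^~ f @ U) by exact: ultra_map.
  have UM : (A ^~ f @ U) (`[- M, M]%classic : set R).
    apply: FU; apply: filterS (A_bound cf fM) => t.
    by rewrite ler_norml /= in_itv.
  by move=> /(_ uA UM)[l [_ Al]]; apply/cvg_ex; exists l.
pose L (f : S -> R) : R := lim (A t f @[t --> U]).
have lim_near (u w : T -> R) (l l' : R) : u t @[t --> U] --> l -> w t @[t --> U] --> l' ->
    (\forall t \near F, u t = w t) -> l = l'.
  move=> ul wl uw; apply: (cvg_unique (@Rhausdorff R) ul).
  apply: cvg_trans wl; apply: near_eq_cvg; apply: FU.
  by apply: filterS uw => t ->.
exists U, L; split => //; split=> [f g cf cg|c f cf|f cf f0|].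
- apply: (lim_near _ _ _ _ (cvgA _ (continuous_add cf cg)) _ (A_add cf cg)).
  by apply: cvgD; exact: cvgA.
- have cc := continuous_scale (c := c) cf.
  have cl : (fun t => c * A t f) @ U --> c * L f by apply: cvgM; [exact: cvg_cst|exact: cvgA].
  exact: (lim_near _ _ _ _ (cvgA _ cc) cl (A_scale c cf)).
- by apply: limr_ge; [exact: cvgA|apply: FU; exact: A_ge0].
- by apply: (lim_near _ _ _ _ (cvgA _ _) (cvg_cst _) A_1); exact: cst_continuous.
Qed.

End mean_limit.

Section walk_mean.
Context (R : realType) (E : pmetricType R) (P : process R (config E)).
Local Notation Omega := (config E).
Hypotheses (cE : compact [set: E]) (TP : translation_invariant P).
Variables (a : Omega -> int -> R) (W : process R (Omega * site)%type) (v : R).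
Hypotheses (a_rates : jump_rates a) (a_adm : (rates_norm1 a < +oo)%E)
  (W_walker : walker P a W) (W_speed : asymptotic_speed W v).

Let cO := config_compact cE.
Let p0 : Omega * site := (point, 0 : site).

Let pos_near : \forall t \near (+oo : set_system R), 0 < t.
Proof. by apply: nbhs_pinfty_gt; exact: num_real. Qed.

(** A limit of the time averages: [drift_speed] gives its value on the drift, and the term
    [2 * M / t] of [time_mean_generator] disappears. *)
Lemma walk_mean : exists L : (Omega -> R) -> R, [/\ mean L, L (drift a) = v &
  forall (F G H : Omega -> R) (kappa : R), generator P F G -> continuous H ->
    (forall eta, `|G eta + walk_jumps a F eta - H eta| <= kappa) -> `|L H| <= kappa].
Proof.
pose A (t : R) (f : Omega -> R) := time_mean W p0 (seen f) t.
have A_add (f g : Omega -> R) : continuous f -> continuous g ->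
    \forall t \near (+oo : set_system R), A t (fun x => f x + g x) = A t f + A t g.
  move=> cf cg; apply: filterS pos_near => t /ltW t0.
  have [M fM] := compact_bounded_fun cO cf; have [N gN] := compact_bounded_fun cO cg.
  have sf := seen_continuous cf; have sg := seen_continuous cg.
  exact: (@time_meanD _ _ W p0 (seen f) (seen g) M N t t0 sf sg (fun q => fM _) (fun q => gN _)).
have A_scale (c : R) (f : Omega -> R) : continuous f ->
    \forall t \near (+oo : set_system R), A t (fun x => c * f x) = c * A t f.
  move=> cf; apply: filterS pos_near => t /ltW t0.
  have [M fM] := compact_bounded_fun cO cf; have sf := seen_continuous cf.
  exact: (@time_meanZ _ _ W p0 (seen f) M c t t0 sf (fun q => fM _)).
have A_ge0 (f : Omega -> R) : continuous f -> (forall x, 0 <= f x) ->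
    \forall t \near (+oo : set_system R), 0 <= A t f.
  move=> cf f0; apply: filterS pos_near => t /ltW t0.
  by apply: time_mean_ge0 => // q; exact: f0.
have A_1 : \forall t \near (+oo : set_system R), A t (fun=> 1) = 1.
  apply: filterS pos_near => t t0; rewrite /A /time_mean.
  have -> : \int[@lebesgue_measure R]_(s in `[0%R, t]) semigroup W s (seen (fun=> 1)) p0 =
      \int[@lebesgue_measure R]_(s in `[0%R, t]) 1.
    by apply: eq_Rintegral => s _; exact: semigroup_cst.
  rewrite Rintegral_cst//= lebesgue_measure_itv/= lte_fin t0 /= subr0 mul1r mulVf//.
  by rewrite gt_eqF.
have [U [L [pU FU mL cL]]] := @mean_limit R Omega R (+oo : set_system R) _ cO A A_add A_scale A_ge0 A_1.
exists L; split => //.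
  apply: (cvg_unique (@Rhausdorff R) (cL _ _)); first exact: drift_continuous.
  apply/cvgrPdist_le => e e0; apply: FU.
  have [T0 T00 hT] := drift_speed a_rates a_adm W_walker W_speed e0.
  apply: filterS (nbhs_pinfty_ge (num_real T0)) => T TT.
  by rewrite distrC; exact: hT.
move=> F G H kappa FG cH GH; apply/ler_addgt0Pl => e e0.
have [M FM] : exists M : R, forall eta, `|F eta| <= M.
  by apply: compact_bounded_fun => //; case: FG.
have M0 : 0 <= M by exact: le_trans (normr_ge0 _) (FM point).
suff : `|A t H| @[t --> U] --> `|L H|.
  move=> cN; apply: (cvgr_to_le cN); apply: FU.
  have D0 : 0 <= 2 * M / e by rewrite mulr_ge0 ?invr_ge0 ?(ltW e0)// mulr_ge0.
  apply: filterS (nbhs_pinfty_gt (num_real (2 * M / e))) => t Mt.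
  have t0 : 0 < t by exact: le_lt_trans Mt.
  apply: le_trans (time_mean_generator cE TP W_walker _ FG t0 FM cH GH) _.
  by rewrite lerD2r ler_pdivrMr// [leRHS]mulrC -ler_pdivrMr// ltW.
by apply: cvg_norm; exact: cL.
Qed.

End walk_mean.

(** * Signed sums and expectations *)

Lemma sumZE (R : realType) (M u : int -> R) : dominating M -> (forall z, `|u z| <= M z) ->
  sumZ (fun z => (u z)%:E) = (sumR u)%:E.
Proof.
move=> dM uM; rewrite /sumR fineK//.
have fin (f : int -> \bar R) : (forall z, 0 <= f z <= (M z)%:E)%E ->
    (\esum_(z in [set: int]) f z)%E \is a fin_num.
  move=> fM; rewrite ge0_fin_numE; last by apply: esum_ge0 => z _; case/andP: (fM z).
  case: dM => _; apply: le_lt_trans; apply: le_esum => z _; by case/andP: (fM z).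
rewrite /sumZ fin_numB; apply/andP; split; apply: fin => z.
- rewrite funepos_ge0 funeposE ge_max !lee_fin (le_trans (ler_norm _) (uM z)).
  by case: dM => ->.
- rewrite funeneg_ge0 funenegE ge_max -EFinN !lee_fin (le_trans _ (uM z)).
    by case: dM => ->.
  by rewrite -normrN ler_norm.
Qed.

Lemma sumZ_ge0E (R : realType) (u : int -> \bar R) : (forall z, 0 <= u z)%E ->
  sumZ u = (\esum_(z in [set: int]) u z)%E.
Proof.
move=> u0; rewrite /sumZ [X in (_ - X)%E](_ : _ = 0%E) ?sube0; last first.
  apply: esum1 => z _; apply: (@ge0_funenegE _ _ setT); rewrite ?inE//.
by apply: eq_esum => z _; apply: (@ge0_funeposE _ _ setT); rewrite ?inE.
Qed.

Section expected_sums.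
Context d (T : measurableType d) (R : realType) (mu : probability T R).

Let mu1 : mu setT = 1%E := probability_setT mu.

Lemma expectation_seq (u : T -> int -> R) (M : int -> R) (s : seq int) :
  (forall z, measurable_fun setT (u ^~ z)) -> (forall x z, `|u x z| <= M z) ->
  \int[mu]_x (\sum_(z <- s) u x z) = \sum_(z <- s) \int[mu]_x u x z.
Proof.
move=> mu_ uM; elim: s => [|z s IHs].
  by under eq_Rintegral do rewrite big_nil; rewrite big_nil (expectation_cst mu1).
under eq_Rintegral do rewrite big_cons.
rewrite big_cons -IHs; apply: (@expectationD _ _ _ _ mu1 _ _ (M z) (\sum_(y <- s) M y)) => //.
  exact: measurable_sum.
by move=> x; apply: le_trans (ler_norm_sum _ _ _) _; exact: ler_sum.
Qed.

Variable u : T -> int -> R.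
Hypothesis mu_ : forall z, measurable_fun setT (u ^~ z).

Lemma expectation_sumR (M : int -> R) : dominating M -> (forall x z, `|u x z| <= M z) ->
  \int[mu]_x sumR (u x) = sumR (fun z => \int[mu]_x u x z).
Proof.
move=> dM uM; apply/eqP; rewrite -subr_eq0 -normr_le0; apply/ler_addgt0Pl => e e0.
rewrite addr0; have e20 : 0 < e / 2 by rewrite divr_gt0.
have [s hs] := sumR_approx dM e20.
have h1 : `|sumR (fun z => \int[mu]_x u x z) - \sum_(z <- s) \int[mu]_x u x z| <= e / 2.
  by apply: hs => z; apply: (expectation_bound mu1) => x; exact: uM.
have h2 : `|\int[mu]_x sumR (u x) - \int[mu]_x (\sum_(z <- s) u x z)| <= e / 2.
  apply: (@expectation_near _ _ _ _ mu1 _ _ (fine (\esum_(z in setT) (M z)%:E)%E)).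
  - by move=> x; exact: sumR_bound.
  - exact: measurable_sum.
  - by move=> x; apply: hs.
rewrite (expectation_seq _ mu_ uM) in h2; move: h1 h2.
set A := sumR _; set B := \sum_(_ <- _) _; set D := \int[mu]_x _ => h1 h2.
rewrite (_ : D - A = (D - B) - (A - B)); last by ring.
by rewrite [e]splitr; apply: le_trans (ler_normB _ _) _; exact: lerD.
Qed.

(** For a finite set of indices, the sum of the absolute expectations is at most the expectation of
    the sum of absolute values, hence at most [B]. *)
Lemma esum_expectation_le (B : R) :
  (forall x, \esum_(z in [set: int]) `|u x z|%:E <= B%:E)%E ->
  (\esum_(z in [set: int]) `|\int[mu]_x u x z|%:E <= B%:E)%E.
Proof.
move=> uB.
have bound (s : seq int) x : uniq s -> \sum_(z <- s) `|u x z| <= B.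
  move=> us; rewrite -lee_fin; apply: le_trans (uB x).
  rewrite -sumEFin fsbig_seq//; apply: ereal_sup_ubound; exists [set` s] => //.
  by split => //; exact: finite_seq.
have uBz x z : `|u x z| <= B by have := @bound [:: z] x isT; rewrite big_seq1.
apply: ge_ereal_sup => _ [F [finF _] <-].
rewrite fsbig_finite//= sumEFin lee_fin.
have mn z : measurable_fun setT (fun x => `|u x z|) by exact: measurableT_comp.
have us : uniq (finmap.enum_fset (fset_set F)) := finmap.fset_uniq _.
move: (finmap.enum_fset _) us => s us.
apply: (@le_trans _ _ (\sum_(z <- s) \int[mu]_x `|u x z|)).
  apply: ler_sum => z _; apply: le_normr_Rintegral => //.
  exact: (bounded_integrable mu1 (mu_ z) (uBz ^~ z)).
rewrite -(@expectation_seq (fun x z => `|u x z|) (fun=> B))//; last first.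
  by move=> x z; rewrite normr_id.
apply: le_trans (ler_norm _) (expectation_bound mu1 _) => x.
by rewrite ger0_norm ?sumr_ge0// bound.
Qed.

End expected_sums.

(** * The Einstein relation *)

Section einstein.
Context (R : realType) (E : pmetricType R).
Local Notation Omega := (config E).
Hypotheses (cE : compact [set: E]) (mdist_le1 : forall a b : E, mdist a b <= 1).
Variable PE : process R Omega.
Hypotheses (PE_feller : feller PE) (PE_transl : translation_invariant PE).
Variable muE : probability (borel Omega) R.
Hypothesis muE_ergodic : unique_ergodic PE muE.
Variables (alpha : R -> Omega -> int -> R) (alpha0 : int -> R) (alpha' : Omega -> int -> R) (C : R).
Hypotheses (alpha_rates : forall e : R, 0 <= e -> jump_rates (alpha e))
  (alpha_admissible : forall e : R, 0 <= e -> admissible (alpha e))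
  (alpha0E : forall eta z, alpha 0 eta z = alpha0 z)
  (alpha_diff : forall eta z,
     (alpha e eta z - alpha 0 eta z) / e @[e --> 0^'+] --> alpha' eta z)
  (alpha_diff1 : forall eta,
     (\esum_(z in [set: int])
        (`|z|%:~R * `|(alpha e eta z - alpha 0 eta z) / e - alpha' eta z|)%:E)%E
       @[e --> 0^'+] --> 0%E)
  (alpha_lip : forall e : R, 0 <= e ->
     (rates_tnorm1 (fun eta z => alpha e eta z - alpha 0 eta z)%R <=
      (C * e)%:E)%E).
Variables (W : R -> process R (Omega * site)%type) (v : R -> R).
Hypotheses (W_walker : forall e : R, 0 <= e -> walker PE (alpha e) (W e))
  (v_speed : forall e : R, 0 <= e -> asymptotic_speed (W e) (v e)).

Let cO := config_compact cE.

Let gain (e : R) (eta : Omega) : R := sumR (fun z => z%:~R * slope alpha e eta z).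

Let gain_term e eta z : 0 < e -> `|z%:~R * slope alpha e eta z| <= slope_sup alpha e z.
Proof.
move=> e0; rewrite normrM; apply: le_trans (slope_le_sup alpha_admissible eta z e0).
by rewrite /absz_ -intr_norm.
Qed.

Let slope_continuous e z : 0 < e -> continuous (fun eta => slope alpha e eta z).
Proof.
move=> e0; have [_ ce] := alpha_rates (ltW e0); have [_ c0] := alpha_rates (lexx 0).
have c := continuous_scale (c := e^-1) (continuous_sub (ce z) (c0 z)).
rewrite (_ : (fun eta => slope alpha e eta z) =
  fun eta => e^-1 * (alpha e eta z - alpha 0 eta z)) => [//|].
by apply/funext => eta; rewrite /slope mulrC.
Qed.

Let gain_continuous e : 0 < e -> continuous (gain e).
Proof.
move=> e0; apply: (sumR_continuous (slope_sup_dominating alpha_admissible e0)).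
  by move=> eta z; exact: gain_term.
by move=> z; apply: continuous_scale; exact: slope_continuous.
Qed.

Let slope_dominating e eta : 0 < e -> dominating (fun z => absz_ z * `|slope alpha e eta z|).
Proof.
move=> e0; apply: (@dominating_le _ (slope_sup alpha e)).
- by move=> z; rewrite mulr_ge0 ?absz_ge0.
- by move=> z; exact: slope_le_sup.
- exact: slope_sup_dominating.
Qed.

Let uniform_cauchy := @slope_uniform_cauchy R E cE mdist_le1 alpha alpha' C
  alpha_rates alpha_admissible alpha_diff1 alpha_lip.

Let gain_near (kappa : R) : 0 < kappa -> exists2 d : R, 0 < d & forall e e' : R,
  0 < e < d -> 0 < e' < d -> forall eta, `|gain e eta - gain e' eta| <= kappa.
Proof.
move=> k0; have [d d0 hd] := uniform_cauchy k0; exists d => // e e' ed e'd eta.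
have e0 : 0 < e by case/andP: ed. have e'0 : 0 < e' by case/andP: e'd.
apply: le_trans (hd e e' ed e'd eta).
rewrite /gain -(sumRB (slope_sup_dominating alpha_admissible e0)
  (slope_sup_dominating alpha_admissible e'0)); last 2 first.
- by move=> z; exact: gain_term.
- by move=> z; exact: gain_term.
apply: sumR_norm_le; first exact: (slope_gap_dominating alpha_admissible).
by move=> z; rewrite -mulrBr normrM /absz_ -intr_norm.
Qed.

(** For small [e] the slopes are within 1 of the fixed slope at [d / 2], whose weighted norm is
    finite. *)
Let slope_total : exists d B : R, [/\ 0 < d, 0 <= B & forall e : R, 0 < e < d -> forall eta,
  sumR (fun z => absz_ z * `|slope alpha e eta z|) <= B].
Proof.
have [d d0 hd] := uniform_cauchy ltr01.
have d20 : 0 < d / 2 by rewrite divr_gt0.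
have d2d : 0 < d / 2 < d by rewrite d20/= ltr_pdivrMr// ltr_pMr// ltr1n.
have dS := slope_sup_dominating alpha_admissible d20.
pose B := fine (\esum_(z in [set: int]) (slope_sup alpha (d / 2) z)%:E)%E.
have B0 : 0 <= B by case: dS => S0 _; rewrite fine_ge0// esum_ge0// => z _; rewrite lee_fin.
exists d, (1 + B); split => //; first by rewrite addr_ge0.
move=> e ed eta; have e0 : 0 < e by case/andP: ed.
have part : sumR (fun z => absz_ z * `|slope alpha (d / 2) eta z|) <= B.
  apply: le_trans (ler_norm _) _; apply: sumR_bound => // z.
  by rewrite ger0_norm ?mulr_ge0 ?absz_ge0//; exact: slope_le_sup.
apply: le_trans (lerD (hd e (d / 2) ed d2d eta) part).
have dg := slope_gap_dominating alpha_admissible eta e0 d20; have ds := slope_dominating eta d20.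
have self (f : int -> R) z : dominating f -> `|f z| <= f z by case=> f0 _; rewrite ger0_norm.
rewrite -(sumRD dg ds (fun z => self _ _ dg) (fun z => self _ _ ds)).
apply: le_trans (ler_norm _) _; apply: sumR_norm_le; first exact: dominatingD.
move=> z; rewrite ger0_norm ?mulr_ge0 ?absz_ge0// -mulrDr ler_wpM2l ?absz_ge0//.
by apply: le_trans (ler_normD _ _); rewrite subrK.
Qed.

Let alpha0_ge0 z : 0 <= alpha0 z.
Proof. by rewrite -(alpha0E point); case: (alpha_rates (lexx 0)) => + _; exact. Qed.

Let alpha0_sum : dominating (fun z => absz_ z * alpha0 z).
Proof.
have [a0 _] := alpha_admissible (lexx 0).
apply: (@dominating_le _ (rate_sup (alpha 0))).
- by move=> z; rewrite mulr_ge0 ?absz_ge0.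
- by move=> z; have := rate_le_sup a0 point z; rewrite alpha0E ger0_norm.
- exact: rate_sup_dominating.
Qed.

(** The rates differ by [e] times the slope, and an increment of [F] is at most [2 * M * |z|]: it
    vanishes for [z = 0], and [|z| >= 1] otherwise. *)
Let jump_diff e F (M : R) B eta : 0 < e -> (forall eta, `|F eta| <= M) ->
  sumR (fun z => absz_ z * `|slope alpha e eta z|) <= B ->
  `|walk_jumps (alpha e) F eta - jumps alpha0 F eta| <= e * (2 * M * B).
Proof.
move=> e0 FM hB; have M0 : 0 <= M by exact: le_trans (normr_ge0 _) (FM point).
have [ae _] := alpha_admissible (ltW e0); have [a0 _] := alpha_admissible (lexx 0).
have M20 : 0 <= 2 * M by rewrite mulr_ge0.
have inc z : `|F (Defs.shift (- z) eta) - F eta| <= 2 * M * absz_ z.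
  have [->|z0] := eqVneq z 0; first by rewrite oppr0 shift0 subrr normr0 mulr_ge0 ?absz_ge0.
  apply: (@le_trans _ _ (2 * M)); last by rewrite ler_peMr// absz_ge1.
  by apply: le_trans (ler_normB _ _) _; rewrite mulr_natl mulr2n lerD.
have tb a z : (rates_norm1 a < +oo)%E ->
    `|a eta z * (F (Defs.shift (- z) eta) - F eta)| <= 2 * M * rate_sup a z.
  move=> ad; rewrite normrM; apply: (@le_trans _ _ (2 * M * (absz_ z * `|a eta z|))).
    by rewrite mulrA mulrC ler_wpM2r.
  by rewrite ler_wpM2l//; exact: rate_le_sup.
have de := dominatingZ M20 (rate_sup_dominating ae).
have d0 := dominatingZ M20 (rate_sup_dominating a0).
have -> : jumps alpha0 F eta = walk_jumps (alpha 0) F eta.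
  by rewrite /jumps /walk_jumps; congr sumR; apply/funext => z; rewrite alpha0E.
rewrite /walk_jumps -(sumRB de d0 (fun z => tb _ z ae) (fun z => tb _ z a0)).
have ds := slope_dominating eta e0.
have self z : `|absz_ z * `|slope alpha e eta z| | <= absz_ z * `|slope alpha e eta z|.
  by rewrite ger0_norm ?mulr_ge0 ?absz_ge0.
apply: (@le_trans _ _ (sumR (fun z => e * (2 * M) * (absz_ z * `|slope alpha e eta z|)))).
  apply: sumR_norm_le; first by apply: dominatingZ => //; rewrite mulr_ge0 ?(ltW e0).
  move=> z; rewrite -mulrBl normrM.
  have -> : alpha e eta z - alpha 0 eta z = e * slope alpha e eta z.
    by rewrite /slope mulrCA mulfV ?gt_eqF// mulr1.
  rewrite normrM (gtr0_norm e0) -!mulrA ler_pM2l// mulrC.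
  by apply: le_trans (ler_wpM2r _ (inc z)) _ => //; rewrite !mulrA.
by rewrite (sumRZ _ ds self) [leRHS]mulrA ler_wpM2l// mulr_ge0 ?(ltW e0).
Qed.

Let velocity_mean e (L : (Omega -> R) -> R) := [/\ mean L, L (drift (alpha e)) = v e &
  forall (F G H : Omega -> R) (kappa : R), generator PE F G -> continuous H ->
    (forall eta, `|G eta + walk_jumps (alpha e) F eta - H eta| <= kappa) -> `|L H| <= kappa].

Let velocity_mean_ex (e : R) : 0 <= e -> exists L, velocity_mean e L.
Proof.
move=> e0; have [ae _] := alpha_admissible e0.
have [L hL] := walk_mean cE PE_transl (alpha_rates e0) ae (W_walker e0) (v_speed e0).
by exists L.
Qed.

(** The drift of [alpha 0] is constant, so its mean, which is [v 0], is its value at every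
    configuration. *)
Let velocity_gain (e : R) L : 0 < e -> velocity_mean e L -> L (gain e) = (v e - v 0) / e.
Proof.
move=> e0 [mL Lv _]; have [L0 [mL0 L0v _]] := velocity_mean_ex (lexx 0).
have [a0 _] := alpha_admissible (lexx 0).
have v0E eta : drift (alpha 0) eta = v 0.
  rewrite -L0v -(mean_cst mL0 (drift (alpha 0) eta)); congr L0; apply/funext => xi.
  by rewrite /drift; congr sumR; apply/funext => z; rewrite !alpha0E.
have dS := slope_sup_dominating alpha_admissible e0.
have dE : drift (alpha e) = fun eta => v 0 + e * gain e eta.
  apply/funext => eta; rewrite -(v0E eta) /gain -(sumRZ e dS (fun z => gain_term eta z e0)).
  rewrite -(sumRD (rate_sup_dominating a0) (dominatingZ (ltW e0) dS)) => [|z|z].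
  - rewrite /drift; congr sumR; apply/funext => z.
    rewrite mulrCA -mulrDr /slope mulrCA mulfV ?gt_eqF// mulr1.
    by rewrite addrC subrK.
  - exact: drift_term.
  - by rewrite normrM gtr0_norm// ler_pM2l//; exact: gain_term.
have cg := gain_continuous e0.
have h : L (fun eta => v 0 + e * gain e eta) = v 0 + e * L (gain e).
  have [mD mZ _ _] := mL.
  rewrite mD; [|exact: cst_continuous|exact: continuous_scale].
  by rewrite (mean_cst mL) mZ.
by rewrite -Lv dE h addrAC subrr add0r mulrAC mulfV ?gt_eqF// mul1r.
Qed.

(** Suppose the quotient stays away from [m] along parameters [s n] tending to 0. Their means have a
    limit mean, which is integration against [muE]. As [gain (s n)] varies with n, it is first
    replaced by [gain e] for one fixed small [e], to which the convergence of the means applies. *)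
Lemma velocity_slope (m : R) :
  (forall kappa : R, 0 < kappa -> exists2 d : R, 0 < d & forall e, 0 < e < d ->
     `|\int[muE]_eta gain e eta - m| <= kappa) ->
  (v e - v 0) / e @[e --> 0^'+] --> m.
Proof.
move=> gm; apply/cvgrPdist_le => kappa k0; apply: contrapT => H.
have /choice[s sP] (n : nat) : exists e : R, 0 < e < n.+1%:R^-1 /\
    kappa < `|m - (v e - v 0) / e|.
  apply: contrapT => Hn; apply: H; apply/near0_rightP; exists n.+1%:R^-1 => //.
  by move=> e en; rewrite leNgt; apply/negP => h; apply: Hn; exists e.
have s0 n : 0 < s n by have [/andP[]] := sP n.
have s_small (d : R) : 0 < d -> \forall n \near \oo, s n < d.
  move=> d0; have := near_infty_natSinv_lt (PosNum d0).
  apply: filterS => n /= h; have [/andP[_ h'] _] := sP n; exact: lt_trans h.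
have /choice[A AP] (n : nat) : exists L, velocity_mean (s n) L.
  by apply: velocity_mean_ex; exact: ltW.
have mA n : mean (A n) by case: (AP n).
have [U [L [pU FU mL cL]]] : exists (U : set_system nat) (L : (Omega -> R) -> R),
    [/\ ProperFilter U, \oo `<=` U, mean L &
      forall f : Omega -> R, continuous f -> A n f @[n --> U] --> L f].
  apply: (@mean_limit R Omega nat \oo _ cO A).
  - by move=> f g cf cg; apply: nearW => n; case: (mA n) => + _ _ _; exact.
  - by move=> c f cf; apply: nearW => n; case: (mA n) => _ + _ _; exact.
  - by move=> f cf f0; apply: nearW => n; case: (mA n) => _ _ + _; exact.
  - by apply: nearW => n; case: (mA n).
have L_near (f : Omega -> R) (c k : R) : continuous f ->
    (\forall n \near \oo, `|c - A n f| <= k) -> `|c - L f| <= k.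
  move=> cf h; have cN : `|c - A n f| @[n --> U] --> `|c - L f|.
    by apply: cvg_norm; apply: cvgB; [exact: cvg_cst|exact: cL].
  by apply: (cvgr_to_le cN); exact: FU.
have L_mu (f : Omega -> R) : continuous f -> L f = \int[muE]_eta f eta.
  apply: (stationary_mean cE PE_feller PE_transl alpha0_ge0 alpha0_sum mL) => //.
  move=> F G FG; have [cF cG _] := FG; have [M FM] := compact_bounded_fun cO cF.
  have cH : continuous (fun eta => G eta + jumps alpha0 F eta).
    by apply: continuous_add => //; exact: (jumps_continuous cE alpha0_ge0 alpha0_sum).
  have M0 : 0 <= M by exact: le_trans (normr_ge0 _) (FM point).
  have [d [B [d0 B0 hB]]] := slope_total.
  have K0 : 0 <= 2 * M * B by rewrite !mulr_ge0.
  apply/eqP; rewrite -normr_le0 -normrN -sub0r; apply/ler_addgt0Pl => e e0; rewrite addr0.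
  (* The defect of stationarity is at most [s n * (2 * M * B)]; the [+ 1] avoids a zero
     denominator. *)
  apply: L_near => //; have e'0 : 0 < e / (2 * M * B + 1) by rewrite divr_gt0// ltr_wpDl.
  apply: filterS2 (s_small _ d0) (s_small _ e'0) => n sd se.
  rewrite sub0r normrN; have [_ _ hA] := AP n.
  apply: (hA F G) => // eta; rewrite opprD addrACA subrr add0r.
  have sdn : 0 < s n < d by rewrite s0.
  apply: le_trans (jump_diff (s0 n) FM (hB (s n) sdn eta)) _.
  apply: (@le_trans _ _ (s n * (2 * M * B + 1))); first by rewrite ler_pM2l// lerDl.
  by rewrite -ler_pdivlMr ?ltr_wpDl// ltW.
have k40 : 0 < kappa / 4 by rewrite divr_gt0.
have [d1 d10 h1] := gain_near k40; have [d2 d20 h2] := gm _ k40.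
pose e := Num.min d1 d2 / 2.
have m0 : 0 < Num.min d1 d2 by rewrite lt_min d10.
have em : e < Num.min d1 d2 by rewrite ltr_pdivrMr// ltr_pMr// ltr1n.
have e0 : 0 < e by rewrite divr_gt0.
have ed1 : 0 < e < d1 by rewrite e0 (lt_le_trans em)// ge_min lexx.
have ed2 : 0 < e < d2 by rewrite e0 (lt_le_trans em)// ge_min lexx orbT.
have near_mu := h2 e ed2; rewrite -L_mu in near_mu; last exact: gain_continuous.
have [n [nd nL]] : exists n, s n < d1 /\ `|L (gain e) - A n (gain e)| <= kappa / 4.
  have u1 : U [set n | s n < d1] by apply: FU; exact: s_small.
  have /cvgrPdist_le/(_ _ k40) u2 := cL _ (gain_continuous e0).
  by have [n [h3 h4]] := @filter_ex _ U _ _ (filterI u1 u2); exists n.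
have snd : 0 < s n < d1 by rewrite s0.
have close : `|A n (gain e) - A n (gain (s n))| <= kappa / 4.
  rewrite -(meanB (mA n)); [|exact: gain_continuous..].
  apply: (mean_bound (mA n)); last by move=> eta; exact: h1.
  by apply: continuous_sub; exact: gain_continuous.
have [_] := sP n; rewrite -(velocity_gain (s0 n) (AP n)) ltNge => /negP; apply.
move: nL close near_mu; set x := A n (gain (s n)); set y := A n (gain e); set w := L (gain e).
move=> nL close near_mu.
rewrite (_ : m - x = (w - y) + (y - x) - (w - m)); last by ring.
apply: le_trans (ler_normB _ _) _; apply: le_trans (lerD (ler_normD _ _) (lexx _)) _.
by move: nL close near_mu; lra.
Qed.

(** The derivative is the pointwise limit of the continuous slopes along [1/(n+1)]. *)
Let rate_measurable z : measurable_fun [set: borel Omega] (alpha' ^~ z).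
Proof.
apply: (@measurable_fun_cvg _ (borel Omega) R setT (fun n eta => slope alpha n.+1%:R^-1 eta z)).
  move=> n; apply: continuous_borel; exact: slope_continuous.
move=> eta _; apply/cvgrPdist_le => e e0.
have /cvgrPdist_le/(_ e e0)/near0_rightP[d d0 hd] := @alpha_diff eta z.
have := near_infty_natSinv_lt (PosNum d0); apply: filterS => n /= nd.
by apply: hd; rewrite invr_gt0 ltr0n.
Qed.

Let tail (e : R) (eta : borel Omega) (z : int) : R :=
  z%:~R * (slope alpha e eta z - alpha' eta z).

Let mean_rate z : R := \int[muE]_eta (z%:~R * alpha' eta z).

Let mu1 : muE setT = 1%E := probability_setT muE.

Let tail_measurable e z : 0 < e -> measurable_fun setT ((tail e) ^~ z).
Proof.
move=> e0; apply: measurable_funM => //; apply: measurable_funB => //.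
by apply: continuous_borel; exact: slope_continuous.
Qed.

Let tail_small (kappa : R) : 0 < kappa -> exists2 d : R, 0 < d & forall e : R, 0 < e < d ->
  forall eta, (\esum_(z in [set: int]) `|tail e eta z|%:E <= kappa%:E)%E.
Proof.
move=> k0; have [d d0 hd] := @slope_uniform R E cE mdist_le1 alpha alpha' C
  alpha_rates alpha_admissible alpha_diff1 alpha_lip _ k0.
exists d => // e ed eta; apply: le_trans (hd e ed eta).
by apply: le_esum => z _; rewrite /tail normrM /absz_ -intr_norm.
Qed.

Let tail_term e (kappa : R) eta z :
  (\esum_(y in [set: int]) `|tail e eta y|%:E <= kappa%:E)%E -> `|tail e eta z| <= kappa.
Proof.
move=> h; rewrite -lee_fin; apply: le_trans h.
by rewrite (esum_compl [set z]) ?esum_set1// leeDl// esum_ge0.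
Qed.

Let rate_bound z : exists M : R, forall eta, `|z%:~R * alpha' eta z| <= M.
Proof.
have [d d0 hd] := tail_small ltr01.
have d2d : 0 < d / 2 < d by rewrite divr_gt0//= ltr_pdivrMr// ltr_pMr// ltr1n.
have e0 : 0 < d / 2 by case/andP: d2d.
exists (slope_sup alpha (d / 2) z + 1) => eta.
have -> : z%:~R * alpha' eta z = z%:~R * slope alpha (d / 2) eta z - tail (d / 2) eta z.
  by rewrite /tail; ring.
apply: le_trans (ler_normB _ _) _; apply: lerD; first exact: gain_term.
exact: tail_term (hd _ d2d eta).
Qed.

Let mean_rateE (e kappa : R) z : 0 < e ->
  (forall eta, \esum_(y in [set: int]) `|tail e eta y|%:E <= kappa%:E)%E ->
  mean_rate z = \int[muE]_eta (z%:~R * slope alpha e eta z) - \int[muE]_eta tail e eta z.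
Proof.
move=> e0 h.
have ms : measurable_fun setT (fun eta : borel Omega => z%:~R * slope alpha e eta z).
  by apply: measurable_funM => //; apply: continuous_borel; exact: slope_continuous.
have tk eta : `|tail e eta z| <= kappa by exact: tail_term.
rewrite -RintegralB//; last 2 first.
- exact: (bounded_integrable mu1 ms (fun eta => gain_term eta z e0)).
- exact: (bounded_integrable mu1 (tail_measurable z e0) tk).
by rewrite /mean_rate; apply: eq_Rintegral => eta _; rewrite /tail; ring.
Qed.

Let mean_slope_bound e z : 0 < e ->
  `|\int[muE]_eta (z%:~R * slope alpha e eta z)| <= slope_sup alpha e z.
Proof. by move=> e0; apply: (expectation_bound mu1) => eta; exact: gain_term. Qed.

Let tail_dominating e (kappa : R) : 0 < e ->
  (forall eta, \esum_(y in [set: int]) `|tail e eta y|%:E <= kappa%:E)%E ->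
  dominating (fun z => `|\int[muE]_eta tail e eta z|) /\
  `|sumR (fun z => \int[muE]_eta tail e eta z)| <= kappa.
Proof.
move=> e0 h; have le := esum_expectation_le muE (fun z => tail_measurable z e0) h.
have dt : dominating (fun z => `|\int[muE]_eta tail e eta z|).
  by split=> // ; apply: le_lt_trans le _; rewrite ltry.
split=> //; apply: (@le_trans _ _ (fine (\esum_(z in setT) `|\int[muE]_eta tail e eta z|%:E)%E)).
  exact: sumR_bound.
by rewrite -lee_fin fineK//; exact: dominating_fin dt.
Qed.

Let mean_rate_dominated : exists2 M, dominating M & forall z, `|mean_rate z| <= M z.
Proof.
have [d d0 hd] := tail_small ltr01.
have d2d : 0 < d / 2 < d by rewrite divr_gt0//= ltr_pdivrMr// ltr_pMr// ltr1n.
have e0 : 0 < d / 2 by case/andP: d2d.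
have [dt _] := tail_dominating e0 (hd _ d2d).
exists (fun z => slope_sup alpha (d / 2) z + `|\int[muE]_eta tail (d / 2) eta z|).
  by apply: dominatingD => //; exact: slope_sup_dominating.
move=> z; rewrite (mean_rateE z e0 (hd _ d2d)).
by apply: le_trans (ler_normB _ _) _; rewrite lerD2r; exact: mean_slope_bound.
Qed.

(** At a fixed [e] the majorant of the slopes allows exchanging sum and expectation; the remainders
    [tail], summed in absolute value, are at most [kappa] uniformly in the environment. *)
Let mean_gain (kappa : R) : 0 < kappa -> exists2 d : R, 0 < d & forall e, 0 < e < d ->
  `|\int[muE]_eta gain e eta - sumR mean_rate| <= kappa.
Proof.
move=> k0; have [d d0 hd] := tail_small k0; exists d => // e ed.
have e0 : 0 < e by case/andP: ed.
have [dt tk] := tail_dominating e0 (hd e ed).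
have dS := slope_sup_dominating alpha_admissible e0.
have -> : mean_rate = fun z =>
    \int[muE]_eta (z%:~R * slope alpha e eta z) - \int[muE]_eta tail e eta z.
  by apply/funext => z; exact: mean_rateE (hd e ed).
rewrite (sumRB dS dt (fun z => mean_slope_bound z e0) (fun z => lexx _)).
rewrite /gain (@expectation_sumR _ (borel Omega) R muE _ _ _ dS).
- by rewrite opprB addrCA subrr addr0.
- by move=> z; apply: measurable_funM => //; apply: continuous_borel; exact: slope_continuous.
- by move=> eta z; exact: gain_term.
Qed.

Let mean_rate_EFin z : (z%:~R%:E * \int[muE]_eta (alpha' eta z)%:E)%E = (mean_rate z)%:E.
Proof.
(* The weight [|z|] gives no control of [alpha'] at [z = 0], but the factor 0 annihilates its
   integral, even an infinite one. *)
have [->|z0] := eqVneq z 0.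
  rewrite mul0e /mean_rate; congr EFin.
  rewrite -[LHS](expectation_cst mu1); apply: eq_Rintegral => eta _.
  by rewrite mul0r.
have [M hM] := rate_bound z.
have b eta : `|alpha' eta z| <= M.
  apply: le_trans (hM eta); rewrite normrM ler_peMl//.
  by rewrite -intr_norm; exact: absz_ge1.
have i := bounded_integrable mu1 (rate_measurable z) b.
rewrite /mean_rate RintegralZl// EFinM /Rintegral fineK//.
exact: integrable_fin_num i.
Qed.

Lemma velocity_slope_rate :
  ((v e - v 0) / e)%:E @[e --> 0^'+] -->
  sumZ (fun z => z%:~R%:E * \int[muE]_eta (alpha' eta z)%:E)%E.
Proof.
rewrite (_ : (fun z => _) = fun z => (mean_rate z)%:E); last first.
  by apply/funext => z; exact: mean_rate_EFin.
have [M dM rM] := mean_rate_dominated.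
rewrite (sumZE dM rM); apply: cvg_EFin; first exact: nearW.
exact: velocity_slope mean_gain.
Qed.

End einstein.

Theorem corollary4p3 (R : realType) (E : pmetricType R)
  (E_compact : compact [set: E])
  (mdist_le1 : forall a b : E, mdist a b <= 1)
  (PE : process R (config E))
  (PE_feller : feller PE)
  (PE_transl : translation_invariant PE)
  (muE : probability (borel (config E)) R)
  (muE_ergodic : unique_ergodic PE muE)
  (Q : process R (config E * config E)%type)
  (Q_coupling : strong_markov_coupling PE Q)
  (Q_mixing : (\int[@lebesgue_measure R]_(t in `[0%R, +oo[)
                 (t%:E * discrepancy Q t) < +oo)%E)
  (alpha : R -> config E -> int -> R)
  (alpha_rates : forall e, 0 <= e -> jump_rates (alpha e))
  (alpha_admissible : forall e, 0 <= e -> admissible (alpha e))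
  (alpha0 : int -> R)
  (alpha0E : forall eta z, alpha 0 eta z = alpha0 z)
  (alpha' : config E -> int -> R)
  (alpha_diff : forall eta z,
     (alpha e eta z - alpha 0 eta z) / e @[e --> 0^'+] --> alpha' eta z)
  (* Summability of the derivative in z: with differentiability for each fixed z
     only, mass of order e may escape to z = +oo as e tends to 0, and then the
     sum over z cannot be differentiated term by term. *)
  (alpha_diff1 : forall eta,
     (\esum_(z in [set: int])
        (`|z|%:~R * `|(alpha e eta z - alpha 0 eta z) / e - alpha' eta z|)%:E)%E
       @[e --> 0^'+] --> 0%E)
  (C : R) (C_gt0 : 0 < C)
  (alpha_lip : forall e, 0 <= e ->
     (rates_tnorm1 (fun eta z => alpha e eta z - alpha 0 eta z)%R <=
      (C * e)%:E)%E)
  (W : R -> process R (config E * site)%type)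
  (W_walker : forall e, 0 <= e -> walker PE (alpha e) (W e))
  (v : R -> R)
  (v_speed : forall e, 0 <= e -> asymptotic_speed (W e) (v e)) :
  let sigma2 := (\esum_(z in [set: int]) (z%:~R ^+ 2 * alpha0 z)%:E)%E in
  let Einstein := ((v e - v 0) / e)%:E @[e --> 0^'+] --> sigma2 in
  (Einstein <->
     sumZ (fun z => z%:~R%:E * \int[muE]_eta (alpha' eta z)%:E)%E = sigma2) /\
  ((forall z, (\int[muE]_eta (alpha' eta z)%:E = (z%:~R * alpha0 z)%:E)%E) ->
     Einstein).
Proof.
move=> sigma2 Einstein.
have lim := velocity_slope_rate E_compact mdist_le1 PE_feller PE_transl muE_ergodic
  alpha_rates alpha_admissible alpha0E alpha_diff alpha_diff1 alpha_lip W_walker v_speed.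
set drift_slope := sumZ _ in lim *.
(* The difference quotient always converges to the finite number [drift_slope], so the equivalence
   is uniqueness of limits in the extended reals. If [sigma2] is infinite, both sides fail. *)
have iff : Einstein <-> drift_slope = sigma2.
  split=> [|eq2]; last by rewrite /Einstein -eq2.
  exact: (cvg_unique (@ereal_hausdorff R) lim).
split => // h; apply/iff; rewrite /drift_slope.
have z2E z : (z%:~R%:E * \int[muE]_eta (alpha' eta z)%:E)%E = (z%:~R ^+ 2 * alpha0 z)%:E.
  by rewrite h -EFinM mulrA -expr2.
rewrite (_ : (fun z => _) = fun z => (z%:~R ^+ 2 * alpha0 z)%:E); last first.
  by apply/funext => z; exact: z2E.
(* All terms [z^2 * alpha0 z] are nonnegative, so the signed sum is the plain one. *)
apply: sumZ_ge0E => z; rewrite lee_fin mulr_ge0 ?sqr_ge0//.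
by rewrite -(alpha0E point); case: (alpha_rates 0 (lexx 0)) => + _; exact.
Qed.
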